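(* Let $\pi^b$ be the invariant probability measure of the broken system and $h=I_1\sin\theta_1+I_3\sin\theta_3$. For every $T_3>0$, if $\gamma>0$ and $T_1>0$ are sufficiently small, then $\mathrm{Var}_{\pi^b}[h]<\frac1{10}T_3^{2/3}$.
   Context: Broken system on $(0,\infty)^2\times\mathbb T^2$ ($\mathbb T=\mathbb R/2\pi\mathbb Z$), $\mathbf x^b=(I_1,I_3,\theta_1,\theta_3)$, parameters $\gamma,T_1,T_3>0$, independent Brownian motions: $dI_1=\gamma(T_1-I_1^3)dt+\sqrt{\gamma T_1I_1/2}dB^{(1)}_t$, $dI_3=\gamma(T_3-I_3^3)dt+\sqrt{\gamma T_3I_3/2}dB^{(2)}_t$, $d\theta_1=-[I_1(1+2\cos\theta_1)+2I_3\cos\theta_3]dt+\sqrt\gamma dB^{(3)}_t$, $d\theta_3=-[I_3(1+2\cos\theta_3)+2I_1\cos\theta_1]dt+\sqrt\gamma dB^{(4)}_t$. *)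

(* Defs.v *)
From HB Require Import structures.
From mathcomp Require Import all_boot all_order all_algebra.
From mathcomp Require Import all_classical all_reals all_analysis.
Set Implicit Arguments. Unset Strict Implicit. Unset Printing Implicit Defensive.
Import Order.TTheory GRing.Theory Num.Theory.
Import numFieldNormedType.Exports.
Local Open Scope classical_set_scope.
Local Open Scope ring_scope.

(* State space of the broken system: x = ((I1, I3), (theta1, theta3)).
   The torus T^2 is represented by 2*pi-periodic dependence on the angles. *)
Definition bstate (R : realType) := ((R * R) * (R * R))%type.

Section Broken.
Variable R : realType.

Definition eI1 : bstate R := ((1, 0), (0, 0)).
Definition eI3 : bstate R := ((0, 1), (0, 0)).
Definition eth1 : bstate R := ((0, 0), (1, 0)).
Definition eth3 : bstate R := ((0, 0), (0, 1)).

Definition bdirs : seq (bstate R) := [:: eI1; eI3; eth1; eth3].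

Definition C2 (f : bstate R -> R) : Prop :=
  forall v w, v \in bdirs -> w \in bdirs ->
    (forall x, derivable f x v) /\ continuous ('D_v f) /\
    (forall x, derivable ('D_v f) x w) /\ continuous ('D_w ('D_v f)).

Definition test_fun (f : bstate R -> R) : Prop :=
  [/\ C2 f,
      (forall i1 i3 t1 t3, f ((i1, i3), (t1 + 2 * pi, t3)) = f ((i1, i3), (t1, t3))),
      (forall i1 i3 t1 t3, f ((i1, i3), (t1, t3 + 2 * pi)) = f ((i1, i3), (t1, t3)))
    & exists a b : R, [/\ 0 < a, a <= b &
        forall x : bstate R, ~ (a <= x.1.1 <= b /\ a <= x.1.2 <= b) -> f x = 0]].

Definition gen_broken (gamma T1 T3 : R) (f : bstate R -> R) (x : bstate R) : R :=
  let I1 := x.1.1 in let I3 := x.1.2 in let t1 := x.2.1 in let t3 := x.2.2 in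
    gamma * (T1 - I1 ^+ 3) * 'D_eI1 f x
  + gamma * (T3 - I3 ^+ 3) * 'D_eI3 f x
  - (I1 * (1 + 2 * cos t1) + 2 * I3 * cos t3) * 'D_eth1 f x
  - (I3 * (1 + 2 * cos t3) + 2 * I1 * cos t1) * 'D_eth3 f x
  + (gamma * T1 * I1 / 2) / 2 * 'D_eI1 ('D_eI1 f) x
  + (gamma * T3 * I3 / 2) / 2 * 'D_eI3 ('D_eI3 f) x
  + gamma / 2 * 'D_eth1 ('D_eth1 f) x
  + gamma / 2 * 'D_eth3 ('D_eth3 f) x.

(* the state space (0,oo)^2 x [0,2pi)^2 (fundamental domain of the torus) *)
Definition bspace : set (bstate R) :=
  [set x | [/\ 0 < x.1.1, 0 < x.1.2, 0 <= x.2.1 < 2 * pi & 0 <= x.2.2 < 2 * pi]].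

Definition invariant_broken (gamma T1 T3 : R) (P : probability (bstate R) R) : Prop :=
  P bspace = 1%E /\
  forall f, test_fun f -> (\int[P]_x (gen_broken gamma T1 T3 f x)%:E = 0)%E.

Definition hfun (x : bstate R) : R := x.1.1 * sin x.2.1 + x.1.2 * sin x.2.2.

Definition variance_of (P : probability (bstate R) R) (g : bstate R -> R) : \bar R :=
  let m := fine (\int[P]_x (g x)%:E) in (\int[P]_x ((g x - m) ^+ 2)%:E)%E.

End Broken.

(* Main.v *)
(** Everything follows from one Lyapunov function V, proper on the quadrant, with
    (h - m0)^2 <= C - L V pointwise: testing invariance against (n - V)_+^3 and letting n
    grow gives E (h - m0)^2 <= C, and the variance is at most E (h - m0)^2.
    For small gamma and T1 the action I1 is negligible, so h is close to I3 sin theta3,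
    where theta3' = - I3 (1 + 2 cos theta3) has the attracting point - 2pi/3 and the
    repelling point 2pi/3. Hence sin theta3 is close to - sqrt 3 / 2 and the variance is
    3/4 of that of I3, which is less than 0.11 T3^(2/3) by an explicit polynomial
    solution of a Poisson inequality. Besides this polynomial, V contains a function of
    theta3 that forces 1 + 2 cos theta3 to be small, multiples of I1 and of
    I1^2 + I3^2 + 1/I1 + 1/I3 that absorb errors and give properness, and a barrier that
    keeps theta3 away from the repelling point. As I1 / I3 does not vanish, that point is
    in fact a repelling invariant curve; the noise is too small to dominate the error of
    replacing it by a point, so the barrier is built on a trigonometric sum that solves
    the invariance equation up to gamma. *)

(* The scales decide the form of the argument. Actions and noise move at rate [gamma], so every
   piece of V except the function of theta3 has a coefficient of order 1/[gamma], and an error in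
   the drift of the barrier is harmless only if it is [gamma] times something small. The gain of the
   barrier comes from the Ito correction, which raises the squared distance to the curve at rate at
   least [gamma]/4 even on the curve itself. A residual r in the curve equation enters as I3 r^2, so
   the tolerance [gamma] costs only [gamma]^2 I3. The approximating sum depends on [gamma], but its
   norm bound does not; hence all constants are fixed beforehand, in the order [lam], [kap], M, [a],
   [eta], [tau], followed by the thresholds for [gamma] and [T1]. In units of T3^(2/3) the main term
   is 11/10 * 3/4 * 11/100 = 363/4000, where 11/10 pays for a square completion, and eleven errors
   of 1/2000 each raise it to 385/4000 < 1/10. *)
Require Import Defs.
From HB Require Import structures.
From mathcomp Require Import all_boot all_order all_algebra.
From mathcomp Require Import all_classical all_reals all_analysis.
From mathcomp Require Import measurable_realfun ring lra.
Import Order.TTheory GRing.Theory Num.Theory.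
Import numFieldNormedType.Exports.
Set Implicit Arguments. Unset Strict Implicit. Unset Printing Implicit Defensive.
Local Open Scope classical_set_scope.
Local Open Scope ring_scope.

(** * Jets and the generator *)

Section Jets.
Context {R : realType}.
Notation st := (bstate R).
Implicit Types (f g : st -> R) (x v w : st).

(** Directional differentiability is differentiability in one real variable along the line through
    [x] with direction [v], where the ordinary chain rule applies. *)
Lemma is_derive_comp1 (phi : R -> R) f x v (dphi df : R) :
  is_derive x v f df -> is_derive (f x) 1 phi dphi ->
  is_derive x v (fun y => phi (f y)) (dphi * df).
Proof.
move=> [df_ <-] [dphi_ <-].
pose F h := f (h *: v + x).
have F0 : F 0 = f x by rewrite /F scale0r add0r.
have dF : derivable F 0 1 by exact: (derivable1P _ _ _).1.
have dphiF : derivable phi (F 0) 1 by rewrite F0.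
have dc : derivable (phi \o F) 0 1.
  apply/derivable1_diffP/differentiable_comp; exact: (derivable1_diffP _ _).1.
have dirE (g : st -> R) : 'D_v g x = 'D_1 (fun h : R => g (h *: v + x)) 0.
  rewrite /derive; set g1 := fun h => h^-1 *: _; set g2 := fun h => h^-1 *: _.
  suff -> : g1 = g2 by [].
  by rewrite funeqE /g1 /g2 => h /=; rewrite addr0 scale0r add0r [_%:A]mulr1.
apply: DeriveDef; first exact: (derivable1P _ _ _).2.
rewrite dirE [in RHS]dirE -/F -[LHS]derive1E (_ : (fun _ => _) = phi \o F) //.
by rewrite (derive1_comp dF dphiF) F0 2!derive1E.
Qed.

Lemma is_derive_lin f x v : (forall k a b, f (k *: a + b) = k * f a + f b) ->
  is_derive x v f (f v).
Proof.
move=> lf.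
have key : (fun h : R => h^-1 *: ((f \o shift x) (h *: v) - f x)) @ 0^' --> f v.
  apply: (@cvg_near_cst _ _ (f v)).
  near=> h; rewrite /= lf addrK /GRing.scale/= mulKf //.
  by near: h; exact: nbhs_dnbhs_neq.
apply: DeriveDef; first by apply/cvg_ex; exists (f v).
exact: cvg_lim key.
Unshelve. all: by end_near. Qed.

Definition pquad : set st := [set x | 0 < x.1.1 /\ 0 < x.1.2].

(* Value, first and second directional derivatives of a function on [pquad]. *)
Record jet := Jet { jv : st -> R; j1 : st -> st -> R; j2 : st -> st -> st -> R }.

(** Carrying explicit derivatives next to the value turns later computations with the generator into
    polynomial or rational identities. All ordered pairs of directions are kept because [C2] asks
    for mixed second derivatives. *)
Definition jet_ok (J : jet) := forall x, pquad x ->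
  {for x, continuous (jv J)} /\
  forall v, is_derive x v (jv J) (j1 J v x) /\ {for x, continuous (j1 J v)} /\
  forall w, is_derive x w (j1 J v) (j2 J v w x) /\ {for x, continuous (j2 J v w)}.

Definition jcst c := Jet (fun=> c) (fun _ _ => 0) (fun _ _ _ => 0).
Definition jlin f := Jet f (fun v _ => f v) (fun _ _ _ => 0).
Definition jadd J K := Jet (fun x => jv J x + jv K x)
  (fun v x => j1 J v x + j1 K v x) (fun v w x => j2 J v w x + j2 K v w x).
Definition jmul J K := Jet (fun x => jv J x * jv K x)
  (fun v x => jv J x * j1 K v x + jv K x * j1 J v x)
  (fun v w x => (jv J x * j2 K v w x + j1 K v x * j1 J w x)
              + (jv K x * j2 J v w x + j1 J v x * j1 K w x)).
Definition jcomp (p p1 p2 : R -> R) J := Jet (fun x => p (jv J x))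
  (fun v x => p1 (jv J x) * j1 J v x)
  (fun v w x => p1 (jv J x) * j2 J v w x + j1 J v x * (p2 (jv J x) * j1 J w x)).

Lemma jcst_ok c : jet_ok (jcst c).
Proof.
move=> x _; split; first exact: cvg_cst.
by move=> v; split; [exact: is_derive_cst|split; [exact: cvg_cst|
  move=> w; split; [exact: is_derive_cst|exact: cvg_cst]]].
Qed.

Lemma jlin_ok f : (forall k a b, f (k *: a + b) = k * f a + f b) ->
  continuous f -> jet_ok (jlin f).
Proof.
move=> lf cf x _; split; first exact: cf.
by move=> v; split; [exact: is_derive_lin|split; [exact: cvg_cst|
  move=> w; split; [exact: is_derive_cst|exact: cvg_cst]]].
Qed.

Lemma is_deriveDf f g x v df dg : is_derive x v f df -> is_derive x v g dg ->
  is_derive x v (fun y => f y + g y) (df + dg).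
Proof. exact: is_deriveD. Qed.

Lemma is_deriveMf f g x v df dg : is_derive x v f df -> is_derive x v g dg ->
  is_derive x v (fun y => f y * g y) (f x * dg + g x * df).
Proof. exact: is_deriveM. Qed.

Lemma jadd_ok J K : jet_ok J -> jet_ok K -> jet_ok (jadd J K).
Proof.
move=> hJ hK x qx; have [cJ dJ] := hJ x qx; have [cK dK] := hK x qx.
split; first exact: continuousD.
move=> v; have [J1 [cJ1 J2]] := dJ v; have [K1 [cK1 K2]] := dK v.
split; first exact: is_deriveDf.
split; first exact: continuousD.
move=> w; have [J3 J4] := J2 w; have [K3 K4] := K2 w.
by split; [exact: is_deriveDf|exact: continuousD].
Qed.

Lemma jmul_ok J K : jet_ok J -> jet_ok K -> jet_ok (jmul J K).
Proof.
move=> hJ hK x qx; have [cJ dJ] := hJ x qx; have [cK dK] := hK x qx.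
split; first exact: continuousM.
move=> v; have [J1 [cJ1 J2]] := dJ v; have [K1 [cK1 K2]] := dK v.
split; first exact: is_deriveMf.
split; first by apply: continuousD; apply: continuousM.
move=> w; have [J3 J4] := J2 w; have [K3 K4] := K2 w.
have [J1' [cJ1' _]] := dJ w; have [K1' [cK1' _]] := dK w.
split; first by apply: is_deriveDf; apply: is_deriveMf.
by apply: continuousD; apply: continuousD; apply: continuousM.
Qed.

Lemma jcomp_ok p p1 p2 J : jet_ok J ->
  (forall x, pquad x -> [/\ is_derive (jv J x) 1 p (p1 (jv J x)),
     is_derive (jv J x) 1 p1 (p2 (jv J x)) & {for jv J x, continuous p2}]) ->
  jet_ok (jcomp p p1 p2 J).
Proof.
move=> hJ hp x qx; have [cJ dJ] := hJ x qx; have [P1 P2 cP2] := hp x qx.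
have cP : {for jv J x, continuous p}.
  by apply/differentiable_continuous/derivable1_diffP.
have cP1 : {for jv J x, continuous p1}.
  by apply/differentiable_continuous/derivable1_diffP.
split; first exact: continuous_comp.
move=> v; have [J1 [cJ1 J2]] := dJ v.
split; first exact: is_derive_comp1.
split; first by apply: continuousM => //; exact: continuous_comp.
move=> w; have [J3 J4] := J2 w; have [J1' [cJ1' _]] := dJ w.
split; first by apply: is_deriveMf => //; exact: is_derive_comp1.
apply: continuousD; apply: continuousM => //; first exact: continuous_comp.
by apply: continuousM => //; exact: continuous_comp.
Qed.

End Jets.

(** * Extension by zero from the quadrant to a test function *)

Section Extension.
Context {R : realType}.
Notation st := (bstate R).
Implicit Types (f g : st -> R) (x v w : st).

Definition jgen (gamma T1 T3 : R) (J : @jet R) x : R :=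
    gamma * (T1 - x.1.1 ^+ 3) * j1 J (eI1 R) x
  + gamma * (T3 - x.1.2 ^+ 3) * j1 J (eI3 R) x
  - (x.1.1 * (1 + 2 * cos x.2.1) + 2 * x.1.2 * cos x.2.2) * j1 J (eth1 R) x
  - (x.1.2 * (1 + 2 * cos x.2.2) + 2 * x.1.1 * cos x.2.1) * j1 J (eth3 R) x
  + (gamma * T1 * x.1.1 / 2) / 2 * j2 J (eI1 R) (eI1 R) x
  + (gamma * T3 * x.1.2 / 2) / 2 * j2 J (eI3 R) (eI3 R) x
  + gamma / 2 * j2 J (eth1 R) (eth1 R) x
  + gamma / 2 * j2 J (eth3 R) (eth3 R) x.

Definition torus_periodic f :=
  (forall i1 i3 t1 t3, f ((i1, i3), (t1 + 2 * pi, t3)) = f ((i1, i3), (t1, t3))) /\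
  (forall i1 i3 t1 t3, f ((i1, i3), (t1, t3 + 2 * pi)) = f ((i1, i3), (t1, t3))).

Definition box (a b : R) : set st :=
  [set x | a <= x.1.1 <= b /\ a <= x.1.2 <= b].

Lemma near_pquad x : pquad x -> \forall y \near x, pquad y.
Proof.
move=> [x1 x2].
have c1 : {for x, continuous (fun y : st => y.1.1)}.
  by apply: (@continuous_comp _ _ _ fst fst); exact: cvg_fst.
have c2 : {for x, continuous (fun y : st => y.1.2)}.
  by apply: (@continuous_comp _ _ _ fst snd); [exact: cvg_fst|exact: cvg_snd].
near=> y; split; near: y.
- exact: (cvgr_gt _ c1).
- exact: (cvgr_gt _ c2).
Unshelve. all: by end_near. Qed.

Lemma near_not_box a b x : ~ box a b x -> \forall y \near x, ~ box a b y.
Proof.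
have c1 : {for x, continuous (fun y : st => y.1.1)}.
  by apply: (@continuous_comp _ _ _ fst fst); exact: cvg_fst.
have c2 : {for x, continuous (fun y : st => y.1.2)}.
  by apply: (@continuous_comp _ _ _ fst snd); [exact: cvg_fst|exact: cvg_snd].
have aux (p : st -> R) : {for x, continuous p} -> ~~ (a <= p x <= b) ->
    \forall y \near x, ~~ (a <= p y <= b).
  move=> cp; rewrite negb_and -!ltNge => /orP[h|h].
    by near=> y; rewrite negb_and -!ltNge; apply/orP; left; near: y; exact: (cvgr_lt _ cp).
  by near=> y; rewrite negb_and -!ltNge; apply/orP; right; near: y; exact: (cvgr_gt _ cp).
move=> /not_andP[/negP h|/negP h].
- by have := aux _ c1 h; apply: filterS => y /negP + [].
- by have := aux _ c2 h; apply: filterS => y /negP + [].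
Unshelve. all: by end_near. Qed.

Lemma near_eq_continuous f g x : (\forall y \near x, g y = f y) ->
  {for x, continuous g} -> {for x, continuous f}.
Proof.
move=> fg cg; rewrite /prop_for /continuous_at -(nbhs_singleton fg).
exact: (cvg_trans (near_eq_cvg fg)).
Qed.

Definition jext (J : @jet R) x : R := if `[< pquad x >] then jv J x else 0.

Variables (J : @jet R) (a b : R).
Hypotheses (a0 : 0 < a) (okJ : jet_ok J).
Hypothesis suppJ : forall x, pquad x -> ~ box a b x -> jv J x = 0.

Let f := jext J.

Let box_pquad x : box a b x -> pquad x.
Proof. by case: x => [[i1 i3] [t1 t3]] [/= /andP[? _] /andP[? _]]; split; apply: lt_le_trans a0 _. Qed.

Let f_out x : ~ box a b x -> f x = 0.
Proof. by move=> nb; rewrite /f /jext; case: asboolP => // px; rewrite suppJ. Qed.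

Let near_f_in x : pquad x -> \forall y \near x, jv J y = f y.
Proof.
by move=> /near_pquad; apply: filterS => y py; rewrite /f /jext asboolT.
Qed.

Let near_f_out x : ~ box a b x -> \forall y \near x, (cst 0 : st -> R) y = f y.
Proof. by move=> /near_not_box; apply: filterS => y py; rewrite f_out. Qed.

Let pcase x : pquad x \/ ~ box a b x.
Proof. by case: (pselect (box a b x)) => [/box_pquad|]; [left|right]. Qed.

Let Df_in v x : pquad x -> 'D_v f x = j1 J v x.
Proof.
move=> px; have [_ /(_ v)[dJ _]] := okJ px.
exact: (@derive_val _ _ _ _ _ _ _ (near_eq_is_derive (near_f_in px) dJ)).
Qed.

Let Df_out v x : ~ box a b x -> 'D_v f x = 0.
Proof.
move=> nb; exact: (@derive_val _ _ _ _ _ _ _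
  (near_eq_is_derive (near_f_out nb) (is_derive_cst _ _ _))).
Qed.

Let near_Df_in v x : pquad x -> \forall y \near x, j1 J v y = 'D_v f y.
Proof. by move=> /near_pquad; apply: filterS => y py; rewrite Df_in. Qed.

Let near_Df_out v x : ~ box a b x -> \forall y \near x, (cst 0 : st -> R) y = 'D_v f y.
Proof. by move=> /near_not_box; apply: filterS => y py; rewrite Df_out. Qed.

Let DDf_in v w x : pquad x -> 'D_w ('D_v f) x = j2 J v w x.
Proof.
move=> px; have [_ /(_ v)[_ [_ /(_ w)[dJ _]]]] := okJ px.
exact: (@derive_val _ _ _ _ _ _ _ (near_eq_is_derive (near_Df_in v px) dJ)).
Qed.

Let DDf_out v w x : ~ box a b x -> 'D_w ('D_v f) x = 0.
Proof.
move=> nb; exact: (@derive_val _ _ _ _ _ _ _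
  (near_eq_is_derive (near_Df_out v nb) (is_derive_cst _ _ _))).
Qed.

(** The quadrant and the complement of the box are open and, because [0 < a], cover the space. Near
    a point of the first set the extension agrees with the jet, near a point of the second with
    0. *)
Lemma jext_C2 : C2 (jext J).
Proof.
move=> v w _ _; split; [|split; [|split]].
- move=> x; case: (pcase x) => hx.
    have [_ /(_ v)[dJ _]] := okJ hx.
    exact: (@ex_derive _ _ _ _ _ _ _ (near_eq_is_derive (near_f_in hx) dJ)).
  exact: (@ex_derive _ _ _ _ _ _ _
    (near_eq_is_derive (near_f_out hx) (is_derive_cst _ _ _))).
- move=> x; case: (pcase x) => hx.
    apply: near_eq_continuous (near_Df_in v hx) _.
    by have [_ /(_ v)[_ []]] := okJ hx.
  by apply: near_eq_continuous (near_Df_out v hx) _; exact: cvg_cst.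
- move=> x; case: (pcase x) => hx.
    have [_ /(_ v)[_ [_ /(_ w)[dJ _]]]] := okJ hx.
    exact: (@ex_derive _ _ _ _ _ _ _ (near_eq_is_derive (near_Df_in v hx) dJ)).
  exact: (@ex_derive _ _ _ _ _ _ _
    (near_eq_is_derive (near_Df_out v hx) (is_derive_cst _ _ _))).
- move=> x; case: (pcase x) => hx.
    apply: (@near_eq_continuous _ (j2 J v w)).
      by move/near_pquad : hx; apply: filterS => y py; rewrite DDf_in.
    by have [_ /(_ v)[_ [_ /(_ w)[]]]] := okJ hx.
  apply: (@near_eq_continuous _ (cst 0)); last exact: cvg_cst.
  by move/near_not_box : hx; apply: filterS => y py; rewrite DDf_out.
Qed.

Lemma jext_gen gamma T1 T3 x : pquad x ->
  gen_broken gamma T1 T3 (jext J) x = jgen gamma T1 T3 J x.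
Proof.
move=> px; rewrite /gen_broken /jgen.
congr (_ * _ + _ * _ - _ * _ - _ * _ + _ * _ + _ * _ + _ * _ + _ * _);
  [exact: Df_in|exact: Df_in|exact: Df_in|exact: Df_in
  |exact: DDf_in|exact: DDf_in|exact: DDf_in|exact: DDf_in].
Qed.

Lemma jext_gen_out gamma T1 T3 x : ~ pquad x ->
  gen_broken gamma T1 T3 (jext J) x = 0.
Proof.
move=> npx; have nb : ~ box a b x by move=> /box_pquad.
transitivity (jgen gamma T1 T3 (jcst 0) x); last first.
  by rewrite /jgen /= !mulr0 !subr0 !addr0.
rewrite /gen_broken /jgen.
congr (_ * _ + _ * _ - _ * _ - _ * _ + _ * _ + _ * _ + _ * _ + _ * _);
  [exact: Df_out|exact: Df_out|exact: Df_out|exact: Df_out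
  |exact: DDf_out|exact: DDf_out|exact: DDf_out|exact: DDf_out].
Qed.

Lemma jext_test : a <= b -> torus_periodic (jv J) -> test_fun (jext J).
Proof.
move=> ab [p1 p3]; split.
- exact: jext_C2.
- by move=> i1 i3 t1 t3; rewrite /jext /pquad/= p1.
- by move=> i1 i3 t1 t3; rewrite /jext /pquad/= p3.
- by exists a, b; split.
Qed.

End Extension.

(** * Measurability of continuous functions and of the generator *)

Section Measurability.
Context {R : realType}.

(* Countable neighbourhood bases made of measurable sets; this property passes
   to products, and makes open sets measurable. *)
Definition measurable_base d (T : measurableType d) (N : T -> set (set T)) :=
  exists B : nat -> set T, (forall n, measurable (B n)) /\
    forall x A, N x A -> exists n, B n x /\ B n `<=` A.

Lemma measurable_base_R : measurable_base (fun x : R => nbhs x).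
Proof.
exists (fun n => if @unpickle (rat * rat)%type n is Some q
                 then `]ratr q.1, ratr q.2[%classic else set0).
split=> [n|x A /nbhs_ballP[e /= e0 xA]].
  by case: unpickle => // q; exact: measurable_itv.
have [q qx] : exists q : rat, ratr q \in `]x - e, x[.
  have xe : x - e < x by rewrite ltrBlDr ltrDl.
  by have [q hq] := rat_in_itvoo xe; exists q.
have [r rx] : exists q : rat, ratr q \in `]x, x + e[.
  have xe : x < x + e by rewrite ltrDl.
  by have [r hr] := rat_in_itvoo xe; exists r.
exists (pickle (q, r)); rewrite pickleK /=; split.
  by rewrite in_itv /= (itvP qx) (itvP rx).
move=> y /=; rewrite in_itv/= => /andP[qy yr]; apply: xA; rewrite /ball/=.
rewrite ltr_norml; move: qx rx; rewrite !in_itv/= => /andP[h1 h2] /andP[h3 h4].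
by apply/andP; split; lra.
Qed.

Lemma measurable_base_prod d1 d2 (T1 : measurableType d1) (T2 : measurableType d2)
    (N1 : T1 -> set (set T1)) (N2 : T2 -> set (set T2))
    (N : T1 * T2 -> set (set (T1 * T2))) :
  (forall x A, N x A -> exists A1 A2, [/\ N1 x.1 A1, N2 x.2 A2 & A1 `*` A2 `<=` A]) ->
  measurable_base N1 -> measurable_base N2 -> measurable_base N.
Proof.
move=> hN [B1 [mB1 hB1]] [B2 [mB2 hB2]].
exists (fun n => if @unpickle (nat * nat)%type n is Some q
                 then B1 q.1 `*` B2 q.2 else set0).
split=> [n|x A /hN[A1 [A2 [/hB1[n [nx nA]] /hB2[m [mx mA]] sA]]]].
  by case: unpickle => // q; exact: measurableX.
exists (pickle (n, m)); rewrite pickleK /=; split => //.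
by move=> y [/nA y1 /mA y2]; exact: sA.
Qed.

Notation st := (bstate R).

Lemma measurable_base_bstate : measurable_base (fun x : st => nbhs x).
Proof.
have prod_nbhs (U V : topologicalType) (x : U * V) (A : set (U * V)) : nbhs x A ->
    exists A1 A2, [/\ nbhs x.1 A1, nbhs x.2 A2 & A1 `*` A2 `<=` A].
  by move=> [[A1 A2] [/= h1 h2] h3]; exists A1, A2.
have h := measurable_base_R.
have h2 : measurable_base (fun x : R * R => nbhs x).
  exact: (measurable_base_prod (@prod_nbhs R R) h h).
rewrite /bstate.
apply: (measurable_base_prod _ h2 h2).
exact: (@prod_nbhs (R * R)%type (R * R)%type).
Qed.

(** The sigma-algebra of the state space is a product one, so an open set is reached through a
    countable base: it is the union of the basic sets that it contains. *)
Lemma bstate_open_measurable (U : set st) :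
  (forall x, U x -> nbhs x U) -> measurable U.
Proof.
move=> oU; have [B [mB hB]] := measurable_base_bstate.
have -> : U = \bigcup_n (if `[< B n `<=` U >] then B n else set0).
  apply/seteqP; split=> [x Ux|x [n _]]; last by case: asboolP => // sB /sB.
  have [n [nx nU]] := hB x U (oU x Ux).
  by exists n => //; rewrite asboolT.
by apply: bigcupT_measurable => n; case: asboolP.
Qed.

Lemma pquad_measurable : measurable (@pquad R).
Proof. by apply: bstate_open_measurable => x; exact: near_pquad. Qed.

Lemma continuous_on_measurable (U : set st) (f : st -> R) :
  (forall x, U x -> nbhs x U) -> (forall x, U x -> {for x, continuous f}) ->
  measurable_fun U f.
Proof.
move=> oU cf mU; apply: (measurability _ (RGenOInfty.measurableE R)) => //.
move=> _ [_ [a ->] <-]; apply: bstate_open_measurable => x [Ux].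
rewrite /= in_itv/= andbT => afx.
apply: filterI; first exact: oU.
by near=> y; rewrite /= in_itv/= andbT; near: y; exact: (cvgr_gt _ (cf x Ux)).
Unshelve. all: by end_near. Qed.

Lemma continuous_bstate_measurable (f : st -> R) :
  continuous f -> measurable_fun setT f.
Proof.
move=> cf; apply: continuous_on_measurable => x _; first exact: filterT.
exact: cf.
Qed.

Lemma bstate_coord_continuous :
  [/\ continuous (fun x : st => x.1.1), continuous (fun x : st => x.1.2),
      continuous (fun x : st => x.2.1) & continuous (fun x : st => x.2.2)].
Proof.
split=> x.
- by apply: (@continuous_comp _ _ _ fst fst); exact: cvg_fst.
- by apply: (@continuous_comp _ _ _ fst snd); [exact: cvg_fst|exact: cvg_snd].
- by apply: (@continuous_comp _ _ _ snd fst); [exact: cvg_snd|exact: cvg_fst].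
- by apply: (@continuous_comp _ _ _ snd snd); exact: cvg_snd.
Qed.

Lemma gen_broken_measurable gamma T1 T3 (f : st -> R) : C2 f ->
  measurable_fun setT (gen_broken gamma T1 T3 f).
Proof.
move=> C2f; have [c1 c2 c3 c4] := bstate_coord_continuous.
have m1 := continuous_bstate_measurable c1.
have m2 := continuous_bstate_measurable c2.
have m3 : measurable_fun setT (fun x : st => cos x.2.1).
  by apply: continuous_bstate_measurable => x; apply: continuous_comp; [exact: c3|exact: continuous_cos].
have m4 : measurable_fun setT (fun x : st => cos x.2.2).
  by apply: continuous_bstate_measurable => x; apply: continuous_comp; [exact: c4|exact: continuous_cos].
have D1 v : v \in bdirs R -> measurable_fun setT ('D_v f).
  by move=> vb; have [_ [h _]] := C2f v v vb vb; exact: continuous_bstate_measurable.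
have D2 v : v \in bdirs R -> measurable_fun setT ('D_v ('D_v f)).
  by move=> vb; have [_ [_ [_ h]]] := C2f v v vb vb; exact: continuous_bstate_measurable.
have e1 : eI1 R \in bdirs R by rewrite !inE eqxx.
have e2 : eI3 R \in bdirs R by rewrite !inE eqxx orbT.
have e3 : eth1 R \in bdirs R by rewrite !inE eqxx !orbT.
have e4 : eth3 R \in bdirs R by rewrite !inE eqxx !orbT.
have k1 (T : R) (i : st -> R) : measurable_fun setT i ->
    measurable_fun setT (fun x => gamma * (T - i x ^+ 3)).
  move=> mi; apply: measurable_funM; first exact: measurable_cst.
  apply: measurable_funB; first exact: measurable_cst.
  exact: measurable_funX.
have k2 (i j a b : st -> R) : measurable_fun setT i -> measurable_fun setT j ->
    measurable_fun setT a -> measurable_fun setT b ->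
    measurable_fun setT (fun x => i x * (1 + 2 * a x) + 2 * j x * b x).
  move=> mi mj ma mb; apply: measurable_funD; apply: measurable_funM => //.
    apply: measurable_funD; first exact: measurable_cst.
    by apply: measurable_funM => //; exact: measurable_cst.
  by apply: measurable_funM => //; exact: measurable_cst.
have k3 (T : R) (i : st -> R) : measurable_fun setT i ->
    measurable_fun setT (fun x => (gamma * T * i x / 2) / 2).
  move=> mi; do 2 (apply: measurable_funM; last exact: measurable_cst).
  by apply: measurable_funM => //; exact: measurable_cst.
rewrite /gen_broken.
apply: measurable_funD; last exact: (measurable_funM (measurable_cst _) (D2 _ e4)).
apply: measurable_funD; last exact: (measurable_funM (measurable_cst _) (D2 _ e3)).
apply: measurable_funD; last exact: (measurable_funM (k3 _ _ m2) (D2 _ e2)).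
apply: measurable_funD; last exact: (measurable_funM (k3 _ _ m1) (D2 _ e1)).
apply: measurable_funB; last exact: (measurable_funM (k2 _ _ _ _ m2 m1 m4 m3) (D1 _ e4)).
apply: measurable_funB; last exact: (measurable_funM (k2 _ _ _ _ m1 m2 m3 m4) (D1 _ e3)).
apply: measurable_funD; last exact: (measurable_funM (k1 _ _ m2) (D1 _ e2)).
exact: (measurable_funM (k1 _ _ m1) (D1 _ e1)).
Qed.

End Measurability.

(** * Product and chain rules for the generator *)

Section Ito.
Context {R : realType}.
Notation st := (bstate R).
Implicit Types (J K : @jet R) (x : st).
Variables gamma T1 T3 : R.

(* The carre du champ of [jgen]. *)
Definition jgam J K x : R :=
    gamma * T1 * x.1.1 / 2 * (j1 J (eI1 R) x * j1 K (eI1 R) x)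
  + gamma * T3 * x.1.2 / 2 * (j1 J (eI3 R) x * j1 K (eI3 R) x)
  + gamma * (j1 J (eth1 R) x * j1 K (eth1 R) x)
  + gamma * (j1 J (eth3 R) x * j1 K (eth3 R) x).

Notation L := (jgen gamma T1 T3).

Lemma jgen_cst c x : L (jcst c) x = 0.
Proof. by rewrite /jgen /= !mulr0 !subr0 !addr0. Qed.

Lemma jgen_add J K x : L (jadd J K) x = L J x + L K x.
Proof.
rewrite /jgen /=.
move: (j1 J _ _) (j1 J _ _) (j1 J _ _) (j1 J _ _) (j2 J _ _ _) (j2 J _ _ _) (j2 J _ _ _) (j2 J _ _ _).
move: (j1 K _ _) (j1 K _ _) (j1 K _ _) (j1 K _ _) (j2 K _ _ _) (j2 K _ _ _) (j2 K _ _ _) (j2 K _ _ _).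
move=> *; ring.
Qed.

(** [jgam] is normalised as the full rate of quadratic covariation, so it enters the product rule
    with factor 1 and the chain rule with factor 1/2. *)
Lemma jgen_mul J K x :
  L (jmul J K) x = jv J x * L K x + jv K x * L J x + jgam J K x.
Proof.
rewrite /jgen /jgam /=.
move: (j1 J _ _) (j1 J _ _) (j1 J _ _) (j1 J _ _) (j2 J _ _ _) (j2 J _ _ _) (j2 J _ _ _) (j2 J _ _ _).
move: (j1 K _ _) (j1 K _ _) (j1 K _ _) (j1 K _ _) (j2 K _ _ _) (j2 K _ _ _) (j2 K _ _ _) (j2 K _ _ _).
move: (jv J x) (jv K x) => *; by field.
Qed.

Lemma jgen_comp p p1 p2 J x :
  L (jcomp p p1 p2 J) x = p1 (jv J x) * L J x + p2 (jv J x) / 2 * jgam J J x.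
Proof.
rewrite /jgen /jgam /=.
move: (j1 J _ _) (j1 J _ _) (j1 J _ _) (j1 J _ _) (j2 J _ _ _) (j2 J _ _ _) (j2 J _ _ _) (j2 J _ _ _).
move: (p1 _) (p2 _) => *; by field.
Qed.

Lemma jgam_ge0 J x : 0 < gamma -> 0 < T1 -> 0 < T3 -> pquad x -> 0 <= jgam J J x.
Proof.
move=> g0 t1 t3 [x1 x3]; rewrite /jgam -!expr2.
by rewrite !addr_ge0 // mulr_ge0 ?sqr_ge0 // ?ltW // !divr_gt0 ?mulr_gt0.
Qed.

End Ito.

(** * Powers of the positive part *)

Section PosPart.
Context {R : realType}.
Implicit Types v : R.

Definition pos v : R := Num.max 0 v.

Lemma pos_ge0 v : 0 <= pos v. Proof. by rewrite /pos le_max lexx. Qed.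

Lemma pos_id v : 0 <= v -> pos v = v. Proof. by move=> h; rewrite /pos max_r. Qed.

Lemma pos_0 v : v <= 0 -> pos v = 0. Proof. by move=> h; rewrite /pos max_l. Qed.

Lemma pos_continuous : continuous pos.
Proof.
move=> v; rewrite (_ : pos = fun v => (v + `|v|) / 2); last first.
  apply/funext => w; have [w0|w0] := lerP 0 w; first by rewrite pos_id //= ger0_norm //; lra.
  by rewrite pos_0 ?ltW //= ltr0_norm //; lra.
apply: (@continuousM R R (fun v : R => v + `|v|) (cst 2^-1) v); last exact: cvg_cst.
apply: (@continuousD R R R id (fun v : R => `|v|) v); first exact: cvg_id.
exact: norm_continuous.
Qed.

(** Away from 0 the function is locally a power or 0. At 0 the difference quotient is at most [|h|]
    once [|h| <= 1]. *)
Lemma is_derive_pos n v :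
  is_derive v 1 (fun v => pos v ^+ n.+2) (n.+2%:R * pos v ^+ n.+1).
Proof.
have [v0|v0|->] := ltrgt0P v.
- rewrite pos_id ?ltW //; apply: (@near_eq_is_derive _ _ _ (fun v => v ^+ n.+2)).
    near=> w; rewrite pos_id //; apply: ltW; near: w.
    exact: (cvgr_gt _ (@cvg_id _ (nbhs v))).
  apply: DeriveDef; first exact: (@exprn_derivable R n.+2 v 1).
  by rewrite (@exp_derive R n.+2 v 1) /GRing.scale/= mulr1.
- rewrite pos_0 ?ltW // expr0n mulr0; apply: (near_eq_is_derive _ (is_derive_cst (0 : R) v 1)).
  near=> w; rewrite pos_0 ?expr0n //; apply: ltW; near: w.
  exact: (cvgr_lt _ (@cvg_id _ (nbhs v))).
- rewrite pos_id // expr0n mulr0.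
  suff H : (fun h : R => h^-1 *: (((fun v => pos v ^+ n.+2) \o shift 0) (h *: 1) -
      pos 0 ^+ n.+2)) @ 0^' --> (0 : R).
    by apply: DeriveDef; [apply/cvg_ex; exists 0|exact: cvg_lim H].
  apply/cvgr0Pnorm_lt => e e0; near=> h.
  have hn0 : h != 0 by near: h; exact: nbhs_dnbhs_neq.
  rewrite /= addr0 (pos_id (lexx 0)) expr0n subr0 /GRing.scale /= mulr1.
  have h1 : `|h| < Num.min 1 e.
    near: h; apply: dnbhs0_lt; by rewrite lt_min ltr01.
  move: h1; rewrite lt_min => /andP[h1 he]; apply: le_lt_trans he.
  rewrite normrM normfV normrX.
  have ph : `|pos h| <= `|h|.
    have [h0|h0] := lerP 0 h; first by rewrite pos_id.
    by rewrite pos_0 ?normr0 // ltW.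
  rewrite mulrC ler_pdivrMr ?normr_gt0 // exprSr exprSr -mulrA.
  apply: (@le_trans _ _ (`|h| ^+ n * (`|h| * `|h|))).
    by rewrite ler_pM ?exprn_ge0 ?mulr_ge0 ?lerXn2r ?nnegrE // ler_pM.
  by rewrite ler_piMl ?mulr_ge0 // exprn_ile1 // ltW.
Unshelve. all: by end_near. Qed.

(** The cube is the lowest integer power of the positive part that is twice continuously
    differentiable. *)
Definition jpos3 (J : @jet R) :=
  jcomp (fun v => pos v ^+ 3) (fun v => 3 * pos v ^+ 2) (fun v => 6 * pos v) J.

Lemma jpos3_ok J : jet_ok J -> jet_ok (jpos3 J).
Proof.
move=> okJ; apply: jcomp_ok => // x _; split; first exact: is_derive_pos.
  have H := is_derive_pos 0 (jv J x).
  have := @is_deriveM R R (cst 3) (fun v : R => pos v ^+ 2) (jv J x) 1 0 _ (is_derive_cst _ _ _) H.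
  move/is_derive_eq; apply.
  by rewrite scaler0 addr0 expr1 /GRing.scale/= mulrA -natrM.
apply: (@continuousM R R (cst 6) pos); first exact: cvg_cst.
exact: pos_continuous.
Qed.

End PosPart.
(** * Integral bounds from Lyapunov functions *)

Section Lyapunov.
Context {R : realType}.
Notation st := (bstate R).

(** An extended integral is the difference of those of the positive and negative parts, which can be
    rearranged only if one of them is finite. The lower bound [- c] makes the negative part
    integrable; the value 0 then makes both parts equal and finite. *)
Lemma integral0_addC d (T : measurableType d) (P : probability T R) (g : T -> R) c :
  measurable_fun setT g -> (forall x, - c <= g x) -> 0 <= c ->
  (\int[P]_x (g x)%:E = 0)%E -> (\int[P]_x (g x + c)%:E = c%:E)%E.
Proof.
move=> mg gc c0 g0.
have mgE : measurable_fun setT (EFin \o g) by exact/measurable_EFinP.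
have mp : measurable_fun setT (EFin \o g)^\+%E by exact: measurable_funepos.
have mn : measurable_fun setT (EFin \o g)^\-%E by exact: measurable_funeneg.
have mc : measurable_fun [set: T] (fun=> c%:E) by exact: measurable_cst.
have Ic : (\int[P]_x c%:E = c%:E)%E.
  by rewrite integral_cst // [X in (_ * X)%E]probability_setT mule1.
have In : (\int[P]_x ((EFin \o g)^\- x) \is a fin_num)%E.
  rewrite ge0_fin_numE; last by apply: integral_ge0.
  apply: (@le_lt_trans _ _ (\int[P]_x c%:E)%E); last by rewrite Ic ltry.
  apply: ge0_le_integral => // x _; rewrite funenegE ge_max /= !lee_fin c0 andbT.
  by rewrite lerNl.
move: g0; rewrite integralE => g0.
have pn : (\int[P]_x ((EFin \o g)^\+ x) = \int[P]_x ((EFin \o g)^\- x))%E.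
  by rewrite -[LHS](subeK _ In) g0 add0e.
have H : (\int[P]_x (g x + c)%:E + \int[P]_x ((EFin \o g)^\- x) =
          \int[P]_x c%:E + \int[P]_x ((EFin \o g)^\+ x))%E.
  rewrite -!ge0_integralD //; first last.
  - by apply/measurable_EFinP; apply: measurable_funD => //; exact: measurable_cst.
  - by move=> x _; rewrite lee_fin -lerBlDr sub0r.
  apply: eq_integral => x _.
  rewrite funenegE funeposE /= -!EFin_max -!EFinD; congr (_%:E).
  by rewrite /Num.max; do 2 case: ifP => ?; lra.
by rewrite -[LHS](addeK _ In) H pn Ic (addeK _ In).
Qed.

Variables (gamma T1 T3 : R) (P : probability st R).
Hypotheses (gamma0 : 0 < gamma) (T10 : 0 < T1) (T30 : 0 < T3).
Hypothesis invP : invariant_broken gamma T1 T3 P.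

Lemma bspace_measurable : measurable (@bspace R).
Proof.
have [c1 c2 c3 c4] := @bstate_coord_continuous R.
have m1 := continuous_bstate_measurable c1.
have m2 := continuous_bstate_measurable c2.
have m3 := continuous_bstate_measurable c3.
have m4 := continuous_bstate_measurable c4.
have mI (f : st -> R) (I : interval R) : measurable_fun setT f ->
    measurable [set x | f x \in I].
  move=> mf; rewrite (_ : [set x | _] = setT `&` f @^-1` [set` I]).
    by apply: mf => //; exact: measurable_itv.
  by rewrite setTI.
rewrite (_ : @bspace R = [set x : st | x.1.1 \in `]0, +oo[] `&` [set x : st | x.1.2 \in `]0, +oo[]
   `&` ([set x : st | x.2.1 \in `[0, 2 * pi[] `&` [set x : st | x.2.2 \in `[0, 2 * pi[])).
  by apply: measurableI; apply: measurableI; exact: mI.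
apply/seteqP; split=> x; rewrite /bspace /= !in_itv /= ?andbT.
  by move=> [].
by move=> [[? ?] [? ?]].
Qed.

Lemma pquadC_null : P (~` (@pquad R)) = 0%E.
Proof.
have mp := @pquad_measurable R.
have P1 : P (@pquad R) = 1%E.
  apply/eqP; rewrite eq_le probability_le1 //= -(invP.1).
  apply: le_measure; rewrite ?inE //; first exact: bspace_measurable.
  by move=> x [].
by rewrite probability_setC // P1 subee.
Qed.

Variables (J : @jet R) (W : st -> R) (C : R).
Hypotheses (okJ : jet_ok J) (perJ : torus_periodic (jv J)).
Hypothesis J0 : forall x, pquad x -> 0 <= jv J x.
Hypothesis properJ : forall c : R, exists a b, [/\ 0 < a, a <= b &
  forall x, pquad x -> jv J x < c -> box a b x].
Hypotheses (mW : measurable_fun setT W) (W0 : forall x, 0 <= W x) (C0 : 0 <= C).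
Hypothesis drift : forall x, pquad x -> W x <= C - jgen gamma T1 T3 J x.

Let trunc n x := pos (n%:R - jv J x).

Let trunc_measurable n : measurable_fun (@pquad R) (trunc n).
Proof.
apply: continuous_on_measurable; first exact: near_pquad.
move=> x px; have okK : jet_ok (jadd (jcst n%:R) (jmul (jcst (-1)) J)).
  by apply: jadd_ok; [exact: jcst_ok|apply: jmul_ok => //; exact: jcst_ok].
have [cK _] := okK x px.
have -> : trunc n = fun x => pos (jv (jadd (jcst n%:R) (jmul (jcst (-1)) J)) x).
  by apply/funext => y; rewrite /= mulN1r.
by apply: (continuous_comp cK); exact: pos_continuous.
Qed.

(** With t = (n - V)_+ the generator of t^3 is - 3 t^2 L V + 3 t G(V, V). The second-order term has
    the favourable sign and is dropped, the drift hypothesis bounds the first from below by 3 t^2 (W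
    - C), and t <= n because V >= 0. *)
Let trunc_bound (n : nat) :
  (\int[P]_(x in @pquad R) (trunc n x ^+ 2 * W x)%:E <= (C * n%:R ^+ 2)%:E)%E.
Proof.
pose K := jadd (jcst n%:R) (jmul (jcst (-1)) J).
have okK : jet_ok K by apply: jadd_ok; [exact: jcst_ok|apply: jmul_ok => //; exact: jcst_ok].
have KE x : jv K x = n%:R - jv J x by rewrite /K /= mulN1r.
have [a [b [a0 ab hab]]] := properJ n%:R.
have okf := jpos3_ok okK.
have suppf x : pquad x -> ~ box a b x -> jv (jpos3 K) x = 0.
  move=> px nb; rewrite /= mulN1r pos_0 ?expr0n // subr_le0 leNgt.
  by apply/negP => /(hab x px).
pose f := jext (jpos3 K).
have perf : torus_periodic (jv (jpos3 K)).
  by have [h1 h2] := perJ; split=> *; rewrite /= ?h1 ?h2.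
have testf : test_fun f := jext_test a0 okf suppf ab perf.
pose g := gen_broken gamma T1 T3 f.
have mg : measurable_fun setT g.
  by apply: gen_broken_measurable; exact: (jext_C2 a0 okf suppf).
pose c := 3 * (C * n%:R ^+ 2).
have c0 : 0 <= c by rewrite mulr_ge0 // mulr_ge0 // sqr_ge0.
have gE x : pquad x -> 3 * (trunc n x ^+ 2 * W x) <= g x + c.
  move=> px; rewrite /g /c (jext_gen okf _ _ _ px) jgen_comp KE -/(trunc n x).
  rewrite jgen_add jgen_mul !jgen_cst !mulr0 addr0 add0r.
  have -> : jgam gamma T1 T3 (jcst (-1)) J x = 0 by rewrite /jgam /= !(mul0r, mulr0, addr0).
  have G0 := jgam_ge0 K gamma0 T10 T30 px.
  have t0 : 0 <= trunc n x by exact: pos_ge0.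
  have tn : trunc n x <= n%:R.
    by rewrite /trunc /pos ge_max ler0n lerBlDr lerDl J0.
  have := drift px; move: (jgen _ _ _ _ _) (jgam _ _ _ _ _ _) G0 => l q q0 hl.
  have h1 : trunc n x ^+ 2 * W x <= trunc n x ^+ 2 * (C - l).
    by rewrite ler_wpM2l // sqr_ge0.
  have h2 : trunc n x ^+ 2 * C <= n%:R ^+ 2 * C.
    by rewrite ler_wpM2r // lerXn2r // nnegrE.
  have h3 : 0 <= trunc n x * q by exact: mulr_ge0.
  rewrite /=; nra.
have g_ge x : - c <= g x.
  have [px|npx] := pselect (pquad x).
    have := gE x px; have := mulr_ge0 (sqr_ge0 (trunc n x)) (W0 x); lra.
  by rewrite /g (jext_gen_out a0 suppf) // oppr_le0.
have Ig := integral0_addC mg g_ge c0 (invP.2 f testf).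
have mp := @pquad_measurable R.
have mt : measurable_fun (@pquad R) (fun x => trunc n x ^+ 2 * W x).
  apply: measurable_funM; last exact: measurable_funTS.
  exact: measurable_funX (trunc_measurable n).
have m3 : measurable_fun (@pquad R) (fun x => 3 * (trunc n x ^+ 2 * W x)).
  by apply: measurable_funM => //; exact: measurable_cst.
have mgc : measurable_fun setT (fun x => g x + c).
  by apply: measurable_funD => //; exact: measurable_cst.
have gc0 x : 0 <= g x + c by rewrite -lerBlDr sub0r.
have t0 x : 0 <= trunc n x ^+ 2 * W x by rewrite mulr_ge0 // sqr_ge0.
have : (\int[P]_(x in @pquad R) (3 * (trunc n x ^+ 2 * W x))%:E <= c%:E)%E.
  rewrite -Ig; apply: (@le_trans _ _ (\int[P]_(x in @pquad R) (g x + c)%:E)%E).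
    apply: ge0_le_integral => //.
    - by move=> x _; rewrite lee_fin mulr_ge0.
    - exact/measurable_EFinP.
    - by apply/measurable_EFinP; exact: measurable_funTS.
  apply: ge0_subset_integral => //; first exact/measurable_EFinP.
  by move=> x _; rewrite lee_fin.
under eq_integral do rewrite EFinM.
rewrite ge0_integralZl_EFin //; last 2 first.
- by move=> x _; rewrite lee_fin.
- exact/measurable_EFinP.
by rewrite /c EFinM lee_pmul2l // ?lte_fin.
Qed.

Theorem lyapunov_bound : (\int[P]_x (W x)%:E <= C%:E)%E.
Proof.
have mp := @pquad_measurable R.
have mWE : measurable_fun setT (EFin \o W) by exact/measurable_EFinP.
rewrite (ge0_negligible_integral _ _ mWE _ pquadC_null) //; last 2 first.
- exact: measurableC.
- by move=> x _; rewrite lee_fin.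
rewrite setDE setTI setCK.
(* After division by the square of the level, the weight is (1 - V / (n + 1))_+^2, which increases
   to 1 because V >= 0; the successor avoids level 0. *)
pose u n x := (trunc n.+1 x / n.+1%:R) ^+ 2 * W x.
have un0 n x : 0 <= u n x by rewrite mulr_ge0 // sqr_ge0.
have mu n : measurable_fun (@pquad R) (u n).
  apply: measurable_funM; last exact: measurable_funTS.
  apply: measurable_funX; apply: measurable_funM; first exact: trunc_measurable.
  exact: measurable_cst.
have uE n x : u n x = pos (1 - jv J x * n.+1%:R^-1) ^+ 2 * W x.
  rewrite /u /trunc; congr (_ ^+ 2 * _).
  rewrite /pos maxr_pMl ?invr_ge0 // mul0r; congr Num.max.
  by rewrite mulrBl divff ?pnatr_eq0.
have und x : pquad x -> nondecreasing_seq (fun n => (u n x)%:E).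
  move=> px m n mn; rewrite lee_fin !uE ler_wpM2r // lerXn2r ?nnegrE ?pos_ge0 //.
  rewrite /pos le_max ge_max lexx /=; apply/orP.
  have [h|h] := leP (1 - jv J x * m.+1%:R^-1) 0; first by left.
  by right; rewrite lerD2l lerN2 ler_wpM2l ?J0 //
    lef_pV2 ?posrE ?ltr0n // ler_nat ltnS.
have ucvg x : pquad x -> (fun n => (u n x)%:E) @ \oo --> (W x)%:E.
  move=> px; apply: cvg_EFin; first exact: nearW.
  have -> : fine \o (fun n => (u n x)%:E) =
      (fun n => pos (1 - jv J x * harmonic n) ^+ 2 * W x).
    by apply/funext => n; rewrite /= uE.
  have H : (fun n => pos (1 - jv J x * harmonic n)) @ \oo --> (1 : R).
    have p1 : pos (1 - jv J x * 0) = 1 by rewrite mulr0 subr0 pos_id.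
    rewrite -[X in _ --> X]p1.
    apply: continuous_cvg; first exact: pos_continuous.
    apply: cvgB; first exact: cvg_cst.
    by apply: cvgM; [exact: cvg_cst|exact: cvg_harmonic].
  have := cvgM (cvgM H H) (cvg_cst (W x)).
  by rewrite !mul1r => h; apply: h.
have muE n : measurable_fun (@pquad R) (fun x => (u n x)%:E) by exact/measurable_EFinP.
have cv := cvg_monotone_convergence mp muE (fun n x _ => un0 n x) und.
rewrite (eq_integral (fun x => limn (fun n => (u n x)%:E))); last first.
  by move=> x; rewrite inE => px; apply/esym/cvg_lim => //; exact: ucvg.
rewrite -(cvg_lim _ (cv P)) //; apply: lime_le; first by apply/cvg_ex; eexists; exact: (cv P).
apply: nearW => n.
have n0 : (0 : R) < n.+1%:R ^- 2 by rewrite invr_gt0 exprn_gt0.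
rewrite (eq_integral (fun x => (n.+1%:R ^- 2)%:E * (trunc n.+1 x ^+ 2 * W x)%:E)%E); last first.
  by move=> x _; rewrite -EFinM /u expr_div_n mulrAC mulrC.
rewrite ge0_integralZl_EFin //; [|by move=> x _; rewrite lee_fin mulr_ge0 // sqr_ge0|].
  have := trunc_bound n.+1.
  rewrite -(@lee_pmul2l _ (n.+1%:R ^- 2)%:E) ?lte_fin // => /le_trans; apply.
  by rewrite -EFinM lee_fin mulrCA mulVf ?mulr1 // expf_neq0.
apply/measurable_EFinP; apply: measurable_funM; last exact: measurable_funTS.
exact: measurable_funX (trunc_measurable _).
Qed.

End Lyapunov.
(** * The repelling curve *)

Section TrigSeries.
Context {R : realType}.

(* [(j, n, (a, b))] stands for [e ^+ j * (a * cos (n x) + b * sin (n x))]. *)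
Definition term : Type := (nat * nat * (R * R))%type.
Implicit Types (t s : term) (l : seq term) (e x : R).

Definition tev t e x : R :=
  e ^+ t.1.1 * (t.2.1 * cos (t.1.2%:R * x) + t.2.2 * sin (t.1.2%:R * x)).
Definition ev l e x : R := \sum_(t <- l) tev t e x.

Definition tang t : term := (t.1.1, t.1.2, (t.1.2%:R * t.2.2, - (t.1.2%:R * t.2.1))).
(** This is the derivative in e, as [tang] is the derivative in x. At exponent 0 the truncated
    predecessor is harmless because the coefficients become 0. *)
Definition tpar t : term := (t.1.1.-1, t.1.2, (t.1.1%:R * t.2.1, t.1.1%:R * t.2.2)).
Definition tshift t : term := (t.1.1.+1, t.1.2, t.2).
Definition topp t : term := (t.1, (- t.2.1, - t.2.2)).
(** The periodic solution y of y' - sqrt 3 y = t, one frequency at a time. No frequency is resonant,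
    since the denominator n^2 + 3 is positive even for n = 0: this is where the strict repulsion of
    the curve enters. *)
Definition tsolve t : term := let n : R := t.1.2%:R in let c := Num.sqrt 3 in
  (t.1, (- (c * t.2.1 + n * t.2.2) / (n ^+ 2 + 3), (n * t.2.1 - c * t.2.2) / (n ^+ 2 + 3))).
(** Product-to-sum formulas. The case distinction keeps the difference of the frequencies a true
    natural difference and moves its sign to the sine coefficient. *)
Definition tmul t s : seq term :=
  let: (j, n, (a, b)) := t in let: (k, m, (a', b')) := s in
  [:: ((j + k)%N, (n + m)%N, ((a * a' - b * b') / 2, (a * b' + b * a') / 2));
      if (m <= n)%N then ((j + k)%N, (n - m)%N, ((a * a' + b * b') / 2, (b * a' - a * b') / 2))
      else ((j + k)%N, (m - n)%N, ((a * a' + b * b') / 2, (a * b' - b * a') / 2))].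
Definition lmul l1 l2 := flatten [seq tmul t s | t <- l1, s <- l2].

Lemma ev_cat l1 l2 e x : ev (l1 ++ l2) e x = ev l1 e x + ev l2 e x.
Proof. by rewrite /ev big_cat. Qed.

Lemma ev_map (f : term -> term) (k : R) l e x :
  (forall t, tev (f t) e x = k * tev t e x) -> ev (map f l) e x = k * ev l e x.
Proof. by move=> h; rewrite /ev big_map mulr_sumr; apply: eq_bigr. Qed.

Lemma ev_opp l e x : ev (map topp l) e x = - ev l e x.
Proof. by rewrite (@ev_map _ (-1)) ?mulN1r // => t; rewrite /tev /=; ring. Qed.

Lemma ev_shift l e x : ev (map tshift l) e x = e * ev l e x.
Proof. by apply: ev_map => t; rewrite /tev /= exprS -mulrA. Qed.

Lemma tmulE t s e x : ev (tmul t s) e x = tev t e x * tev s e x.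
Proof.
case: t => [[j n] [a b]]; case: s => [[k m] [a' b']].
rewrite /ev /tmul 2!big_cons big_nil /tev /=.
have cD : cos ((n + m)%:R * x) = cos (n%:R * x) * cos (m%:R * x) - sin (n%:R * x) * sin (m%:R * x).
  by rewrite natrD mulrDl cosD.
have sD : sin ((n + m)%:R * x) = sin (n%:R * x) * cos (m%:R * x) + cos (n%:R * x) * sin (m%:R * x).
  by rewrite natrD mulrDl sinD.
have cB (p q : nat) : (q <= p)%N -> cos ((p - q)%:R * x) =
    cos (p%:R * x) * cos (q%:R * x) + sin (p%:R * x) * sin (q%:R * x).
  by move=> qp; rewrite natrB // mulrBl cosB.
have sB (p q : nat) : (q <= p)%N -> sin ((p - q)%:R * x) =
    sin (p%:R * x) * cos (q%:R * x) - cos (p%:R * x) * sin (q%:R * x).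
  by move=> qp; rewrite natrB // mulrBl sinB.
case: ifPn => [mn|]; last rewrite -ltnNge => /ltnW mn.
  by rewrite /= cD sD cB // sB // !exprD; field.
by rewrite /= cD sD cB // sB // !exprD; field.
Qed.

Lemma ev_mul l1 l2 e x : ev (lmul l1 l2) e x = ev l1 e x * ev l2 e x.
Proof.
rewrite /lmul {1}/ev big_flatten /= big_allpairs_dep /ev mulr_suml.
apply: eq_bigr => t _; rewrite mulr_sumr; apply: eq_bigr => s _.
exact: tmulE.
Qed.

Lemma sqrt3E : Num.sqrt 3 ^+ 2 = 3 :> R. Proof. by rewrite sqr_sqrtr. Qed.

Lemma sqrt3_bounds : 1 <= Num.sqrt 3 :> R /\ Num.sqrt 3 <= 2 :> R.
Proof.
have s0 : 0 <= Num.sqrt 3 :> R by exact: sqrtr_ge0.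
by have := sqrt3E; split; nra.
Qed.

Lemma ev_solve l e x :
  ev (map (tang \o tsolve) l) e x - Num.sqrt 3 * ev (map tsolve l) e x = ev l e x.
Proof.
rewrite /ev !big_map mulr_sumr -sumrB; apply: eq_bigr => -[[j n] [a b]] _.
rewrite /tev /tang /tsolve /=.
have n0 : (n%:R ^+ 2 + 3 : R) != 0 by rewrite lt0r_neq0 // ltr_wpDl // sqr_ge0.
have := sqrt3E; move: (Num.sqrt 3) (cos _) (sin _) => c C S c3.
by rewrite -c3 in n0 *; field.
Qed.

Variable sigma : R.
Hypothesis sigma_gt0 : 0 < sigma.

(** The factor (1 + n)^2 pays for two angular derivatives, and [sigma] acts as a radius in e. As 1 +
    n + m <= (1 + n)(1 + m), the resulting norm is submultiplicative, so the Picard iteration can be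
    run entirely in it. *)
Definition wt t : R :=
  sigma ^+ t.1.1 * (1 + t.1.2%:R) ^+ 2 * (`|t.2.1| + `|t.2.2|).
Definition nrm l : R := \sum_(t <- l) wt t.

Lemma wt_ge0 t : 0 <= wt t.
Proof. by rewrite /wt !mulr_ge0 ?exprn_ge0 ?addr_ge0 // ltW. Qed.

Lemma nrm_ge0 l : 0 <= nrm l.
Proof. by apply: sumr_ge0 => t _; exact: wt_ge0. Qed.

Lemma nrm_cat l1 l2 : nrm (l1 ++ l2) = nrm l1 + nrm l2.
Proof. by rewrite /nrm big_cat. Qed.

Lemma nrm_map (f : term -> term) k l :
  (forall t, wt (f t) <= k * wt t) -> nrm (map f l) <= k * nrm l.
Proof. by move=> h; rewrite /nrm big_map mulr_sumr; apply: ler_sum. Qed.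

Lemma nrm_opp l : nrm (map topp l) <= nrm l.
Proof. by rewrite -[leRHS]mul1r; apply: nrm_map => t; rewrite /wt /= !normrN mul1r. Qed.

Lemma nrm_shift l : nrm (map tshift l) <= sigma * nrm l.
Proof. by apply: nrm_map => t; rewrite /wt /= exprS !mulrA. Qed.

Lemma nrm_solve l : nrm (map tsolve l) <= nrm l.
Proof.
rewrite -[leRHS]mul1r; apply: nrm_map => -[[j n] [a b]]; rewrite mul1r /wt /=.
rewrite ler_wpM2l ?mulr_ge0 ?exprn_ge0 ?addr_ge0 ?(ltW sigma_gt0) //.
have [c1 c2] := sqrt3_bounds; move: (Num.sqrt 3) c1 c2 => c c1 c2.
have c0 : 0 <= c by rewrite (le_trans ler01).
have n0 : 0 <= n%:R :> R by [].
have d0 : 0 < n%:R ^+ 2 + 3 :> R by rewrite ltr_wpDl // sqr_ge0.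
rewrite !normrM normfV normrN (gtr0_norm d0) -mulrDl ler_pdivrMr //.
have h1 : `|c * a + n%:R * b| <= c * `|a| + n%:R * `|b|.
  by rewrite (le_trans (ler_normD _ _)) // !normrM (ger0_norm c0) (ger0_norm n0).
have h2 : `|n%:R * a - c * b| <= n%:R * `|a| + c * `|b|.
  by rewrite (le_trans (ler_normB _ _)) // !normrM (ger0_norm c0) (ger0_norm n0).
apply: le_trans (lerD h1 h2) _.
have := normr_ge0 a; have := normr_ge0 b; move: `|a| `|b| => u v u0 v0.
have h3 : c + n%:R <= n%:R ^+ 2 + 3 by nra.
rewrite [leLHS](_ : _ = (u + v) * (c + n%:R)); last by ring.
by rewrite ler_wpM2l // addr_ge0.
Qed.

(** Solving divides by n^2 + 3 and so regains the factor n lost by differentiating. Thanks to this,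
    the term e u' of the curve equation costs no regularity and the iteration closes in a single
    norm. *)
Lemma nrm_solve_ang l : nrm (map (tsolve \o tang) l) <= 2 * nrm l.
Proof.
apply: nrm_map => -[[j n] [a b]]; rewrite /wt /= [leRHS]mulrCA.
rewrite ler_wpM2l ?mulr_ge0 ?exprn_ge0 ?addr_ge0 ?(ltW sigma_gt0) //.
have [c1 c2] := sqrt3_bounds; move: (Num.sqrt 3) c1 c2 => c c1 c2.
have c0 : 0 <= c by rewrite (le_trans ler01).
have n0 : 0 <= n%:R :> R by [].
have d0 : 0 < n%:R ^+ 2 + 3 :> R by rewrite ltr_wpDl // sqr_ge0.
rewrite !normrM normfV normrN (gtr0_norm d0) -mulrDl ler_pdivrMr //.
have h1 : `|c * (n%:R * b) + n%:R * - (n%:R * a)| <= n%:R * (c * `|b| + n%:R * `|a|).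
  rewrite (le_trans (ler_normD _ _)) // !(normrM, normrN) (ger0_norm c0) (ger0_norm n0).
  by rewrite le_eqVlt; apply/orP; left; apply/eqP; ring.
have h2 : `|n%:R * (n%:R * b) - c * - (n%:R * a)| <= n%:R * (n%:R * `|b| + c * `|a|).
  rewrite (le_trans (ler_normB _ _)) // !(normrM, normrN) (ger0_norm c0) (ger0_norm n0).
  by rewrite le_eqVlt; apply/orP; left; apply/eqP; ring.
apply: le_trans (lerD h1 h2) _.
have := normr_ge0 a; have := normr_ge0 b; move: `|a| `|b| => u v u0 v0.
have h3 : n%:R * (c + n%:R) <= 2 * (n%:R ^+ 2 + 3) by nra.
rewrite [leLHS](_ : _ = (u + v) * (n%:R * (c + n%:R))); last by ring.
by rewrite [leRHS]mulrAC [leRHS]mulrC ler_wpM2l // addr_ge0.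
Qed.

Lemma nrm_tmul t s : nrm (tmul t s) <= wt t * wt s.
Proof.
case: t => [[j n] [a b]]; case: s => [[k m] [a' b']].
rewrite /nrm /tmul 2!big_cons big_nil addr0.
have mono (p : nat) (u v : R) : (p <= n + m)%N -> `|u| + `|v| <= (`|a| + `|b|) * (`|a'| + `|b'|) / 2 ->
    wt ((j + k)%N, p, (u, v)) <= wt (j, n, (a, b)) * wt (k, m, (a', b')) / 2.
  move=> pnm huv; rewrite /wt /= exprD.
  have hp : (1 + p%:R) ^+ 2 <= ((1 + n%:R) * (1 + m%:R)) ^+ 2 :> R.
    rewrite lerXn2r ?nnegrE ?mulr_ge0 ?addr_ge0 //.
    have : p%:R <= n%:R + m%:R :> R by rewrite -natrD ler_nat.
    have : 0 <= n%:R * m%:R :> R by rewrite mulr_ge0.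
    by lra.
  rewrite [leRHS](_ : _ = sigma ^+ j * sigma ^+ k * (((1 + n%:R) * (1 + m%:R)) ^+ 2 *
     ((`|a| + `|b|) * (`|a'| + `|b'|) / 2))); last by field.
  rewrite -!(mulrA (_ * _)) ler_wpM2l ?mulr_ge0 ?exprn_ge0 ?(ltW sigma_gt0) //.
  by rewrite [leRHS]mulrA -expr2 ler_pM // ?sqr_ge0 ?addr_ge0.
have hab (u v : R) : `|u| <= `|a| * `|a'| + `|b| * `|b'| -> `|v| <= `|a| * `|b'| + `|b| * `|a'| ->
    `|u / 2| + `|v / 2| <= (`|a| + `|b|) * (`|a'| + `|b'|) / 2.
  move=> hu hv; rewrite !normrM normfV (ger0_norm (ler0n R 2)) -mulrDl.
  by rewrite ler_pM2r // (le_trans (lerD hu hv)) // le_eqVlt; apply/orP; left; apply/eqP; ring.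
have nB (p q r s' : R) : `|p * q - r * s'| <= `|p| * `|q| + `|r| * `|s'|.
  by rewrite (le_trans (ler_normB _ _)) // !normrM.
have nD (p q r s' : R) : `|p * q + r * s'| <= `|p| * `|q| + `|r| * `|s'|.
  by rewrite (le_trans (ler_normD _ _)) // !normrM.
rewrite [leRHS](splitr) lerD //; first by apply: mono => //; apply: hab; [exact: nB|exact: nD].
case: ifP => mn; apply: mono => //; try by rewrite (leq_trans (leq_subr _ _)) // ?leq_addr ?leq_addl.
- by apply: hab; [exact: nD|rewrite [leRHS]addrC; exact: nB].
- by apply: hab; [exact: nD|exact: nB].
Qed.

Lemma nrm_mul l1 l2 : nrm (lmul l1 l2) <= nrm l1 * nrm l2.
Proof.
rewrite /lmul {1}/nrm big_flatten /= big_allpairs_dep /nrm mulr_suml.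
apply: ler_sum => t _; rewrite mulr_sumr; apply: ler_sum => s _.
exact: nrm_tmul.
Qed.

Lemma ev_le (f : term -> term) K l e x :
  (forall t, `|tev (f t) e x| <= K * wt t) -> `|ev (map f l) e x| <= K * nrm l.
Proof.
move=> h; rewrite /ev big_map /nrm mulr_sumr (le_trans (ler_norm_sum _ _ _)) //.
exact: ler_sum.
Qed.

Lemma tev_le t e x : 0 <= e -> `|tev t e x| <= e ^+ t.1.1 * (`|t.2.1| + `|t.2.2|).
Proof.
move=> e0; rewrite /tev normrM ger0_norm ?exprn_ge0 // ler_wpM2l ?exprn_ge0 //.
have cb y : `|cos y| <= 1 :> R by rewrite ler_norml cos_geN1 cos_le1.
have sb y : `|sin y| <= 1 :> R by rewrite ler_norml sin_geN1 sin_le1.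
by rewrite (le_trans (ler_normD _ _)) // !normrM lerD // ler_piMr.
Qed.

Section Bounds.
Variables (e x : R).
Hypotheses (e_ge0 : 0 <= e) (e_le : e <= sigma / 4).

Let sigma4_gt0 : 0 < sigma / 4. Proof. by rewrite divr_gt0. Qed.

Let e_sigma : e <= sigma.
Proof. by have := sigma_gt0; have := e_le; lra. Qed.

Let key (f : term -> term) K : 0 <= K ->
  (forall t, e ^+ (f t).1.1 * (`|(f t).2.1| + `|(f t).2.2|) <= K * wt t) ->
  forall l, `|ev (map f l) e x| <= K * nrm l.
Proof. by move=> K0 h l; apply: ev_le => t; rewrite (le_trans (tev_le _ _ _)). Qed.

Let wt_ge j n (a b k : R) : 0 <= k -> k <= (1 + n%:R) ^+ 2 ->
  e ^+ j * (k * (`|a| + `|b|)) <= wt (j, n, (a, b)).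
Proof.
move=> k0 hk; rewrite /wt /= mulrA ler_wpM2r ?addr_ge0 // ler_pM ?exprn_ge0 //.
by rewrite lerXn2r // nnegrE ltW.
Qed.

Lemma ev_bound l : `|ev l e x| <= nrm l.
Proof.
rewrite -[l]map_id -[nrm _]mul1r map_id -{1}[l]map_id; apply: key => // -[[j n] [a b]].
rewrite mul1r -[X in _ * X]mul1r /=; apply: wt_ge => //.
by have : 0 <= n%:R :> R by []; nra.
Qed.

Lemma ev_ang_bound l : `|ev (map tang l) e x| <= nrm l.
Proof.
rewrite -[nrm _]mul1r; apply: key => // -[[j n] [a b]].
rewrite mul1r /= normrN !normrM -mulrDr ger0_norm // addrC; apply: wt_ge => //.
by have : 0 <= n%:R :> R by []; nra.
Qed.

Lemma ev_ang2_bound l : `|ev (map tang (map tang l)) e x| <= nrm l.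
Proof.
rewrite -map_comp -[nrm _]mul1r; apply: key => // -[[j n] [a b]].
rewrite mul1r /= !normrN !normrM !normrN !normrM -!mulrDr ger0_norm // mulrA; apply: wt_ge.
  by rewrite mulr_ge0.
by have : 0 <= n%:R :> R by []; nra.
Qed.

Let pow4 j : j%:R ^+ 2 <= 4 ^+ j :> R.
Proof.
elim: j => [|j IH]; first by rewrite expr0n ler01.
have [->|j0] := posnP j; first by rewrite expr1n expr1 ler1n.
rewrite [leRHS]exprS -natr1; have : 1 <= j%:R :> R by rewrite ler1n.
by move: IH; move: (4 ^+ j) (j%:R) => A B; nra.
Qed.

(** A Cauchy estimate: as e stays below a quarter of the radius [sigma], the factor j^k is absorbed
    by 4^j, at the price 4 / [sigma] for each derivative in e. *)
Let pow_par j k : (k <= j)%N -> (k <= 2)%N ->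
  e ^+ (j - k) * j%:R ^+ k <= (4 / sigma) ^+ k * sigma ^+ j.
Proof.
move=> kj k2.
have h1 : e ^+ (j - k) <= (sigma / 4) ^+ (j - k).
  by rewrite lerXn2r // nnegrE // ltW.
have h2 : j%:R ^+ k <= 4 ^+ j :> R.
  case: j kj {h1} => [|j] kj.
    by move: kj; rewrite leqn0 => /eqP ->; rewrite !expr0.
  by rewrite (le_trans _ (pow4 j.+1)) // ler_weXn2l // ler1n.
apply: (@le_trans _ _ ((sigma / 4) ^+ (j - k) * 4 ^+ j)).
  by rewrite ler_pM ?exprn_ge0.
have s0 : sigma != 0 by exact: lt0r_neq0.
have -> : (sigma / 4) ^+ (j - k) = (sigma / 4) ^+ j * (4 / sigma) ^+ k.
  rewrite -{2}(subnK kj) exprD -mulrA -exprMn.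
  have -> : sigma / 4 * (4 / sigma) = 1 by field.
  by rewrite expr1n mulr1.
rewrite expr_div_n le_eqVlt; apply/orP; left; apply/eqP.
have : 4 ^+ j != 0 :> R by rewrite expf_neq0.
by move: (4 ^+ j) (sigma ^+ j) (_ ^+ k) => A B C A0; field.
Qed.

Lemma ev_par_bound l : `|ev (map tpar l) e x| <= 4 / sigma * nrm l.
Proof.
have s4 : 0 <= 4 / sigma by rewrite divr_ge0 // ltW.
apply: key => // -[[j n] [a b]].
rewrite /= !normrM -mulrDr ger0_norm //.
case: j => [|j]; first by rewrite mul0r mulr0 mulr_ge0 // wt_ge0.
have := @pow_par j.+1 1 isT isT; rewrite subn1 /= !expr1 => h.
rewrite /wt /= [leLHS]mulrA [leRHS]mulrA [X in _ <= X * _]mulrA ler_wpM2r ?addr_ge0 //.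
apply: (le_trans h); rewrite ler_peMr //.
  by rewrite mulr_ge0 // exprn_ge0 // ltW.
by have : 0 <= n%:R :> R by []; nra.
Qed.

Lemma ev_par2_bound l : `|ev (map tpar (map tpar l)) e x| <= (4 / sigma) ^+ 2 * nrm l.
Proof.
have s4 : 0 <= (4 / sigma) ^+ 2 by rewrite sqr_ge0.
rewrite -map_comp; apply: key => // -[[j n] [a b]].
rewrite /= !normrM -!mulrDr !normr_nat.
case: j => [|[|j]]; first by rewrite !mul0r mulr0 mulr_ge0 // wt_ge0.
  by rewrite mul0r mulr0 mulr_ge0 // wt_ge0.
have := @pow_par j.+2 2 isT isT; rewrite subn2 /= => h.
rewrite /wt /= [X in e ^+ j * X]mulrA [leLHS]mulrA [leRHS]mulrA [X in _ <= X * _]mulrA ler_wpM2r ?addr_ge0 //.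
apply: le_trans (_ : e ^+ j * j.+2%:R ^+ 2 <= _).
  rewrite ler_wpM2l ?exprn_ge0 // mulrC expr2 ler_wpM2l // ler_nat //.
apply: (le_trans h); rewrite ler_peMr //.
  by rewrite mulr_ge0 // exprn_ge0 // ltW.
by have : 0 <= n%:R :> R by []; nra.
Qed.

End Bounds.

Definition lX : seq term := [:: (1%N, 1%N, (1, 0))].
Definition l2Y : seq term := [:: (1%N, 1%N, (0, 2))].

(* Picard iteration for the curve: [d] is the increment from [xi] to the next iterate. *)
Definition dstep xi d := let m := lmul d (xi ++ xi ++ d) in
  map tshift (map tsolve (map tang d)) ++
  map tsolve (map topp m ++ lmul lX m ++ lmul l2Y d).
Definition picard k :=
  iter k (fun p : seq term * seq term => (p.1 ++ p.2, dstep p.1 p.2)) ([::], map tsolve (map topp lX)).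

Lemma ev_lX e x : ev lX e x = e * cos x.
Proof. by rewrite /ev big_seq1 /tev /= expr1 !mul1r mul0r addr0. Qed.

Lemma ev_l2Y e x : ev l2Y e x = 2 * (e * sin x).
Proof. by rewrite /ev big_seq1 /tev /= expr1 mul1r mul0r add0r mulrCA. Qed.

(* For [gamma = 0] and [e = I1 / I3] frozen, [theta3 = 2pi/3 + 2 atan (u (x))] with
   [x = 2pi/3 + theta1 - theta3] is invariant when [u' = sqrt 3 u + curve_rhs e x u u']. *)
Definition curve_rhs e x u du : R :=
  e * du - u ^+ 2 - e * cos x * (1 - u ^+ 2) + 2 * (e * sin x) * u.

Lemma ev_solve2 l e x :
  ev (map tang (map tsolve l)) e x = Num.sqrt 3 * ev (map tsolve l) e x + ev l e x.
Proof. by rewrite -(ev_solve l) -map_comp addrC subrK. Qed.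

(** The right-hand side is quadratic in u and affine in u', so its increment has a closed form in
    which the only nonlinear quantity is (u + v)^2 - u^2 = v (2 u + v), the product [m] in
    [dstep]. *)
Lemma dstepE xi d e x : let u := ev xi e x in let v := ev d e x in
  let du := ev (map tang xi) e x in let dv := ev (map tang d) e x in
  ev (map tang (dstep xi d)) e x - Num.sqrt 3 * ev (dstep xi d) e x =
  curve_rhs e x (u + v) (du + dv) - curve_rhs e x u du.
Proof.
move=> u v du dv; rewrite /dstep map_cat !ev_cat.
have -> : map tang (map tshift (map tsolve (map tang d))) =
          map tshift (map tang (map tsolve (map tang d))).
  by rewrite -!map_comp; apply: eq_map.
rewrite !ev_shift !ev_solve2 !ev_cat !ev_mul ev_opp !ev_mul ev_lX ev_l2Y !ev_cat.
by rewrite /curve_rhs -/u -/v -/dv; ring.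
Qed.

(** The invariant of the iteration is that xi + d solves the linear equation with right-hand side
    taken at xi. The defect of xi is therefore carried entirely by the pending increment d. *)
Lemma picardE k e x : let s := picard k in
  ev (map tang s.1) e x - Num.sqrt 3 * ev s.1 e x -
    curve_rhs e x (ev s.1 e x) (ev (map tang s.1) e x) =
  - (ev (map tang s.2) e x - Num.sqrt 3 * ev s.2 e x).
Proof.
elim: k => [|k].
  have -> : picard 0 = ([::], map tsolve (map topp lX)) by [].
  have := ev_opp lX e x; move: (map topp lX) => L /= hL.
  by rewrite ev_solve2 hL ev_lX /ev !big_nil /curve_rhs; ring.
rewrite /picard iterS -/(picard k); move: (picard k) => [xi d] /= IH.
rewrite dstepE map_cat !ev_cat; move: IH; rewrite /curve_rhs => IH.
by lra.
Qed.

Hypothesis sigma_le : sigma <= 100^-1.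

(** The increments contract: e u' contributes 2 [sigma], the quadratic term 20 [sigma], its product
    with e cos x at most 4/100 of that, and the linear term 8 [sigma]. For [sigma] <= 1/100 the sum
    is below 1/2. *)
Lemma picard_nrm k : let s := picard k in
  nrm s.2 <= 4 * sigma / 2 ^+ k /\ nrm s.1 <= 8 * sigma * (1 - 2 ^- k).
Proof.
have hX : nrm lX = 4 * sigma by rewrite /nrm big_seq1 /wt /= expr1 normr1 normr0; ring.
have hY : nrm l2Y = 8 * sigma.
  by rewrite /nrm big_seq1 /wt /= expr1 normr0 ger0_norm //; ring.
elim: k => [|k].
  have -> : picard 0 = ([::], map tsolve (map topp lX)) by [].
  have := nrm_opp lX; move: (map topp lX) => L hL.
  rewrite /= expr0 invr1 subrr mulr0 mulr1 {2}/nrm big_nil; split => //.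
  by rewrite (le_trans (nrm_solve _)) // (le_trans hL) // hX.
rewrite /picard iterS -/(picard k); move: (picard k) => [xi d] /= [hd hxi].
have k0 : 0 < 2 ^- k :> R by rewrite invr_gt0 exprn_gt0.
have k1 : 2 ^- k <= 1 :> R by rewrite invf_le1 ?exprn_gt0 // exprn_ege1 // ler1n.
rewrite exprS invfM nrm_cat; move: (2 ^- k) k0 k1 hd hxi => q q0 q1 hd hxi.
have s0 := sigma_gt0; have d0 := nrm_ge0 d; have x0 := nrm_ge0 xi.
split; last by lra.
rewrite /dstep; set m := lmul d (xi ++ xi ++ d).
have hm : nrm m <= nrm d * (2 * nrm xi + nrm d).
  rewrite (le_trans (nrm_mul _ _)) // !nrm_cat le_eqVlt; apply/orP; left; apply/eqP; ring.
have hm2 : nrm m <= nrm d * (20 * sigma).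
  have : 2 * nrm xi + nrm d <= 20 * sigma by nra.
  by move=> h; rewrite (le_trans hm) // ler_wpM2l.
have m0 := nrm_ge0 m.
rewrite nrm_cat.
have h1 := nrm_shift (map tsolve (map tang d)).
have h2 : nrm (map tsolve (map tang d)) <= 2 * nrm d by rewrite -map_comp nrm_solve_ang.
have h3 := nrm_solve (map topp m ++ lmul lX m ++ lmul l2Y d).
rewrite !nrm_cat in h3.
have h4 := nrm_opp m; have h5 := nrm_mul lX m; have h6 := nrm_mul l2Y d.
rewrite hX in h5; rewrite hY in h6.
have h7 : sigma * nrm (map tsolve (map tang d)) <= sigma * (2 * nrm d) by rewrite ler_wpM2l // ltW.
have s100 : 4 * sigma <= 4 / 100 by have := sigma_le; lra.
have h8 : 4 * sigma * nrm m <= 4 / 100 * nrm m by rewrite ler_wpM2r.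
have h9 : sigma * nrm d <= 100^-1 * nrm d by rewrite ler_wpM2r.
have h10 : nrm d * (20 * sigma) <= 20 / 100 * nrm d by nra.
lra.
Qed.

(** The iteration is stopped at a finite stage, so the curve is a finite sum with explicit
    derivatives and no limit has to be taken. The norm bound is uniform in [delta], which lets the
    tolerance be chosen after all other constants. *)
Theorem repelling_curve (delta : R) : 0 < delta ->
  exists l, nrm l <= 8 * sigma /\ forall e x, 0 <= e -> e <= sigma / 4 ->
    `|ev (map tang l) e x - Num.sqrt 3 * ev l e x
       - curve_rhs e x (ev l e x) (ev (map tang l) e x)| <= delta.
Proof.
move=> d0.
(* The defect is at most |d'| + sqrt 3 |d| <= 3 [nrm] d, and [nrm] d <= 4 [sigma] / 2^k. *)
pose k := Num.bound (12 * sigma / delta).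
have hk : 12 * sigma / delta < 2 ^+ k by exact: upper_nthrootP.
exists (picard k).1; have [h2 h1] := picard_nrm k; split.
  by rewrite (le_trans h1) // ler_piMr ?mulr_ge0 ?ltW // gtrBl invr_gt0 exprn_gt0.
move=> e x e0 es; rewrite picardE normrN.
have b1 := ev_bound x e0 es (picard k).2; have b2 := ev_ang_bound x e0 es (picard k).2.
have [c1 c2] := sqrt3_bounds.
rewrite (le_trans (ler_normB _ _)) // normrM (ger0_norm (sqrtr_ge0 _)).
have h3 : Num.sqrt 3 * `|ev (picard k).2 e x| <= 2 * nrm (picard k).2.
  by rewrite ler_pM ?sqrtr_ge0.
have h4 : 12 * sigma / 2 ^+ k <= delta.
  by rewrite ler_pdivrMr ?exprn_gt0 // [leRHS]mulrC -ler_pdivrMr // ltW.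
by lra.
Qed.

End TrigSeries.

(** * Jets of trigonometric sums *)

Section JetRules.
Context {R : realType}.
Notation st := (bstate R).
Implicit Types (J K M : @jet R) (f g : st -> R) (x v w : st) (l : seq (@term R)).

Lemma is_derive_tev (t : @term R) f g x v (df dg : R) :
  is_derive x v f df -> is_derive x v g dg ->
  is_derive x v (fun y => tev t (f y) (g y))
    (tev (tpar t) (f x) (g x) * df + tev (tang t) (f x) (g x) * dg).
Proof.
case: t => [[j n] [a b]] hf hg; rewrite /tev /tpar /tang /=.
have hn : is_derive x v (fun y => n%:R * g y) (n%:R * dg).
  have := is_deriveMf (is_derive_cst (n%:R : R) x v) hg.
  by move/is_derive_eq; apply; rewrite mulr0 addr0.
have hc := is_derive_comp1 hn (is_derive_cos (n%:R * g x)).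
have hs := is_derive_comp1 hn (is_derive_sin (n%:R * g x)).
have hca := is_deriveMf (is_derive_cst (a : R) x v) hc.
have hsb := is_deriveMf (is_derive_cst (b : R) x v) hs.
have hj : is_derive x v (fun y => f y ^+ j) (j%:R * f x ^+ j.-1 * df).
  have hX : is_derive (f x) 1 (fun z : R => z ^+ j) (j%:R * f x ^+ j.-1).
    apply: DeriveDef; first exact: (@exprn_derivable R j (f x) 1).
    by rewrite (@exp_derive R j (f x) 1) /GRing.scale/= mulr1.
  exact: is_derive_comp1 hf hX.
have := is_deriveMf hj (is_deriveDf hca hsb).
by move/is_derive_eq; apply => /=; ring.
Qed.

Lemma is_derive_ev l f g x v (df dg : R) :
  is_derive x v f df -> is_derive x v g dg ->
  is_derive x v (fun y => ev l (f y) (g y))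
    (ev (map tpar l) (f x) (g x) * df + ev (map tang l) (f x) (g x) * dg).
Proof.
move=> hf hg; elim: l => [|t l IH].
  rewrite (_ : (fun y => _) = cst 0); last by apply/funext => y; rewrite /ev big_nil.
  rewrite /ev /= !big_nil !mul0r addr0; exact: is_derive_cst.
rewrite (_ : (fun y => _) = (fun y => tev t (f y) (g y) + ev l (f y) (g y))); last first.
  by apply/funext => y; rewrite /ev big_cons.
have := is_deriveDf (is_derive_tev t hf hg) IH.
by move/is_derive_eq; apply; rewrite /ev /= !big_cons; ring.
Qed.

Lemma continuous_ev l f g x : {for x, continuous f} -> {for x, continuous g} ->
  {for x, continuous (fun y => ev l (f y) (g y))}.
Proof.
move=> hf hg; elim: l => [|[[j n] [a b]] l IH].
  rewrite (_ : (fun y => _) = cst 0); first exact: cvg_cst.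
  by apply/funext => y; rewrite /ev big_nil.
rewrite (_ : (fun y => _) = (fun y => tev ((j, n), (a, b)) (f y) (g y) + ev l (f y) (g y))); last first.
  by apply/funext => y; rewrite /ev big_cons.
apply: continuousD => //; rewrite /tev /=.
have hn : {for x, continuous (fun y => n%:R * g y)}.
  by apply: continuousM => //; exact: cvg_cst.
apply: continuousM.
  apply: (@continuous_comp _ _ _ f (fun z : R => z ^+ j) x hf).
  exact: exprn_continuous.
apply: continuousD; apply: continuousM; try exact: cvg_cst.
  by apply: (@continuous_comp _ _ _ _ (@cos R) x hn); exact: continuous_cos.
by apply: (@continuous_comp _ _ _ _ (@sin R) x hn); exact: continuous_sin.
Qed.

Definition jev l J K := Jet (fun x => ev l (jv J x) (jv K x))
  (fun v x => ev (map tpar l) (jv J x) (jv K x) * j1 J v x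
            + ev (map tang l) (jv J x) (jv K x) * j1 K v x)
  (fun v w x =>
     (ev (map tpar l) (jv J x) (jv K x) * j2 J v w x
      + j1 J v x * (ev (map tpar (map tpar l)) (jv J x) (jv K x) * j1 J w x
                  + ev (map tang (map tpar l)) (jv J x) (jv K x) * j1 K w x))
   + (ev (map tang l) (jv J x) (jv K x) * j2 K v w x
      + j1 K v x * (ev (map tpar (map tang l)) (jv J x) (jv K x) * j1 J w x
                  + ev (map tang (map tang l)) (jv J x) (jv K x) * j1 K w x))).

Lemma jev_ok l J K : jet_ok J -> jet_ok K -> jet_ok (jev l J K).
Proof.
move=> hJ hK x qx; have [cJ dJ] := hJ x qx; have [cK dK] := hK x qx.
split; first exact: continuous_ev.
move=> v; have [J1 [cJ1 J2]] := dJ v; have [K1 [cK1 K2]] := dK v.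
split; first exact: is_derive_ev.
split.
  by apply: continuousD; apply: continuousM => //; exact: continuous_ev.
move=> w; have [J3 J4] := J2 w; have [K3 K4] := K2 w.
have [J1' [cJ1' _]] := dJ w; have [K1' [cK1' _]] := dK w.
split.
  by apply: is_deriveDf; apply: is_deriveMf => //; exact: is_derive_ev.
apply: continuousD; apply: continuousD; apply: continuousM => //;
  try exact: continuous_ev;
  by apply: continuousD; apply: continuousM => //; exact: continuous_ev.
Qed.

Section Rules.
Variables gamma T1 T3 : R.
Notation L := (jgen gamma T1 T3).
Notation G := (jgam gamma T1 T3).

Ltac generalize_jets J K := 
  move: (j1 J _ _) (j1 J _ _) (j1 J _ _) (j1 J _ _) (j2 J _ _ _) (j2 J _ _ _)
    (j2 J _ _ _) (j2 J _ _ _);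
  move: (j1 K _ _) (j1 K _ _) (j1 K _ _) (j1 K _ _) (j2 K _ _ _) (j2 K _ _ _)
    (j2 K _ _ _) (j2 K _ _ _).

(** The Ito formula in two variables. The hypothesis removes the mixed second derivatives; it holds
    for I1 / I3 and the angle variable, as actions and angles have independent noises. *)
Lemma jgen_ev l J K x : G J K x = 0 -> let e := jv J x in let a := jv K x in
  L (jev l J K) x = ev (map tpar l) e a * L J x + ev (map tang l) e a * L K x
    + ev (map tpar (map tpar l)) e a / 2 * G J J x
    + ev (map tang (map tang l)) e a / 2 * G K K x.
Proof.
move=> h e a; rewrite -[RHS]addr0 -[X in _ + X](mulr0 ((ev (map tang (map tpar l)) e a +
  ev (map tpar (map tang l)) e a) / 2)) -h.
rewrite /jgen /jgam /= -/e -/a; move: (ev _ _ _) (ev _ _ _) (ev _ _ _) (ev _ _ _) (ev _ _ _) (ev _ _ _).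
by generalize_jets J K => *; field.
Qed.

Lemma jgamC J K x : G J K x = G K J x.
Proof. by rewrite /jgam; congr (_ * _ + _ * _ + _ * _ + _ * _); exact: mulrC. Qed.

Lemma jgam_ev l J K M x : G (jev l J K) M x =
  ev (map tpar l) (jv J x) (jv K x) * G J M x + ev (map tang l) (jv J x) (jv K x) * G K M x.
Proof.
rewrite /jgam /=; move: (ev _ _ _) (ev _ _ _).
move: (j1 M _ _) (j1 M _ _) (j1 M _ _) (j1 M _ _) (j1 J _ _) (j1 J _ _) (j1 J _ _) (j1 J _ _).
by move: (j1 K _ _) (j1 K _ _) (j1 K _ _) (j1 K _ _) => *; field.
Qed.

Lemma jgam_cst c K x : G (jcst c) K x = 0.
Proof. by rewrite /jgam /= !(mul0r, mulr0, addr0). Qed.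

Lemma jgam_add J K M x : G (jadd J K) M x = G J M x + G K M x.
Proof.
rewrite /jgam /=.
move: (j1 M _ _) (j1 M _ _) (j1 M _ _) (j1 M _ _) (j1 J _ _) (j1 J _ _) (j1 J _ _) (j1 J _ _).
by move: (j1 K _ _) (j1 K _ _) (j1 K _ _) (j1 K _ _) => *; ring.
Qed.

Lemma jgam_mul J K M x : G (jmul J K) M x = jv J x * G K M x + jv K x * G J M x.
Proof.
rewrite /jgam /=; move: (jv _ _) (jv _ _).
move: (j1 M _ _) (j1 M _ _) (j1 M _ _) (j1 M _ _) (j1 J _ _) (j1 J _ _) (j1 J _ _) (j1 J _ _).
by move: (j1 K _ _) (j1 K _ _) (j1 K _ _) (j1 K _ _) => *; field.
Qed.

Lemma jgam_comp p p1 p2 J M x : G (jcomp p p1 p2 J) M x = p1 (jv J x) * G J M x.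
Proof.
rewrite /jgam /=; move: (p1 _).
move: (j1 M _ _) (j1 M _ _) (j1 M _ _) (j1 M _ _) (j1 J _ _) (j1 J _ _) (j1 J _ _) (j1 J _ _).
by move=> *; field.
Qed.

End Rules.
End JetRules.

(** * The Poisson inequality and the distance to the curve *)

Section RealEstimates.
Context {R : realType}.
Implicit Types x : R.

(* The true variance of the stationary law of [I3 / T3^(1/3)] is about 0.081;
   the cubic is a polynomial approximation of the solution of the Poisson equation. *)
Lemma poisson_cubic x : 0 <= x ->
  (x - 92/100) ^+ 2 <= 11/100
    + (x ^+ 3 - 1) * (- (3/4) + 3/2 * x - 9/10 * x ^+ 2 + 1/5 * x ^+ 3)
    - x / 4 * (3/2 - 9/5 * x + 3/5 * x ^+ 2).
Proof.
move=> x0; rewrite -subr_ge0; set p := (X in 0 <= X).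
(* Positivity certificate: on [0, 1] and [1, 2] the difference is written in products of powers of
   the distances to the endpoints, as in a Bernstein basis of degree 6, and beyond 2 in powers of x
   - 2. All coefficients are positive. *)
have [x1|x1] := lerP x 1.
  pose y := 1 - x; have y0 : 0 <= y by rewrite subr_ge0.
  have -> : p = 17/1250 * (x ^+ 0 * y ^+ 6) + 233/5000 * (x ^+ 1 * y ^+ 5) + 379/1000 * (x ^+ 2 * y ^+ 4) + 111/500 * (x ^+ 3 * y ^+ 3) + 77/500 * (x ^+ 4 * y ^+ 2) + 533/5000 * (x ^+ 5 * y ^+ 1) + 143/5000 * (x ^+ 6 * y ^+ 0).
    by rewrite /p /y; field.
  have m i j : 0 <= x ^+ i * y ^+ j by rewrite mulr_ge0 ?exprn_ge0.
  clearbody y; have := m 0%N 6; have := m 1%N 5; have := m 2 4; have := m 3 3; have := m 4 2; have := m 5 1%N; have := m 6 0%N; lra.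
have [x2|x2] := lerP x 2.
  pose y := 2 - x; have y0 : 0 <= y by rewrite subr_ge0.
  pose z := x - 1; have z0 : 0 <= z by rewrite subr_ge0 ltW.
  have -> : p = 143/5000 * (z ^+ 0 * y ^+ 6) + 1183/5000 * (z ^+ 1 * y ^+ 5) + 201/250 * (z ^+ 2 * y ^+ 4) + 661/500 * (z ^+ 3 * y ^+ 3) + 1079/1000 * (z ^+ 4 * y ^+ 2) + 3483/5000 * (z ^+ 5 * y ^+ 1) + 1359/2500 * (z ^+ 6 * y ^+ 0).
    by rewrite /p /y /z; field.
  have m i j : 0 <= z ^+ i * y ^+ j by rewrite mulr_ge0 ?exprn_ge0.
  clearbody y z; have := m 0%N 6; have := m 1%N 5; have := m 2 4; have := m 3 3; have := m 4 2; have := m 5 1%N; have := m 6 0%N; lra.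
pose z := x - 2; have z0 : 0 <= z by rewrite subr_ge0 ltW.
have -> : p = 1359/2500 * (z ^+ 0) + 513/200 * (z ^+ 1) + 23/4 * (z ^+ 2) + 69/10 * (z ^+ 3) + 9/2 * (z ^+ 4) + 3/2 * (z ^+ 5) + 1/5 * (z ^+ 6).
  by rewrite /p /z; field.
have m i : 0 <= z ^+ i by rewrite exprn_ge0.
clearbody z; have := m 1%N; have := m 2; have := m 3; have := m 4; have := m 5; have := m 6; lra.
Qed.

Lemma mul_itv (a b x y : R) : -a <= x -> x <= a -> -b <= y -> y <= b ->
  - (a * b) <= x * y /\ x * y <= a * b.
Proof.
move=> x1 x2 y1 y2; have hx : `|x| <= a by rewrite ler_norml x1.
have hy : `|y| <= b by rewrite ler_norml y1.
apply/andP; rewrite -ler_norml normrM ler_pM //.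
Qed.

(* Completing squares in the cross terms with the residual drifts [r0] and [M]. *)
Lemma absorb_cross (X w I3 r0 M : R) : 0 < I3 -> X ^+ 2 <= 8 * w ->
  - (I3 * w) - 4 * I3 * r0 ^+ 2 - 4 * M ^+ 2 / I3 <= I3 * (X * r0) + X * M.
Proof.
move=> I30 X2.
have h2 : - (w / 2) - 4 * r0 ^+ 2 <= X * r0.
  have := sqr_ge0 (X / 4 + 2 * r0); rewrite sqrrD; lra.
have h2' : I3 * (- (w / 2) - 4 * r0 ^+ 2) <= I3 * (X * r0) by rewrite ler_wpM2l // ltW.
have -> : 4 * M ^+ 2 / I3 = I3 * (4 * (M / I3) ^+ 2).
  by field; exact: lt0r_neq0.
have -> : X * M = I3 * (X * (M / I3)).
  by field; exact: lt0r_neq0.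
move: (M / I3) => m.
have h3 : - (w / 2) - 4 * m ^+ 2 <= X * m.
  have := sqr_ge0 (X / 4 + 2 * m); rewrite sqrrD; lra.
have h3' : I3 * (- (w / 2) - 4 * m ^+ 2) <= I3 * (X * m) by rewrite ler_wpM2l // ltW.
lra.
Qed.

(** [dist_u] and [dist_xi] are the partial derivatives of [dist] in u and in xi. *)
Definition dist_u (C S xi : R) := S - 2 * xi * C - xi ^+ 2 * S.
Definition dist_xi (C S xi : R) := - 2 * S + 2 * xi * (1 + C).
(* [2 (sin (u / 2) - xi cos (u / 2)) ^ 2] where [C = cos u] and [S = sin u]: it vanishes
   exactly on the curve [tan (u / 2) = xi]. *)
Definition dist (C S xi : R) := 1 - C - 2 * xi * S + xi ^+ 2 * (1 + C).

(* Drifts, in units of [I3], of [theta3] and of the repelling curve. *)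
Definition th3_drift (C S e ca sa c3 : R) :=
  - (1 - C - c3 * S) - 2 * e * (ca * C - sa * S).
Definition curve_drift (xi e ca sa c3 : R) :=
  c3 * xi - xi ^+ 2 - e * ((1 - xi ^+ 2) * ca - 2 * xi * sa).
(** Half the exponential rate, in units of I3, at which the noiseless flow increases [dist]. At u =
    xi = e = 0 it equals [c3], that is sqrt 3. *)
Definition expansion (C S xi e ca sa c3 : R) :=
  (e * ca * S + (c3 + 2 * (e * sa)) * (1 + C) + (-1 + e * ca) * S) / 2 + (-1 + e * ca) * xi.

(** In the variable t = tan (u / 2) the drift of theta3 is the same quadratic Riccati field as
    [curve_drift], evaluated at t instead of xi. The difference of the two is divisible by t - xi,
    and [dist] is (t - xi)^2 up to the factor 2 cos^2 (u / 2). *)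
Lemma dist_drift (C S xi e ca sa c3 : R) : C ^+ 2 + S ^+ 2 = 1 ->
  dist_u C S xi * th3_drift C S e ca sa c3 + dist_xi C S xi * curve_drift xi e ca sa c3 =
  2 * expansion C S xi e ca sa c3 * dist C S xi.
Proof.
move=> CS; apply/eqP; rewrite -subr_eq0; apply/eqP.
transitivity ((C ^+ 2 + S ^+ 2 - 1) *
  ((1 - xi ^+ 2) * (c3 + 2 * e * sa) + 2 * xi * (-1 + 2 * e * ca))).
  by rewrite /expansion /dist_u /dist_xi /dist /th3_drift /curve_drift; field.
by rewrite CS subrr mul0r.
Qed.

(** As [dist] is twice a square q^2, the square of each of its derivatives is 8 (q')^2 [dist].
    Gradients thus vanish on the curve like the root of [dist], which is what makes the cross terms
    absorbable. *)
Lemma dist_xi_sqr (C S xi : R) : C ^+ 2 + S ^+ 2 = 1 ->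
  dist_xi C S xi ^+ 2 = 4 * (1 + C) * dist C S xi.
Proof.
move=> CS; apply/eqP; rewrite -subr_eq0; apply/eqP.
transitivity ((C ^+ 2 + S ^+ 2 - 1) * 4).
  by rewrite /dist_xi /dist; ring.
by rewrite CS subrr mul0r.
Qed.

Lemma dist_u_sqr (C S xi : R) : C ^+ 2 + S ^+ 2 = 1 ->
  dist_u C S xi ^+ 2 = ((1 + C) + 2 * (xi * S) + xi * xi * (1 - C)) * dist C S xi.
Proof.
move=> CS; apply/eqP; rewrite -subr_eq0; apply/eqP.
transitivity ((C ^+ 2 + S ^+ 2 - 1) * ((1 + xi ^+ 2) ^+ 2)).
  by rewrite /dist_u /dist; ring.
by rewrite CS subrr mul0r.
Qed.

Lemma CS_bounds (C S : R) : C ^+ 2 + S ^+ 2 = 1 -> [/\ -1 <= C, C <= 1, -1 <= S & S <= 1].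
Proof. by move=> CS; split; nra. Qed.

Lemma dist_ge0 (C S xi : R) : C ^+ 2 + S ^+ 2 = 1 -> 0 <= dist C S xi.
Proof.
move=> CS; have [h1 h2 h3 h4] := CS_bounds CS.
have [C1|C1] := eqVneq (1 + C) 0.
  have CE : C = -1 by clear - C1; lra.
  have SE : S = 0 by move: CS; rewrite CE => ?; nra.
  by rewrite /dist CE SE; clear; lra.
have hX : 0 <= 4 * (1 + C) * dist C S xi by rewrite -dist_xi_sqr // sqr_ge0.
have hC : 0 < 1 + C by rewrite lt_neqAle eq_sym C1 /=; clear - h1; lra.
by move: hX; rewrite pmulr_rge0 // mulr_gt0.
Qed.

Lemma dist_far (C S xi : R) : C ^+ 2 + S ^+ 2 = 1 -> -(1/100) <= xi -> xi <= 1/100 ->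
  1 / 20 <= dist C S xi -> 1 / 40 <= 1 - C.
Proof.
move=> CS x1 x2; have [h1 h2 h3 h4] := CS_bounds CS.
have [a1 a2] := mul_itv x1 x2 h3 h4; have [b1 b2] := mul_itv x1 x2 x1 x2.
have [d1 d2] := mul_itv b1 b2 h1 h2.
rewrite /dist expr2; clear - a1 a2 b1 b2 d1 d2; lra.
Qed.

Lemma dist_near (C S xi : R) : C ^+ 2 + S ^+ 2 = 1 -> -(1/100) <= xi -> xi <= 1/100 ->
  dist C S xi <= 1 / 10 -> [/\ 86/100 <= C, -(52/100) <= S & S <= 52/100].
Proof.
move=> CS x1 x2 hw; have [h1 h2 h3 h4] := CS_bounds CS.
have [a1 a2] := mul_itv x1 x2 h3 h4.
have b1 : 0 <= xi ^+ 2 * (1 + C) by rewrite mulr_ge0 ?sqr_ge0 //; clear - h1; lra.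
have hC : 86/100 <= C by move: hw; rewrite /dist; clear - a1 a2 b1; lra.
by clear - hC CS; split => //; nra.
Qed.

Lemma expansion_ge1 (C S xi e ca sa c3 : R) :
  86/100 <= C -> -(52/100) <= S -> S <= 52/100 -> -(1/100) <= xi -> xi <= 1/100 ->
  0 <= e -> e <= 1/100 -> ca ^+ 2 + sa ^+ 2 = 1 -> 173/100 <= c3 ->
  1 <= expansion C S xi e ca sa c3.
Proof.
move=> Cl S1 S2 xil xiu e0 n2 cs c3l.
have [c1 c2 s1 s2] := CS_bounds cs.
have n1 : - (1/100) <= e by clear - e0; lra.
have := mul_itv n1 n2 c1 c2; have := mul_itv n1 n2 s1 s2.
rewrite /expansion; move: (e * ca) (e * sa) => p q [q1 q2] [p1 p2].
have [pS _] := mul_itv p1 p2 S1 S2; have [px _] := mul_itv p1 p2 xil xiu.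
have hU : 168/100 <= c3 + 2 * q by clear - c3l q1; lra.
have hV : 186/100 <= 1 + C by clear - Cl; lra.
have n3 : 0 <= 168/100 :> R by clear; lra.
have n4 : 0 <= 186/100 :> R by clear; lra.
have h1 := ler_pM n3 n4 hU hV.
clear - h1 pS px S1 S2 xil xiu; lra.
Qed.

(** Since the expansion rate is at least 1, the flow yields 2 I3 [dist]; half of it absorbs the
    cross terms with the residual [r0] and the slow drift [M]. On the curve only the second-order
    term survives, and its lower bound g / 4 is what drives theta3 away. *)
Lemma dist_gen_lower (C S xi e ca sa c3 I3 g xa r0 M gxx : R) :
  C ^+ 2 + S ^+ 2 = 1 -> ca ^+ 2 + sa ^+ 2 = 1 -> `|xi| <= 1/100 -> `|xa| <= 1/100 ->
  0 <= e -> e <= 1/100 -> 173/100 <= c3 -> dist C S xi <= 1 / 10 ->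
  0 < I3 -> 0 < g -> 0 <= gxx ->
  I3 * dist C S xi + g / 4 - 4 * I3 * r0 ^+ 2 - 4 * M ^+ 2 / I3 <=
  dist_u C S xi * (I3 * th3_drift C S e ca sa c3)
  + dist_xi C S xi * (I3 * (curve_drift xi e ca sa c3 + r0) + M)
  + g * ((C + 2 * xi * S - xi ^+ 2 * C) / 2 + (2 * C + 2 * xi * S) * xa) + (1 + C) * gxx.
Proof.
move=> CS cs xis xas e0 e1 c3l hw I30 g0 gxx0.
have [xal xau] : -(1/100) <= xa /\ xa <= 1/100 by apply/andP; rewrite -ler_norml.
have [xl xu] : -(1/100) <= xi /\ xi <= 1/100 by apply/andP; rewrite -ler_norml.
have [_ C1 _ _] := CS_bounds CS.
have [hC S1 S2] := dist_near CS xl xu hw.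
have hL := expansion_ge1 hC S1 S2 xl xu e0 e1 cs c3l.
have w0 := dist_ge0 xi CS.
have X2 : dist_xi C S xi ^+ 2 <= 8 * dist C S xi.
  by rewrite dist_xi_sqr // ler_wpM2r //; clear - C1; lra.
have D := dist_drift xi e ca sa c3 CS.
have h2 := absorb_cross r0 M I30 X2.
have -> : dist_u C S xi * (I3 * th3_drift C S e ca sa c3)
  + dist_xi C S xi * (I3 * (curve_drift xi e ca sa c3 + r0) + M) =
  I3 * (2 * expansion C S xi e ca sa c3 * dist C S xi)
   + (I3 * (dist_xi C S xi * r0) + dist_xi C S xi * M) by rewrite -D; ring.
move: hL h2 w0 {D hw X2}.
move: (dist C S xi) (dist_xi C S xi) (expansion _ _ _ _ _ _ _) => w X Lam hL h2 w0.
have h1 : I3 * (2 * w) <= I3 * (2 * Lam * w).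
  by rewrite ler_wpM2l ?(ltW I30) // ler_wpM2r // ler_peMr.
have [xS1 xS2] := mul_itv xl xu S1 S2.
have [xx1 xx2] := mul_itv xl xu xl xu.
have n1 : -1 <= C by clear - hC; lra.
have [xC1 xC2] := mul_itv xx1 xx2 n1 C1.
have k1 : - (22/10) <= 2 * C + 2 * xi * S by clear - xS1 hC; lra.
have k2 : 2 * C + 2 * xi * S <= 22/10 by clear - xS2 C1; lra.
have [k3 _] := mul_itv k1 k2 xal xau.
have h4 : 1 / 4 <= (C + 2 * xi * S - xi ^+ 2 * C) / 2 + (2 * C + 2 * xi * S) * xa.
  by clear - xS1 xC2 k3 hC; rewrite expr2; lra.
have h5 : g / 4 <= g * ((C + 2 * xi * S - xi ^+ 2 * C) / 2 + (2 * C + 2 * xi * S) * xa).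
  by rewrite ler_wpM2l ?(ltW g0) // -[leLHS]mul1r.
have h6 : 0 <= (1 + C) * gxx by apply: mulr_ge0 => //; clear - n1; lra.
move: h1 h2 h5 h6; move: (I3 * (2 * Lam * w)) (I3 * (X * r0) + X * M) (g * _) ((1 + C) * _).
clear => u1 u2 u3 u4; lra.
Qed.

Lemma dist_gam_upper (C S xi g xa k : R) :
  C ^+ 2 + S ^+ 2 = 1 -> `|xi| <= 1/100 -> `|xa| <= 1/100 -> dist C S xi <= 1 / 10 ->
  0 < g -> 0 <= k ->
  dist_u C S xi ^+ 2 * g - 2 * dist_u C S xi * dist_xi C S xi * (g * xa)
    + dist_xi C S xi ^+ 2 * (g * k) <= g * dist C S xi * (3 + 8 * k).
Proof.
move=> CS xis; rewrite ler_norml => /andP[xal xau] hw g0 k0.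
have [xl xu] : -(1/100) <= xi /\ xi <= 1/100 by apply/andP; rewrite -ler_norml.
have [n1 C1 _ _] := CS_bounds CS.
have [hC S1 S2] := dist_near CS xl xu hw; have w0 := dist_ge0 xi CS.
have X2 : dist_xi C S xi ^+ 2 <= 8 * dist C S xi.
  by rewrite dist_xi_sqr // ler_wpM2r //; clear - C1; lra.
have A2 : dist_u C S xi ^+ 2 <= 21/10 * dist C S xi.
  rewrite dist_u_sqr // ler_wpM2r //.
  have [xS1 xS2] := mul_itv xl xu S1 S2.
  have [xx1 xx2] := mul_itv xl xu xl xu.
  have [xC1 xC2] := mul_itv xx1 xx2 n1 C1.
  by clear - xS2 xx2 xC1 C1; lra.
move: X2 A2 w0 {hw}.
move: (dist C S xi) (dist_xi C S xi) (dist_u C S xi) => w X A X2 A2 w0.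
have h1 : X ^+ 2 * k <= 8 * w * k by rewrite ler_wpM2r.
have h2 : - (2 * A * X * xa) <= (A ^+ 2 + X ^+ 2) / 100.
  have hp : 2 * A * X <= A ^+ 2 + X ^+ 2 by have := sqr_ge0 (A - X); rewrite sqrrB; clear; lra.
  have hm : - (A ^+ 2 + X ^+ 2) <= 2 * A * X by have := sqr_ge0 (A + X); rewrite sqrrD; clear; lra.
  by have [h _] := mul_itv hm hp xal xau; clear - h; lra.
rewrite [leLHS](_ : _ = g * (A ^+ 2 - 2 * A * X * xa + X ^+ 2 * k)); last by ring.
rewrite -[leRHS]mulrA ler_wpM2l ?(ltW g0) //; clear - h1 h2 A2 X2 w0; lra.
Qed.

(** The curvature of the cube produces the one term of order g with the wrong sign, - 3 y [gw]. It
    carries a factor w, so the expansion part 3 y^2 I3 w absorbs it by Young's inequality at a cost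
    of order g^2 / I3, and the gain 3 y^2 g / 4 remains. *)
Lemma bump_gen_lower (I3 g w y lw gw r0 M k : R) : 0 < I3 -> 0 < g -> 0 <= w -> 0 <= y ->
  y = 1/10 - w -> 0 <= k ->
  I3 * w + g / 4 - 4 * I3 * r0 ^+ 2 - 4 * M ^+ 2 / I3 <= lw -> gw <= g * w * (3 + 8 * k) ->
  3/4 * g * y ^+ 2 - I3 * r0 ^+ 2 - M ^+ 2 / I3 - (g * (3 + 8 * k)) ^+ 2 / I3 <=
  3 * y ^+ 2 * lw - 3 * y * gw.
Proof.
move=> I30 g0 w0 y0 yE k0 hl hg.
have w1 : w <= 1/10 by clear - y0 yE; lra.
have y1 : y ^+ 2 <= 1/100 by clear - y0 yE w0; nra.
have h1 : 3 * y ^+ 2 * (I3 * w + g / 4 - 4 * I3 * r0 ^+ 2 - 4 * M ^+ 2 / I3) <= 3 * y ^+ 2 * lw.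
  by rewrite ler_wpM2l // mulr_ge0 // sqr_ge0.
have h2 : 3 * y * gw <= 3 * y * (g * w * (3 + 8 * k)) by rewrite ler_wpM2l // mulr_ge0.
have e1 : 0 <= I3 * r0 ^+ 2 by rewrite mulr_ge0 ?sqr_ge0 // ltW.
have e2 : 0 <= M ^+ 2 / I3 by rewrite divr_ge0 ?sqr_ge0 // ltW.
have h3 : 3 * y * (g * w * (3 + 8 * k)) <= 3 * y ^+ 2 * (I3 * w) + (g * (3 + 8 * k)) ^+ 2 / I3.
  have -> : (g * (3 + 8 * k)) ^+ 2 / I3 = I3 * (g * (3 + 8 * k) / I3) ^+ 2.
    by field; exact: lt0r_neq0.
  have -> : 3 * y * (g * w * (3 + 8 * k)) = I3 * (3 * y * w * (g * (3 + 8 * k) / I3)).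
    by field; exact: lt0r_neq0.
  move: (g * _ / _) => c.
  rewrite [leRHS](_ : _ = I3 * (3 * y ^+ 2 * w + c ^+ 2)); last by ring.
  rewrite ler_wpM2l ?(ltW I30) //.
  have k1 : 0 <= w * (y - c / 2) ^+ 2 by rewrite mulr_ge0 ?sqr_ge0.
  have k2 : w * c ^+ 2 <= 1/10 * c ^+ 2 by rewrite ler_wpM2r ?sqr_ge0.
  have k3 := sqr_ge0 c; clear - k1 k2 k3; lra.
have h4 : y ^+ 2 * (I3 * r0 ^+ 2) <= 1/100 * (I3 * r0 ^+ 2) by rewrite ler_wpM2r.
have h5 : y ^+ 2 * (M ^+ 2 / I3) <= 1/100 * (M ^+ 2 / I3) by rewrite ler_wpM2r.
move: h1 h2 h3 h4 h5 e1 e2; rewrite -[4 * I3 * _]mulrA -[4 * M ^+ 2 / I3]mulrA.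
move: (3 * y * (g * w * _)) ((g * _) ^+ 2 / I3).
move: (I3 * r0 ^+ 2) (M ^+ 2 / I3).
clear => *; lra.
Qed.

End RealEstimates.

(** * Coordinates, curve and distance as jets *)

Section Coordinates.
Context {R : realType}.
Notation st := (bstate R).
Implicit Types (x : st) (l : seq (@term R)).

Definition jI1 : @jet R := jlin (fun x : st => x.1.1).
Definition jI3 : @jet R := jlin (fun x : st => x.1.2).
Definition jt1 : @jet R := jlin (fun x : st => x.2.1).
Definition jt3 : @jet R := jlin (fun x : st => x.2.2).

Lemma jI1_ok : jet_ok jI1.
Proof. by apply: jlin_ok; [move=> k a b|have [] := @bstate_coord_continuous R]. Qed.
Lemma jI3_ok : jet_ok jI3.
Proof. by apply: jlin_ok; [move=> k a b|have [] := @bstate_coord_continuous R]. Qed.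
Lemma jt1_ok : jet_ok jt1.
Proof. by apply: jlin_ok; [move=> k a b|have [] := @bstate_coord_continuous R]. Qed.
Lemma jt3_ok : jet_ok jt3.
Proof. by apply: jlin_ok; [move=> k a b|have [] := @bstate_coord_continuous R]. Qed.

Definition jinv (J : @jet R) := jcomp (fun y : R => y^-1) (fun y => - (y^-1 * y^-1))
  (fun y => 2 * y^-1 ^+ 3) J.

Lemma jinv_ok J : jet_ok J -> (forall x, pquad x -> jv J x != 0) -> jet_ok (jinv J).
Proof.
move=> okJ J0; apply: jcomp_ok => // x /J0 x0.
have dV : is_derive (jv J x) 1 (fun y : R => y^-1) (- ((jv J x)^-1 * (jv J x)^-1)).
  have hd : derivable (id : R -> R) (jv J x) 1 by exact: derivable_id.
  have h1 := @derivableV R R id (jv J x) 1 x0 hd.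
  have h2 := @deriveV R R id (jv J x) 1 x0 hd.
  apply: DeriveDef; first exact: h1.
  rewrite [LHS]h2 derive_id /GRing.scale/= mulr1.
  by rewrite -expr2 exprVn.
split => //.
  have := @is_deriveM R R _ _ _ _ _ _ dV dV.
  move/is_deriveN/is_derive_eq; apply.
  by rewrite /GRing.scale/=; ring.
have cV : {for jv J x, continuous (fun y : R => y^-1)} by exact: inv_continuous.
rewrite (_ : (fun y : R => _) = (fun y : R => 2 * (y^-1 * (y^-1 * y^-1)))); last first.
  by apply/funext => y; rewrite 2!exprS expr1.
apply: (@continuousM R R (cst 2)); first exact: cvg_cst.
by apply: (@continuousM R R) => //; exact: (@continuousM R R).
Qed.

Definition jsin := jcomp (@sin R) (@cos R) (fun y : R => - sin y).
Definition jcos := jcomp (@cos R) (fun y : R => - sin y) (fun y : R => - cos y).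

Lemma jsin_ok J : jet_ok J -> jet_ok (jsin J).
Proof.
move=> okJ; apply: jcomp_ok => // x _; split.
- exact: is_derive_sin.
- exact: is_derive_cos.
- by apply: (@continuousN R R); exact: continuous_sin.
Qed.

Lemma jcos_ok J : jet_ok J -> jet_ok (jcos J).
Proof.
move=> okJ; apply: jcomp_ok => // x _; split.
- exact: is_derive_cos.
- by apply: (@is_deriveN R R R); exact: is_derive_sin.
- by apply: (@continuousN R R); exact: continuous_cos.
Qed.

Section CoordRules.
Variables gamma T1 T3 : R.
Notation L := (jgen gamma T1 T3).
Notation G := (jgam gamma T1 T3).

Lemma jgen_I1 x : L jI1 x = gamma * (T1 - x.1.1 ^+ 3).
Proof. by rewrite /jgen /= !(mulr0, mulr1, addr0, subr0). Qed.
Lemma jgen_I3 x : L jI3 x = gamma * (T3 - x.1.2 ^+ 3).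
Proof. by rewrite /jgen /= !(mulr0, mulr1, addr0, subr0, add0r). Qed.
Lemma jgen_t1 x : L jt1 x = - (x.1.1 * (1 + 2 * cos x.2.1) + 2 * x.1.2 * cos x.2.2).
Proof. by rewrite /jgen /=; ring. Qed.
Lemma jgen_t3 x : L jt3 x = - (x.1.2 * (1 + 2 * cos x.2.2) + 2 * x.1.1 * cos x.2.1).
Proof. by rewrite /jgen /=; ring. Qed.

Lemma jgam_I1 x : G jI1 jI1 x = gamma * T1 * x.1.1 / 2.
Proof. by rewrite /jgam /= !(mulr0, mulr1, addr0, add0r). Qed.
Lemma jgam_I3 x : G jI3 jI3 x = gamma * T3 * x.1.2 / 2.
Proof. by rewrite /jgam /= !(mulr0, mulr1, addr0, add0r). Qed.
Lemma jgam_t1 x : G jt1 jt1 x = gamma.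
Proof. by rewrite /jgam /= !(mulr0, mulr1, addr0, add0r). Qed.
Lemma jgam_t3 x : G jt3 jt3 x = gamma.
Proof. by rewrite /jgam /= !(mulr0, mulr1, addr0, add0r). Qed.
Lemma jgam_offdiag x :
  [/\ G jI1 jI3 x = 0, G jI3 jI1 x = 0, G jt1 jt3 x = 0 & G jt3 jt1 x = 0] /\
  [/\ G jI1 jt1 x = 0, G jI1 jt3 x = 0, G jI3 jt1 x = 0 & G jI3 jt3 x = 0].
Proof. by rewrite /jgam /= !(mulr0, mul0r, mulr1, addr0, add0r). Qed.

End CoordRules.

(** The repelling angle 2pi/3; this form gives its cosine and sine at once. *)
Definition phase : R := acos (- (1 / 2)).

Lemma cos_phase : cos phase = - (1 / 2).
Proof. by rewrite acosK // in_itv/=; apply/andP; split; lra. Qed.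

Lemma sin_phase : sin phase = Num.sqrt 3 / 2.
Proof.
rewrite sin_acos; last by apply/andP; split; lra.
rewrite (_ : 1 - _ = 3 / 2 ^+ 2); last by field.
by rewrite sqrtrM // sqrtrV ?exprn_ge0 // sqrtr_sqr ger0_norm.
Qed.

Definition jeps := jmul jI1 (jinv jI3).
Definition jang := jadd (jcst phase) (jadd jt1 (jmul (jcst (-1)) jt3)).
Definition ju := jadd (jcst (- phase)) jt3.
Definition jcurve l := jev l jeps jang.
Definition jdistance (X U : @jet R) := jadd (jadd (jcst 1) (jmul (jcst (-1)) (jcos U)))
  (jadd (jmul (jcst (-2)) (jmul X (jsin U)))
        (jmul (jmul X X) (jadd (jcst 1) (jcos U)))).
Definition jdist l := jdistance (jcurve l) ju.

Lemma jgam_distance gamma T1 T3 (X U M : @jet R) x :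
  let C := cos (jv U x) in let S := sin (jv U x) in
  jgam gamma T1 T3 (jdistance X U) M x =
  dist_u C S (jv X x) * jgam gamma T1 T3 U M x + dist_xi C S (jv X x) * jgam gamma T1 T3 X M x.
Proof.
move=> C S; rewrite /jdistance !(jgam_add, jgam_mul, jgam_cst) /jcos /jsin !jgam_comp /=.
by rewrite -/C -/S /dist_u /dist_xi; ring.
Qed.

Lemma jgen_distance gamma T1 T3 (X U : @jet R) x :
  let C := cos (jv U x) in let S := sin (jv U x) in let xi := jv X x in
  jgen gamma T1 T3 (jdistance X U) x =
  dist_u C S xi * jgen gamma T1 T3 U x + dist_xi C S xi * jgen gamma T1 T3 X x
  + (C + 2 * xi * S - xi ^+ 2 * C) / 2 * jgam gamma T1 T3 U U x
  - (2 * C + 2 * xi * S) * jgam gamma T1 T3 X U x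
  + (1 + C) * jgam gamma T1 T3 X X x.
Proof.
move=> C S xi.
rewrite /jdistance !(jgen_add, jgen_mul, jgen_cst, jgam_cst, jgam_add, jgam_mul) /jcos /jsin.
rewrite ![jgam _ _ _ X (jadd _ _) x]jgamC ![jgam _ _ _ X (jcomp _ _ _ _) x]jgamC.
rewrite !(jgam_add, jgam_cst, jgam_comp, jgen_comp) ![jgam _ _ _ U X x]jgamC /=.
by rewrite -/C -/S -/xi /dist_u /dist_xi; field.
Qed.

Lemma jI3_neq0 x : pquad x -> jv jI3 x != 0.
Proof. by move=> [_ h]; rewrite lt0r_neq0. Qed.

Lemma jI1_neq0 x : pquad x -> jv jI1 x != 0.
Proof. by move=> [h _]; rewrite lt0r_neq0. Qed.

Lemma jeps_ok : jet_ok jeps.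
Proof. by apply: jmul_ok; [exact: jI1_ok|apply: jinv_ok; [exact: jI3_ok|exact: jI3_neq0]]. Qed.

Lemma jang_ok : jet_ok jang.
Proof.
apply: jadd_ok; [exact: jcst_ok|apply: jadd_ok; [exact: jt1_ok|]].
by apply: jmul_ok; [exact: jcst_ok|exact: jt3_ok].
Qed.

Lemma ju_ok : jet_ok ju.
Proof. by apply: jadd_ok; [exact: jcst_ok|exact: jt3_ok]. Qed.

Lemma jcurve_ok l : jet_ok (jcurve l).
Proof. by apply: jev_ok; [exact: jeps_ok|exact: jang_ok]. Qed.

Lemma jdist_ok l : jet_ok (jdist l).
Proof.
have hC := jcos_ok ju_ok; have hS := jsin_ok ju_ok; have hX := jcurve_ok l.
apply: jadd_ok.
  by apply: jadd_ok; [exact: jcst_ok|apply: jmul_ok => //; exact: jcst_ok].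
apply: jadd_ok.
  by apply: jmul_ok; [exact: jcst_ok|exact: jmul_ok].
by apply: jmul_ok; [exact: jmul_ok|apply: jadd_ok => //; exact: jcst_ok].
Qed.

Section DistRules.
Variables gamma T1 T3 : R.
Notation L := (jgen gamma T1 T3).
Notation G := (jgam gamma T1 T3).
Variables (l : seq (@term R)) (x : st).
Hypothesis px : pquad x.

Let I1 := x.1.1.
Let I3 := x.1.2.
Let e := I1 / I3.
Let al := jv jang x.
Let C := cos (jv ju x).
Let S := sin (jv ju x).
Let xi := ev l e al.
Let xa := ev (map tang l) e al.
Let xe := ev (map tpar l) e al.

Lemma jdistE : jv (jdist l) x = dist C S xi.
Proof. by rewrite /dist /=; rewrite -/S -/C -/xi; ring. Qed.

Lemma jgam_uu : G ju ju x = gamma.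
Proof. by rewrite /ju jgam_add jgam_cst jgamC jgam_add jgam_cst !add0r jgam_t3. Qed.

Lemma jgam_ang_u : G jang ju x = - gamma.
Proof.
have [[_ _ h1 _] _] := jgam_offdiag gamma T1 T3 x.
rewrite /jang /ju !jgam_add jgam_mul !jgam_cst jgamC jgam_add jgam_cst.
rewrite [G jt3 (jadd _ _) x]jgamC jgam_add jgam_cst jgam_t3 [G jt3 jt1 x]jgamC h1 /=; ring.
Qed.

Lemma jgam_ang_ang : G jang jang x = 2 * gamma.
Proof.
have [[_ _ h1 h2] _] := jgam_offdiag gamma T1 T3 x.
have H M : G jang M x = G jt1 M x - G jt3 M x.
  by rewrite /jang !jgam_add jgam_mul !jgam_cst /=; ring.
by rewrite H ![G _ jang x]jgamC !H jgam_t1 jgam_t3 h1 h2; ring.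
Qed.

Lemma jgam_eps M : G jeps M x = I3^-1 * G jI1 M x - I1 * (I3^-1 * I3^-1) * G jI3 M x.
Proof. by rewrite /jeps jgam_mul /jinv jgam_comp /= -/I1 -/I3; ring. Qed.

Lemma jgam_eps_ang : G jeps jang x = 0.
Proof.
have [_ [h1 h2 h3 h4]] := jgam_offdiag gamma T1 T3 x.
have H M : G jang M x = G jt1 M x - G jt3 M x.
  by rewrite /jang !jgam_add jgam_mul !jgam_cst /=; ring.
rewrite jgam_eps ![G _ jang x]jgamC !H ![G jt1 _ x]jgamC ![G jt3 _ x]jgamC h1 h2 h3 h4; ring.
Qed.

Lemma jgam_eps_u : G jeps ju x = 0.
Proof.
have [_ [h1 h2 h3 h4]] := jgam_offdiag gamma T1 T3 x.
rewrite jgam_eps ![G _ ju x]jgamC !jgam_add !jgam_cst ![G jt3 _ x]jgamC h2 h4; ring.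
Qed.

Lemma jgam_eps_eps : G jeps jeps x =
  I3^-1 ^+ 2 * (gamma * T1 * I1 / 2) + (I1 * I3^-1 ^+ 2) ^+ 2 * (gamma * T3 * I3 / 2).
Proof.
have [[h1 h2 _ _] _] := jgam_offdiag gamma T1 T3 x.
rewrite jgam_eps ![G _ jeps x]jgamC !jgam_eps h1 h2 jgam_I1 jgam_I3 -/I1 -/I3; ring.
Qed.

Lemma jgen_eps : L jeps x = gamma * (I3^-1 * (T1 - I1 ^+ 3)
  - I1 * I3^-1 ^+ 2 * (T3 - I3 ^+ 3) + I1 * I3^-1 ^+ 3 * (T3 * I3 / 2)).
Proof.
have [[h1 _ _ _] _] := jgam_offdiag gamma T1 T3 x.
rewrite /jeps jgen_mul /jinv jgen_comp jgamC jgam_comp jgamC h1 jgen_I1 jgen_I3 jgam_I3 /= -/I1 -/I3.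
by move: (I3^-1) => i; field.
Qed.

(** The coupling terms of the two angles cancel in theta1 - theta3, which is why this difference
    parametrises the curve. In units of I3 it moves at speed 1 - e, whence the term e u' in
    [curve_rhs]. *)
Lemma jgen_ang : L jang x = I3 - I1.
Proof.
rewrite /jang !jgen_add jgen_mul !jgen_cst jgam_cst jgen_t1 jgen_t3 /= -/I1 -/I3; ring.
Qed.

Lemma jgam_curve M : G (jcurve l) M x = xe * G jeps M x + xa * G jang M x.
Proof. by rewrite /jcurve jgam_ev. Qed.

Lemma jgam_curve_u : G (jcurve l) ju x = - gamma * xa.
Proof. by rewrite jgam_curve jgam_eps_u jgam_ang_u; ring. Qed.

Lemma jgam_curve_curve : G (jcurve l) (jcurve l) x =
  2 * gamma * xa ^+ 2 + xe ^+ 2 * G jeps jeps x.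
Proof.
rewrite jgam_curve ![G _ (jcurve l) x]jgamC !jgam_curve jgam_ang_ang.
by rewrite [G jang jeps x]jgamC jgam_eps_ang; ring.
Qed.

(** What remains of the drift of the curve after transport along the angle variable: the slow motion
    of e = I1 / I3 and the Ito corrections, all proportional to [gamma]. *)
Definition noise_drift : R := xe * L jeps x
  + ev (map tpar (map tpar l)) e al / 2 * G jeps jeps x
  + gamma * ev (map tang (map tang l)) e al.

Lemma jgen_curve : L (jcurve l) x = (I3 - I1) * xa + noise_drift.
Proof.
rewrite /jcurve (jgen_ev _ jgam_eps_ang) jgen_ang jgam_ang_ang /noise_drift.
by rewrite -/al -/e -/xa -/xe; field.
Qed.

Lemma jgam_dist M : G (jdist l) M x =
  dist_u C S xi * G ju M x + dist_xi C S xi * G (jcurve l) M x.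
Proof. exact: jgam_distance. Qed.

Lemma jgam_dist_dist : G (jdist l) (jdist l) x = dist_u C S xi ^+ 2 * gamma
  - 2 * dist_u C S xi * dist_xi C S xi * (gamma * xa)
  + dist_xi C S xi ^+ 2 * G (jcurve l) (jcurve l) x.
Proof.
rewrite jgam_dist ![G _ (jdist l) x]jgamC !jgam_dist jgam_uu.
by rewrite [G ju (jcurve l) x]jgamC jgam_curve_u; ring.
Qed.

Lemma jgen_dist : L (jdist l) x =
  dist_u C S xi * L ju x + dist_xi C S xi * L (jcurve l) x
  + gamma * ((C + 2 * xi * S - xi ^+ 2 * C) / 2 + (2 * C + 2 * xi * S) * xa)
  + (1 + C) * G (jcurve l) (jcurve l) x.
Proof.
rewrite /jdist jgen_distance jgam_uu jgam_curve_u -/C -/S (_ : jv (jcurve l) x = xi) //; ring.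
Qed.

Lemma jgen_u : L ju x = I3 * th3_drift C S e (cos al) (sin al) (Num.sqrt 3).
Proof.
have -> : L ju x = L jt3 x by rewrite /ju jgen_add jgen_cst add0r.
rewrite jgen_t3 -/I1 -/I3.
have h3 : x.2.2 = jv ju x + phase by rewrite /=; ring.
have h1 : x.2.1 = al + jv ju x by rewrite /al /=; ring.
have c3 : cos x.2.2 = C * - (1 / 2) - S * (Num.sqrt 3 / 2).
  by rewrite h3 /C /S; move: (jv ju x) => u; rewrite cosD cos_phase sin_phase.
have c1 : cos x.2.1 = cos al * C - sin al * S.
  by rewrite h1 /C /S; move: (al) (jv ju x) => b u; rewrite cosD.
rewrite c3 c1 /th3_drift.
have I30 : I3 != 0 by have := px.2; exact: lt0r_neq0.
by rewrite /e; field.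
Qed.

End DistRules.
End Coordinates.
(** * The barrier *)

Section Barrier.
Context {R : realType}.
Notation st := (bstate R).
Implicit Types (x : st).
Variables (gamma T1 T3 : R) (l : seq (@term R)) (a eta : R).
Notation L := (jgen gamma T1 T3).
Notation G := (jgam gamma T1 T3).

Definition jbump := jpos3 (jadd (jcst (1/10)) (jmul (jcst (-1)) (jdist l))).
(** Where both cut-offs are positive, I1 <= [eta] and I3 >= [a], so e <= [sigma] / 4 once [eta] <=
    [a] [sigma] / 4, the range where the curve is controlled. The cut-off in I3 uses I3^-2: it acts
    only from below, and its cost is a multiple of I3^-2, which the confining function
    dissipates. *)
Definition jcut1 := jpos3 (jadd (jcst 1) (jmul (jcst (- eta^-1)) jI1)).
Definition jcut3 :=
  jpos3 (jadd (jcst 1) (jmul (jcst (- a ^+ 2)) (jmul (jinv jI3) (jinv jI3)))).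
Definition jbarrier := jmul (jmul jcut1 jcut3) jbump.

Lemma jbarrier_ok : jet_ok jbarrier.
Proof.
have h1 : jet_ok jcut1.
  apply: jpos3_ok; apply: jadd_ok; first exact: jcst_ok.
  by apply: jmul_ok; [exact: jcst_ok|exact: jI1_ok].
have h3 : jet_ok (jinv (@jI3 R)) by apply: jinv_ok; [exact: jI3_ok|exact: jI3_neq0].
have h3' : jet_ok jcut3.
  apply: jpos3_ok; apply: jadd_ok; first exact: jcst_ok.
  by apply: jmul_ok; [exact: jcst_ok|exact: jmul_ok].
have hb : jet_ok jbump.
  apply: jpos3_ok; apply: jadd_ok; first exact: jcst_ok.
  by apply: jmul_ok; [exact: jcst_ok|exact: jdist_ok].
by apply: jmul_ok => //; exact: jmul_ok.
Qed.

Lemma trig_periodic (n : nat) (t : R) :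
  cos (t + n%:R * (2 * pi)) = cos t /\ sin (t + n%:R * (2 * pi)) = sin t.
Proof.
elim: n => [|n [c s]]; first by rewrite mul0r addr0.
rewrite -natr1 mulrDl mul1r addrA.
move: (t + n%:R * (2 * pi)) c s => u c s.
have -> : 2 * pi = pi + pi :> R by ring.
by rewrite addrA !cosDpi !sinDpi c s !opprK.
Qed.

Lemma tev_periodic (t : @term R) e y : tev t e (y + 2 * pi) = tev t e y.
Proof.
rewrite /tev [t.1.2%:R * (y + _)]mulrDr; have [-> ->] // := trig_periodic t.1.2 (t.1.2%:R * y).
Qed.

Lemma ev_periodic (k : seq (@term R)) e y : ev k e (y + 2 * pi) = ev k e y.
Proof. by rewrite /ev; apply: eq_bigr => t _; exact: tev_periodic. Qed.

Lemma jbarrier_periodic : torus_periodic (jv jbarrier).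
Proof.
have c2 (t : R) : cos (t + 2 * pi) = cos t by have [] := trig_periodic 1 t; rewrite mul1r.
have s2 (t : R) : sin (t + 2 * pi) = sin t by have [] := trig_periodic 1 t; rewrite mul1r.
split=> i1 i3 t1 t3; rewrite /=.
  rewrite (_ : phase + (t1 + 2 * pi + -1 * t3) = phase + (t1 + -1 * t3) + 2 * pi); last by ring.
  by rewrite ev_periodic.
have evB (k : seq (@term R)) (e z : R) : ev k e (z - 2 * pi) = ev k e z.
  by rewrite -[in RHS](subrK (2 * pi) z) ev_periodic.
rewrite (_ : phase + (t1 + -1 * (t3 + 2 * pi)) = phase + (t1 + -1 * t3) - 2 * pi); last by ring.
by rewrite evB (addrA (- phase) t3) c2 s2.
Qed.

Lemma jbarrier_ge0 x : 0 <= jv jbarrier x.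
Proof.
have H v : 0 <= pos v ^+ 3 :> R by rewrite exprn_ge0 // pos_ge0.
exact: mulr_ge0 (mulr_ge0 (H _) (H _)) (H _).
Qed.

Section Point.
Variable x : st.
Hypothesis px : pquad x.
Let I1 := x.1.1.
Let I3 := x.1.2.
Let i := I3^-1.
Let c1 := pos (1 - I1 / eta).
Let c3 := pos (1 - a ^+ 2 * i ^+ 2).
Let y := pos (1/10 - jv (jdist l) x).
Let al := jv jang x.
Let X := dist_xi (cos (jv ju x)) (sin (jv ju x)) (ev l (I1 / I3) al)
         * ev (map tpar l) (I1 / I3) al.

Let jv1 : jv (jadd (jcst 1) (jmul (jcst (- eta^-1)) jI1)) x = 1 - I1 / eta.
Proof. by rewrite /= -/I1; ring. Qed.
Let jv3 : jv (jadd (jcst 1) (jmul (jcst (- a ^+ 2)) (jmul (jinv jI3) (jinv jI3)))) x = 1 - a ^+ 2 * i ^+ 2.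
Proof. by rewrite /= -/I3 -/i; ring. Qed.
Let jvb : jv (jadd (jcst (1/10)) (jmul (jcst (-1)) (jdist l))) x = 1/10 - jv (jdist l) x.
Proof. by rewrite -[LHS]/(1/10 + -1 * jv (jdist l) x) mulN1r. Qed.

Lemma jgen_bump : L jbump x = - (3 * y ^+ 2 * L (jdist l) x - 3 * y * G (jdist l) (jdist l) x).
Proof.
rewrite /jbump /jpos3 jgen_comp jvb -/y.
rewrite jgen_add jgen_mul !jgen_cst !jgam_cst jgam_add jgam_mul !jgam_cst.
rewrite ![G (jdist l) (jadd _ _) x]jgamC jgam_add jgam_mul !jgam_cst [jv (jcst _) x]/=.
by field.
Qed.

Lemma jgen_cut1 : L jcut1 x = gamma * (- (3 * c1 ^+ 2) / eta * (T1 - I1 ^+ 3)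
  + 3 * c1 / eta ^+ 2 * (T1 * I1 / 2)).
Proof.
rewrite /jcut1 /jpos3 jgen_comp jv1 -/c1.
rewrite jgen_add jgen_mul !jgen_cst !jgam_cst jgam_add jgam_mul !jgam_cst.
rewrite ![G jI1 (jadd _ _) x]jgamC jgam_add jgam_mul !jgam_cst [jv (jcst _) x]/=.
by rewrite jgen_I1 jgam_I1 -/I1 -exprVn; move: (eta^-1) => e; field.
Qed.

Lemma jgen_cut3 : L jcut3 x = gamma * (- (3 * c3 ^+ 2) * a ^+ 2 * (2 - T3 / 2 * i ^+ 3)
  + 6 * c3 * a ^+ 4 * T3 * i ^+ 5).
Proof.
have I30 : I3 != 0 by exact: jI3_neq0.
have GE M : G (jadd (jcst 1) (jmul (jcst (- a ^+ 2)) (jmul (jinv jI3) (jinv jI3)))) M x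
    = 2 * a ^+ 2 * i ^+ 3 * G jI3 M x.
  rewrite jgam_add jgam_mul !jgam_cst jgam_mul /jinv jgam_comp /= -/I3 -/i; ring.
rewrite /jcut3 /jpos3 jgen_comp jv3 -/c3 GE [G jI3 _ x]jgamC GE.
rewrite jgen_add jgen_mul !jgen_cst !jgam_cst jgen_mul /jinv jgen_comp jgam_comp.
rewrite [G jI3 (jcomp _ _ _ _) x]jgamC jgam_comp jgen_I3 jgam_I3 /= -/I3 -/i.
by rewrite /i; field.
Qed.

Lemma jgam_dist_I1 : G jI1 (jdist l) x = X * i * (gamma * T1 * I1 / 2).
Proof.
have [[h1 h2 _ _] [h3 h4 _ _]] := jgam_offdiag gamma T1 T3 x.
rewrite jgamC jgam_dist jgam_curve jgam_eps jgam_I1 ![G jI3 jI1 x]jgamC h1.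
have -> : G jang jI1 x = 0.
  by rewrite /jang !jgam_add jgam_mul !jgam_cst ![G _ jI1 x]jgamC h3 h4 /=; ring.
have -> : G ju jI1 x = 0 by rewrite /ju jgam_add jgam_cst jgamC h4 addr0.
by rewrite -/I1 -/I3 -/i -/al /X; ring.
Qed.

Lemma jgam_dist_I3 : G jI3 (jdist l) x = - X * I1 * i ^+ 2 * (gamma * T3 * I3 / 2).
Proof.
have [[h1 h2 _ _] [_ _ h3 h4]] := jgam_offdiag gamma T1 T3 x.
rewrite jgamC jgam_dist jgam_curve jgam_eps jgam_I3 h1.
have -> : G jang jI3 x = 0.
  by rewrite /jang !jgam_add jgam_mul !jgam_cst ![G _ jI3 x]jgamC h3 h4 /=; ring.
have -> : G ju jI3 x = 0 by rewrite /ju jgam_add jgam_cst jgamC h4 addr0.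
by rewrite -/I1 -/I3 -/i -/al /X; ring.
Qed.

(** The two cut-offs depend on actions with independent noises, so they have no mutual second-order
    term. They interact with the bump only through the dependence of the distance on e, whose
    derivative is [X]. *)
Lemma jgen_barrier : L jbarrier x =
  c1 ^+ 3 * c3 ^+ 3 * L jbump x + y ^+ 3 * (c1 ^+ 3 * L jcut3 x + c3 ^+ 3 * L jcut1 x)
  + gamma * X * (9 / 2 * c1 ^+ 3 * c3 ^+ 2 * y ^+ 2 * 2 * a ^+ 2 * I1 * i ^+ 5 * T3 * I3
    + 9 / 2 * c3 ^+ 3 * c1 ^+ 2 * y ^+ 2 / eta * i * T1 * I1).
Proof.
have [[h1 h2 _ _] _] := jgam_offdiag gamma T1 T3 x.
have G1 M : G jcut1 M x = - (3 * c1 ^+ 2 / eta) * G jI1 M x.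
  rewrite /jcut1 /jpos3 jgam_comp jv1 -/c1 jgam_add jgam_mul !jgam_cst /=; ring.
have G3 M : G jcut3 M x = 6 * c3 ^+ 2 * a ^+ 2 * i ^+ 3 * G jI3 M x.
  rewrite /jcut3 /jpos3 jgam_comp jv3 -/c3 jgam_add jgam_mul !jgam_cst jgam_mul /jinv jgam_comp /=.
  by rewrite -/I3 -/i; ring.
have Gb M : G jbump M x = - (3 * y ^+ 2) * G (jdist l) M x.
  rewrite /jbump /jpos3 jgam_comp jvb -/y jgam_add jgam_mul !jgam_cst [jv (jcst _) x]/=; ring.
rewrite /jbarrier jgen_mul jgam_mul [G jcut1 jbump x]G1 [G jcut3 jbump x]G3.
rewrite ![G _ jbump x]jgamC !Gb ![G (jdist l) _ x]jgamC jgam_dist_I1 jgam_dist_I3.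
rewrite jgen_mul G1 [G jI1 jcut3 x]jgamC G3 h2.
have -> : jv jcut1 x = c1 ^+ 3 by rewrite /= -/I1 /c1; congr (pos _ ^+ 3); ring.
have -> : jv jcut3 x = c3 ^+ 3 by rewrite /= -/I3 -/i /c3; congr (pos _ ^+ 3); ring.
have -> : jv jbump x = y ^+ 3 by rewrite -[LHS]/(pos (1/10 + -1 * jv (jdist l) x) ^+ 3) mulN1r.
have -> : jv (jmul jcut1 jcut3) x = c1 ^+ 3 * c3 ^+ 3.
  by rewrite /= -/I3 -/i -/I1 /c1 /c3; congr (pos _ ^+ 3 * pos _ ^+ 3); ring.
by move: (eta^-1) => q; field.
Qed.

End Point.
End Barrier.

(** * Size of the noise contributions *)

Section BarrierEstimate.
Context {R : realType}.
Notation st := (bstate R).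

(** Per unit of [gamma], [eps_noise] bounds the quadratic variation of I1 / I3, and [drift_noise]
    plus 32 I3 bounds [noise_drift]. Here 32 = (4 / [sigma]) (8 [sigma]) bounds the first derivative
    of the curve in e, and [k] its second one. None of these depends on [gamma]. *)
Definition eps_noise (a T3 : R) := 1 / (2 * a ^+ 2) + T3 / (2 * a ^+ 3).
Definition drift_noise (a T3 k : R) :=
  32 * (2 / a + 3 / 2 * (T3 / a ^+ 2)) + k / 2 * eps_noise a T3 + 1.
Definition barrier_err (a T3 k : R) := 2 * drift_noise a T3 k ^+ 2 / a + 2 * 32 ^+ 2 + 1
  + (3 + 8 * (1 + 32 ^+ 2 * eps_noise a T3)) ^+ 2 / a.

Lemma barrier_err_ge0 (a T3 k : R) : 0 < a -> 0 <= barrier_err a T3 k.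
Proof.
move=> a0; rewrite /barrier_err !addr_ge0 //.
  by rewrite divr_ge0 //; [rewrite mulr_ge0 // sqr_ge0|exact: ltW].
by rewrite divr_ge0 //; [exact: sqr_ge0|exact: ltW].
Qed.

Section Reals.
Variables (a T1 T3 I1 I3 i : R).
Hypotheses (a0 : 0 < a) (T10 : 0 < T1) (T11 : T1 <= 1) (T30 : 0 < T3).
Hypotheses (I10 : 0 < I1) (I11 : I1 <= 1) (i0 : 0 < i) (Ii : I3 * i = 1) (ia : i <= 1 / a).

Lemma eps_noise_bound :
  let g := i ^+ 2 * (T1 * I1 / 2) + (I1 * i ^+ 2) ^+ 2 * (T3 * I3 / 2) in
  0 <= g /\ g <= eps_noise a T3.
Proof.
move=> g; have -> : g = T1 * I1 / 2 * i ^+ 2 + T3 * I1 ^+ 2 / 2 * i ^+ 3.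
  rewrite /g; transitivity (T1 * I1 / 2 * i ^+ 2 + T3 * I1 ^+ 2 / 2 * i ^+ 3 * (I3 * i)).
    by ring.
  by rewrite Ii mulr1.
have p2 : i ^+ 2 <= (1 / a) ^+ 2 by rewrite lerXn2r // nnegrE ?ltW // divr_gt0.
have p3 : i ^+ 3 <= (1 / a) ^+ 3 by rewrite lerXn2r // nnegrE ?ltW // divr_gt0.
have q1 : T1 * I1 <= 1 by rewrite -[leRHS]mulr1 ler_pM // ltW.
have q2 : I1 ^+ 2 <= 1 by rewrite expr_le1 // ltW.
have i2 : 0 <= i ^+ 2 by rewrite sqr_ge0.
have i3 : 0 <= i ^+ 3 by rewrite exprn_ge0 // ltW.
split.
  by rewrite addr_ge0 // !mulr_ge0 ?sqr_ge0 // ltW.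
rewrite /eps_noise (_ : 1 / (2 * a ^+ 2) = 1 / 2 * (1 / a) ^+ 2); last first.
  by field; exact: lt0r_neq0.
rewrite (_ : T3 / (2 * a ^+ 3) = T3 / 2 * (1 / a) ^+ 3); last first.
  by field; exact: lt0r_neq0.
apply: lerD; apply: ler_pM => //.
- by rewrite divr_ge0 // mulr_ge0 // ltW.
- by rewrite ler_pM2r.
- by rewrite divr_ge0 // mulr_ge0 ?sqr_ge0 // ltW.
- by rewrite ler_pM2r // ler_piMr // ltW.
Qed.

Lemma drift_noise_bound (xe xee xaa k : R) : `|xe| <= 32 -> `|xee| <= k -> `|xaa| <= 1 ->
  forall g, g = i ^+ 2 * (T1 * I1 / 2) + (I1 * i ^+ 2) ^+ 2 * (T3 * I3 / 2) ->
  `|xe * (i * (T1 - I1 ^+ 3) - I1 * i ^+ 2 * (T3 - I3 ^+ 3) + I1 * i ^+ 3 * (T3 * I3 / 2))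
     + xee / 2 * g + xaa| <= drift_noise a T3 k + 32 * I3.
Proof.
move=> h1 h2 h3 g gE; have [] := eps_noise_bound; rewrite -gE => g0 g1 {gE}.
have I30 : 0 < I3 by rewrite -(pmulr_lgt0 _ i0) Ii.
set d := _ - _ + _.
have dE : d = i * T1 - i * I1 ^+ 3 - 1 / 2 * (T3 * I1 * i ^+ 2) + I1 * I3.
  transitivity (i * T1 - i * I1 ^+ 3 - T3 * I1 * i ^+ 2 + 1 / 2 * T3 * I1 * i ^+ 2 * (I3 * i)
     + I1 * I3 * (I3 * i) ^+ 2); first by rewrite /d; field.
  by rewrite Ii; field.
have p1 : i * T1 <= 1 / a by rewrite -[leRHS]mulr1 ler_pM // ltW.
have p1' : i * I1 ^+ 3 <= 1 / a.
  by rewrite -[leRHS]mulr1 ler_pM ?exprn_ge0 ?(ltW I10) ?(ltW i0) // exprn_ile1 // ltW.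
have p2 : T3 * I1 * i ^+ 2 <= T3 / a ^+ 2.
  rewrite ler_pM ?sqr_ge0 ?mulr_ge0 ?(ltW T30) ?(ltW I10) //.
    by rewrite ler_piMr // ltW.
  rewrite (_ : a ^- 2 = (1 / a) ^+ 2); last by rewrite div1r exprVn.
  by rewrite lerXn2r ?nnegrE ?(ltW i0) // ltW // divr_gt0.
have p3 : I1 * I3 <= I3 by rewrite ler_piMl // ltW.
have q1 : 0 <= i * T1 by rewrite mulr_ge0 // ltW.
have q2 : 0 <= i * I1 ^+ 3 by rewrite mulr_ge0 ?exprn_ge0 // ltW.
have q3 : 0 <= T3 * I1 * i ^+ 2 by rewrite !mulr_ge0 ?sqr_ge0 // ltW.
have q4 : 0 <= I1 * I3 by rewrite mulr_ge0 // ltW.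
have hd : `|d| <= 2 / a + 3 / 2 * (T3 / a ^+ 2) + I3.
  rewrite (_ : 2 / a = 2 * (1 / a)); last by rewrite mul1r.
  rewrite dE; move: p1 p1' p2 p3 q1 q2 q3 q4 (ltW I30).
  move: (i * T1) (i * I1 ^+ 3) (T3 * I1 * i ^+ 2) (I1 * I3) (T3 / _) (1 / a).
  by clear => *; rewrite ler_norml; apply/andP; split; lra.
have k0 : 0 <= k by apply: le_trans h2.
have hx : `|xe * d| <= 32 * (2 / a + 3 / 2 * (T3 / a ^+ 2) + I3).
  by rewrite normrM ler_pM.
have hg : `|xee / 2 * g| <= k / 2 * eps_noise a T3.
  rewrite !normrM (ger0_norm g0) normfV (ger0_norm (ler0n R 2)).
  by rewrite ler_pM ?divr_ge0 // ler_pM2r.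
rewrite /drift_noise; apply: le_trans (ler_normD _ _) _.
have := ler_normD (xe * d) (xee / 2 * g).
have aux (u1 u2 u3 u4 u5 p q : R) : u1 <= 32 * (p + q) -> u2 <= u5 -> u4 <= 1 ->
    u3 <= u1 + u2 -> u3 + u4 <= 32 * p + u5 + 1 + 32 * q by move=> *; lra.
exact: aux hx hg h3.
Qed.

End Reals.
End BarrierEstimate.

Section BumpArithmetic.
Context {R : realType}.

Lemma sqr_le_norm (u v : R) : `|u| <= v -> u ^+ 2 <= v ^+ 2.
Proof.
move=> uv; rewrite -real_normK ?num_real // lerXn2r // nnegrE //.
exact: le_trans uv.
Qed.

Lemma sqrt3_ge : 173/100 <= Num.sqrt 3 :> R.
Proof.
have := @sqrt3E R; have : 0 <= Num.sqrt 3 :> R by exact: sqrtr_ge0.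
move: (Num.sqrt 3) => s s0 s3; rewrite leNgt; apply/negP => h.
have h2 : s * s <= 173/100 * s by rewrite ler_wpM2r // ltW.
by move: s3; rewrite expr2 => s3; lra.
Qed.

Lemma sqrD_le (u v w : R) : (u + w * v) ^+ 2 <= 2 * u ^+ 2 + 2 * w ^+ 2 * v ^+ 2.
Proof.
rewrite -mulrA -exprMn; move: (w * v) => t.
by have := sqr_ge0 (u - t); rewrite sqrrB sqrrD; lra.
Qed.

Lemma sqr_small (u : R) : `|u| <= 1/100 -> 2 * u ^+ 2 <= 1.
Proof. by move/sqr_le_norm; lra. Qed.

Lemma err_collect (g I3 A B Q b1 b2 b3 : R) : 0 <= I3 -> 0 <= A -> 0 <= B -> 0 <= Q ->
  b1 <= g ^+ 2 * I3 -> b2 <= g ^+ 2 * (A + B * I3) -> b3 <= g ^+ 2 * Q ->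
  b1 + b2 + b3 <= g ^+ 2 * ((A + B + 1 + Q) * (1 + I3)).
Proof.
move=> h1 h2 h3 h4 h5 h6 h7.
have -> : (A + B + 1 + Q) * (1 + I3) = I3 + (A + B * I3) + Q + (A * I3 + B + 1 + Q * I3) by ring.
have h : 0 <= g ^+ 2 * (A * I3 + B + 1 + Q * I3).
  by rewrite mulr_ge0 ?sqr_ge0 // !addr_ge0 // mulr_ge0.
by rewrite !mulrDr -!addrA; move: h h6; rewrite !mulrDr; lra.
Qed.

End BumpArithmetic.

(** * Drift of the bump around the curve *)

Section BumpDrift.
Context {R : realType}.
Notation st := (bstate R).
Variables (gamma T1 T3 sigma a : R) (l : seq (@term R)) (x : st).
Hypotheses (g0 : 0 < gamma) (T10 : 0 < T1) (T11 : T1 <= 1) (T30 : 0 < T3).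
Hypotheses (sigma0 : 0 < sigma) (sigma1 : sigma <= 1 / 1000) (a0 : 0 < a).
Let s8 : 8 * sigma <= 1/100. Proof. by move: sigma1 => h; lra. Qed.
Let s4 : sigma / 4 <= 1/100. Proof. by move: sigma1 => h; lra. Qed.
Hypothesis (nl : nrm sigma l <= 8 * sigma).
Hypothesis px : pquad x.
Let I1 := x.1.1.
Let I3 := x.1.2.
Let e := I1 / I3.
Hypothesis (I11 : I1 <= 1) (aI3 : a <= I3) (es : e <= sigma / 4).
Let al := jv jang x.
Let C := cos (jv ju x).
Let S := sin (jv ju x).
Let xi := ev l e al.
Let xa := ev (map tang l) e al.
Let xe := ev (map tpar l) e al.
Let k2 := (4 / sigma) ^+ 2 * (8 * sigma).
Hypothesis res : `|xa - Num.sqrt 3 * xi - curve_rhs e al xi xa| <= gamma.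
Let y := pos (1/10 - jv (jdist l) x).
Let D := drift_noise a T3 k2.

Let I10 : 0 < I1. Proof. by case: px. Qed.
Let I30 : 0 < I3. Proof. by case: px. Qed.
Let e0 : 0 <= e. Proof. by rewrite divr_ge0 // ltW. Qed.
Let i0 : 0 < I3^-1. Proof. by rewrite invr_gt0. Qed.
Let Ii : I3 * I3^-1 = 1. Proof. by rewrite mulfV // lt0r_neq0. Qed.
Let ia : I3^-1 <= 1 / a. Proof. by rewrite div1r lef_pV2 ?posrE. Qed.

Lemma curve_small : [/\ `|xi| <= 1/100, `|xa| <= 1/100, `|xe| <= 32,
  `|ev (map tpar (map tpar l)) e al| <= k2 & `|ev (map tang (map tang l)) e al| <= 1].
Proof.
have h (u : R) : u <= nrm sigma l -> u <= 8 * sigma by move=> h; exact: le_trans h nl.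
have h100 (u : R) : u <= nrm sigma l -> u <= 1/100 by move=> /h hu; exact: le_trans hu s8.
split.
- by apply: h100; exact: ev_bound.
- by apply: h100; exact: ev_ang_bound.
- apply: le_trans (ev_par_bound sigma0 _ e0 es l) _.
  have -> : 32 = 4 / sigma * (8 * sigma) by field; exact: lt0r_neq0.
  by rewrite ler_wpM2l // divr_ge0 // ltW.
- apply: le_trans (ev_par2_bound sigma0 _ e0 es l) _.
  by rewrite ler_wpM2l // sqr_ge0.
- apply: (@le_trans _ _ (1/100)); last by lra.
  by apply: h100; exact: ev_ang2_bound.
Qed.

Lemma noise_drift_bound : `|noise_drift gamma T1 T3 l x| <= gamma * (D + 32 * I3).
Proof.
have [h1 h2 h3 h4 h5] := curve_small.
have := drift_noise_bound a0 T10 T11 T30 I10 I11 i0 Ii ia h3 h4 h5 erefl.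
rewrite -(ler_pM2l g0) -{1}(gtr0_norm g0) -normrM; apply: le_trans.
rewrite le_eqVlt; apply/orP; left; apply/eqP; congr (`| _ |).
rewrite /noise_drift jgen_eps // jgam_eps_eps -/I1 -/I3 -/e -/al -/xe.
by move: (ev _ e al) (ev (map tang _) e al) (I3^-1) => u v i; field.
Qed.

Lemma bump_drift : 3/4 * gamma * y ^+ 2
  <= - jgen gamma T1 T3 (jbump l) x + gamma * (gamma * (barrier_err a T3 k2 * (1 + I3))).
Proof.
have [h1 h2 h3 h4 h5] := curve_small.
have Er : 0 <= gamma * (gamma * (barrier_err a T3 k2 * (1 + I3))).
  rewrite !mulr_ge0 ?(ltW g0) ?barrier_err_ge0 // addr_ge0 // ltW //.
rewrite jgen_bump // -/y opprK.
have [w1|w1] := lerP (jv (jdist l) x) (1/10); last first.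
  by rewrite /y pos_0 ?subr_le0 ?(ltW w1) // expr0n /= !mulr0 !mul0r subr0 add0r.
have yE : y = 1/10 - jv (jdist l) x by rewrite /y pos_id // subr_ge0.
have y0 : 0 <= y by exact: pos_ge0.
have CS : C ^+ 2 + S ^+ 2 = 1 by exact: cos2Dsin2.
have cs : cos al ^+ 2 + sin al ^+ 2 = 1 by exact: cos2Dsin2.
have [g1 g2] := eps_noise_bound a0 T10 T11 T30 I10 I11 i0 Ii ia.
set gn := (X in 0 <= X) in g1; rewrite -/gn in g2.
pose k := 2 * xa ^+ 2 + xe ^+ 2 * gn.
have k0 : 0 <= k by rewrite addr_ge0 // mulr_ge0 // sqr_ge0.
have kE : jgam gamma T1 T3 (jcurve l) (jcurve l) x = gamma * k.
  rewrite jgam_curve_curve jgam_eps_eps -/I1 -/I3 -/e -/al -/xe -/xa /k /gn.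
  by move: (I3^-1) => i; field.
have k1 : k <= 1 + 32 ^+ 2 * eps_noise a T3.
  apply: lerD.
    exact: sqr_small.
  apply: ler_pM => //; first exact: sqr_ge0.
  by rewrite -real_normK ?num_real // lerXn2r // ?nnegrE.
(* The transport term of the curve, in units of I3, minus its exact drift: this is the defect of the
   curve equation, bounded by the tolerance [gamma]. *)
pose r0 := (1 - e) * xa - curve_drift xi e (cos al) (sin al) (Num.sqrt 3).
have hr : `|r0| <= gamma.
  apply: le_trans res; rewrite le_eqVlt; apply/orP; left; apply/eqP; congr (`| _ |).
  rewrite /r0 /curve_drift /curve_rhs; ring.
have s3 := @sqrt3_ge R.
have hM := noise_drift_bound.
set M := noise_drift _ _ _ _ _ in hM.
have e1 : e <= 1/100 by exact: le_trans es s4.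
have wE := jdistE l x; rewrite -/I1 -/I3 -/al -/C -/S -/e -/xi in wE.
have low := @dist_gen_lower R C S xi e (cos al) (sin al) (Num.sqrt 3) I3 gamma xa r0 M
  (gamma * k) CS cs h1 h2 e0 e1 s3.
have upp := @dist_gam_upper R C S xi gamma xa k CS h1 h2.
rewrite -wE in low upp.
have w0 : 0 <= jv (jdist l) x by rewrite wE dist_ge0.
have := @bump_gen_lower R I3 gamma (jv (jdist l) x) y
  (jgen gamma T1 T3 (jdist l) x) (jgam gamma T1 T3 (jdist l) (jdist l) x) r0 M k
  I30 g0 w0 y0 yE k0.
have -> : jgen gamma T1 T3 (jdist l) x = dist_u C S xi * (I3 * th3_drift C S e (cos al) (sin al) (Num.sqrt 3))
  + dist_xi C S xi * (I3 * (curve_drift xi e (cos al) (sin al) (Num.sqrt 3) + r0) + M)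
  + gamma * ((C + 2 * xi * S - xi ^+ 2 * C) / 2 + (2 * C + 2 * xi * S) * xa) + (1 + C) * (gamma * k).
  rewrite jgen_dist jgen_u // kE jgen_curve -/I1 -/I3 -/e -/al -/C -/S -/xi -/xa -/M.
  congr (_ + _ * _ + _ + _).
  rewrite (_ : curve_drift _ _ _ _ _ + r0 = (1 - e) * xa); last by rewrite /r0 addrC subrK.
  by rewrite /e; move: xa => t; field; exact: lt0r_neq0.
have -> : jgam gamma T1 T3 (jdist l) (jdist l) x = dist_u C S xi ^+ 2 * gamma
   - 2 * dist_u C S xi * dist_xi C S xi * (gamma * xa) + dist_xi C S xi ^+ 2 * (gamma * k).
  by rewrite jgam_dist_dist kE.
move=> /(_ (low w1 I30 g0 (mulr_ge0 (ltW g0) k0)) (upp w1 g0 k0)) B.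
apply: le_trans (_ : _ <= _ + (I3 * r0 ^+ 2 + M ^+ 2 / I3 + (gamma * (3 + 8 * k)) ^+ 2 / I3)) _.
  by rewrite -lerBlDr !opprD !addrA; exact: B.
apply: lerD => //.
rewrite [leRHS]mulrA -[gamma * gamma]expr2.
have a10 : 0 <= a^-1 by rewrite invr_ge0 ltW.
have i1 : I3^-1 <= a^-1 by rewrite -[leRHS]div1r.
have A0 : 0 <= 2 * drift_noise a T3 k2 ^+ 2 / a.
  by apply: mulr_ge0 => //; apply: mulr_ge0 => //; exact: sqr_ge0.
have Q0 : 0 <= (3 + 8 * (1 + 32 ^+ 2 * eps_noise a T3)) ^+ 2 / a.
  by apply: mulr_ge0 => //; exact: sqr_ge0.
have B0 : 0 <= 2 * 32 ^+ 2 :> R by apply: mulr_ge0 => //; exact: sqr_ge0.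
apply: err_collect (ltW I30) A0 B0 Q0 _ _ _.
- by rewrite mulrC ler_wpM2r ?(ltW I30) // sqr_le_norm.
- have h : M ^+ 2 <= gamma ^+ 2 * (2 * D ^+ 2 + 2 * 32 ^+ 2 * I3 ^+ 2).
    apply: (le_trans (sqr_le_norm hM)); rewrite exprMn ler_wpM2l ?sqr_ge0 //.
    exact: sqrD_le.
  rewrite ler_pdivrMr //; apply: (le_trans h); rewrite -[leRHS]mulrA; apply: ler_wpM2l; first exact: sqr_ge0.
  rewrite [leRHS]mulrDl -[X in _ <= _ + X]mulrA -expr2 lerD2r -/D -[leRHS]mulrA.
  apply: ler_peMr; first by apply: mulr_ge0 => //; exact: sqr_ge0.
  by rewrite mulrC ler_pdivlMr // mul1r.
- rewrite exprMn -mulrA ler_wpM2l ?sqr_ge0 // ler_pM ?sqr_ge0 ?(ltW i0) //.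
  by rewrite lerXn2r ?nnegrE ?addr_ge0 ?mulr_ge0 ?(le_trans k0 k1) // lerD2l ler_wpM2l.
Qed.

End BumpDrift.

(** * Inequalities for the cut-offs and the angle *)

Section BarrierArithmetic.
Context {R : realType}.

(** Every surplus factor i is paired with a factor [a], and a i <= 1 reduces all powers to i^2, the
    one that the confining function dissipates. *)
Lemma cut3_arith (a T i c : R) : 0 <= a -> 0 <= T -> 0 <= i -> a * i <= 1 -> 0 <= c -> c <= 1 ->
  - (3 * c ^+ 2) * a ^+ 2 * (2 - T / 2 * i ^+ 3) + 6 * c * a ^+ 4 * T * i ^+ 5
  <= 8 * (a * T * i ^+ 2).
Proof.
move=> a0 T0 i0 ai c0 c1; have ai0 : 0 <= a * i by exact: mulr_ge0.
set p := a * T * i ^+ 2; have p0 : 0 <= p by rewrite !mulr_ge0 ?sqr_ge0.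
have -> : - (3 * c ^+ 2) * a ^+ 2 * (2 - T / 2 * i ^+ 3) + 6 * c * a ^+ 4 * T * i ^+ 5 =
  - 6 * (c * a) ^+ 2 + 3 / 2 * (c ^+ 2 * (a * i) * p) + 6 * (c * (a * i) ^+ 3 * p).
  by rewrite /p; field.
have q1 : c ^+ 2 * (a * i) * p <= p.
  by rewrite ler_piMl // mulr_ile1 ?sqr_ge0 // expr_le1.
have q2 : c * (a * i) ^+ 3 * p <= p.
  by rewrite ler_piMl // mulr_ile1 ?exprn_ge0 // exprn_ile1.
have := sqr_ge0 (c * a); lra.
Qed.

Lemma cut1_arith (T I1 eta c : R) : 0 < eta -> 0 <= T -> 0 <= I1 -> I1 <= eta -> 0 <= c -> c <= 1 ->
  - (3 * c ^+ 2) / eta * (T - I1 ^+ 3) + 3 * c / eta ^+ 2 * (T * I1 / 2)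
  <= 3 * eta ^+ 2 + 2 * (T / eta).
Proof.
move=> e0 T0 I0 Ie c0 c1; have en : eta != 0 by exact: lt0r_neq0.
pose r : R := I1 / eta; have r0 : 0 <= r by rewrite divr_ge0 // ltW.
have r1 : r <= 1 by rewrite ler_pdivrMr // mul1r.
pose p := T / eta; have p0 : 0 <= p by rewrite divr_ge0 // ltW.
have -> : - (3 * c ^+ 2) / eta * (T - I1 ^+ 3) + 3 * c / eta ^+ 2 * (T * I1 / 2) =
  - 3 * (c ^+ 2 * p) + 3 * (c ^+ 2 * r ^+ 3 * eta ^+ 2) + 3 / 2 * (c * r * p).
  by rewrite /p /r; field.
have q1 : c ^+ 2 * r ^+ 3 * eta ^+ 2 <= eta ^+ 2.
  by rewrite ler_piMl ?sqr_ge0 // mulr_ile1 ?exprn_ge0 ?sqr_ge0 // exprn_ile1.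
have q2 : c * r * p <= p by rewrite ler_piMl // mulr_ile1.
have q3 : 0 <= c ^+ 2 * p by rewrite mulr_ge0 ?sqr_ge0.
by rewrite -/p; lra.
Qed.

Lemma cross_arith (a T1 T3 I1 I3 i eta c1 c3 y X : R) : 0 < a -> 0 <= T1 -> 0 <= T3 -> 0 <= I1 ->
  0 < eta -> I1 <= eta -> 0 <= i -> I3 * i = 1 -> a * i <= 1 ->
  0 <= c1 -> c1 <= 1 -> 0 <= c3 -> c3 <= 1 -> 0 <= y -> y <= 1/10 -> `|X| <= 66 ->
  X * (9 / 2 * c1 ^+ 3 * c3 ^+ 2 * y ^+ 2 * 2 * a ^+ 2 * I1 * i ^+ 5 * T3 * I3
       + 9 / 2 * c3 ^+ 3 * c1 ^+ 2 * y ^+ 2 / eta * i * T1 * I1)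
  <= 6 * (T3 * eta / a ^+ 2) + 3 * (T1 / a).
Proof.
move=> a0 T10 T30 I10 e0 Ie i0 Ii ai c10 c11 c30 c31 y0 y1 hX.
have en : eta != 0 by exact: lt0r_neq0.
have an : a != 0 by exact: lt0r_neq0.
have ai0 : 0 <= a * i by rewrite mulr_ge0 // ltW.
pose r : R := I1 / eta; have r0 : 0 <= r by rewrite divr_ge0 // ltW.
have r1 : r <= 1 by rewrite ler_pdivrMr // mul1r.
pose p := T3 * eta / a ^+ 2; have p0 : 0 <= p by rewrite !mulr_ge0 // ?invr_ge0 ?sqr_ge0 // ltW.
pose q := T1 / a; have q0 : 0 <= q by rewrite divr_ge0 // ltW.
have -> : 9 / 2 * c1 ^+ 3 * c3 ^+ 2 * y ^+ 2 * 2 * a ^+ 2 * I1 * i ^+ 5 * T3 * I3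
       + 9 / 2 * c3 ^+ 3 * c1 ^+ 2 * y ^+ 2 / eta * i * T1 * I1 =
   9 / 2 * y ^+ 2 * (2 * (c1 ^+ 3 * c3 ^+ 2 * (a * i) ^+ 4 * r * p) + c3 ^+ 3 * c1 ^+ 2 * (a * i) * r * q).
  transitivity (9 / 2 * y ^+ 2 * (2 * (c1 ^+ 3 * c3 ^+ 2 * (a * i) ^+ 4 * r * p) * (I3 * i) + c3 ^+ 3 * c1 ^+ 2 * (a * i) * r * q)).
    by rewrite /p /q /r; field; rewrite an en.
  by rewrite Ii mulr1.
set u := c1 ^+ 3 * _ * _ * _ * _; set v := _ * q.
have m1 (s t : R) : 0 <= s <= 1 -> 0 <= t <= 1 -> 0 <= s * t <= 1.
  by move=> /andP[? ?] /andP[? ?]; rewrite mulr_ge0 // mulr_ile1.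
have m2 (s : R) k : 0 <= s -> s <= 1 -> 0 <= s ^+ k <= 1.
  by move=> ? ?; rewrite exprn_ge0 // exprn_ile1.
have m3 (s t : R) : 0 <= s <= 1 -> 0 <= t -> 0 <= s * t <= t.
  by move=> /andP[? ?] ?; rewrite mulr_ge0 // ler_piMl.
have hr : 0 <= r <= 1 by rewrite r0.
have hai : 0 <= a * i <= 1 by rewrite ai0.
have /andP[u0 u1] : 0 <= u <= p 
  by apply: (m3 _ _ _ p0); apply: (m1 _ _ _ hr); apply: (m1 _ _ (m1 _ _ _ _)); exact: m2.
have /andP[v0 v1] : 0 <= v <= q 
  by apply: (m3 _ _ _ q0); apply: (m1 _ _ _ hr); apply: (m1 _ _ _ hai); apply: (m1); exact: m2.
have y2 : y ^+ 2 <= 1 / 100.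
  by rewrite (_ : 1 / 100 = (1 / 10) ^+ 2) ?lerXn2r ?nnegrE //; field.
set w := 9 / 2 * y ^+ 2 * _.
have w0 : 0 <= w by rewrite !mulr_ge0 ?sqr_ge0 // addr_ge0 // mulr_ge0.
have w1 : w <= 9 / 200 * (2 * p + q).
  rewrite /w; apply: ler_pM.
  - by rewrite mulr_ge0 ?sqr_ge0.
  - by rewrite addr_ge0 // mulr_ge0.
  - by move: y2; lra.
  - by move: u1 v1; lra.
apply: (le_trans (ler_norm _)); rewrite normrM (ger0_norm w0).
have := ler_pM (normr_ge0 X) w0 hX w1; rewrite -/p -/q => h; apply: (le_trans h).
by move: p0 q0; lra.
Qed.

(* Here [C, S] are the cosine and sine of [u = theta3 - 2pi/3], so that the two
   squares are those of [sin theta3 + sqrt 3 / 2] and [1 + 2 cos theta3]. *)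
Lemma half_angle (C S : R) : C ^+ 2 + S ^+ 2 = 1 ->
  2 * (1 - C) * (Num.sqrt 3 / 2 * C - 1 / 2 * S + Num.sqrt 3 / 2) ^+ 2 =
  (1 + C) / 2 * (1 + 2 * (- (1 / 2) * C - Num.sqrt 3 / 2 * S)) ^+ 2.
Proof.
move=> CS; have := @sqrt3E R; move: (Num.sqrt 3) => s s3.
apply/eqP; rewrite -subr_eq0; apply/eqP.
transitivity ((C ^+ 2 + S ^+ 2 - 1) * ((1 - C) / 2 - (1 + C) / 2 * s ^+ 2)
  + (s ^+ 2 - 3) * 0); last by rewrite CS s3 !subrr mul0r mulr0 addr0.
by field.
Qed.

(** The constant comes from 206/100 * 32 < 66. *)
Lemma dist_xi_par (C S xi p : R) : -1 <= C -> C <= 1 -> -1 <= S -> S <= 1 ->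
  `|xi| <= 1/100 -> `|p| <= 32 -> `|dist_xi C S xi| * `|p| <= 66.
Proof.
move=> C0 C1 S0 S1; rewrite ler_norml => /andP[x0 x1] hp.
have hx : `|dist_xi C S xi| <= 206/100.
  have [u1 u2] := mul_itv x0 x1 C0 C1.
  rewrite ler_norml /dist_xi; move: u1 u2; rewrite mulrDr mulr1 -[2 * xi * C]mulrA.
  by move: (xi * C) => v u1 u2; apply/andP; split; lra.
by have := ler_pM (normr_ge0 _) (normr_ge0 _) hx hp; lra.
Qed.

Lemma sin_shift_sqr (t : R) : (sin t + Num.sqrt 3 / 2) ^+ 2 <= 4.
Proof.
have [c s] := @sqrt3_bounds R; have k1 := sin_geN1 t; have k2 := sin_le1 t.
rewrite (_ : 4 = 2 ^+ 2); last by ring.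
by apply: sqr_le_norm; rewrite ler_norml; apply/andP; split; lra.
Qed.

(** Away from the repelling point the factor 2 (1 - C) is at least 1/20, while (1 + C) / 2 <= 1;
    this is the origin of the constant 20. *)
Lemma angle_far (C P Q y : R) : 1 / 40 <= 1 - C -> C <= 1 ->
  2 * (1 - C) * P ^+ 2 = (1 + C) / 2 * Q ^+ 2 -> P ^+ 2 <= 20 * Q ^+ 2 + 1600 * y ^+ 2.
Proof.
move=> hC C1 HA; have Q0 := sqr_ge0 Q; have P0 := sqr_ge0 P; have y0 := sqr_ge0 y.
have hL : 2 * (1 / 40) * P ^+ 2 <= 2 * (1 - C) * P ^+ 2 by rewrite ler_wpM2r // ler_wpM2l.
have hR : (1 + C) / 2 * Q ^+ 2 <= 1 * Q ^+ 2 by rewrite ler_wpM2r //; lra.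
rewrite HA in hL; lra.
Qed.

Lemma bump_near (w : R) : w < 1 / 20 -> 4 <= 1600 * pos (1/10 - w) ^+ 2.
Proof.
move=> hw; rewrite pos_id; last by lra.
have h : 1 / 20 <= 1 / 10 - w by lra.
have h0 : 0 <= 1 / 20 :> R by lra.
by have := ler_pM h0 h0 h h; rewrite -expr2; lra.
Qed.

Lemma barrier_collect (g p Y u1 u3 y2 Lb E A3 P A1 Q X Z S : R) : 0 < g ->
  0 <= p <= 1 -> 0 <= Y -> Y <= 1/10 -> 0 <= u1 <= 1 -> 0 <= u3 <= 1 -> 0 <= E -> 0 <= P -> 0 <= Q ->
  3/4 * g * y2 <= - Lb + g * E -> A3 <= 8 * P -> A1 <= Q -> X * Z <= S ->
  3/4 * g * (p * y2) <= - (p * Lb + Y * (u1 * (g * A3) + u3 * (g * A1)) + g * X * Z)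
    + g * (E + P + Q + S).
Proof.
move=> g0 /andP[p0 p1] Y0 Y1 /andP[u10 u11] /andP[u30 u31] E0 P0 Q0 hb h3 h1 hc.
have gE : 0 <= g * E by rewrite mulr_ge0 // ltW.
have b1 : p * (3/4 * g * y2) <= - (p * Lb) + g * E.
  apply: (le_trans (ler_wpM2l p0 hb)); rewrite mulrDr mulrN lerD2l; exact: ler_piMl.
have b3 : g * (Y * u1 * A3) <= g * P.
  rewrite ler_wpM2l ?(ltW g0) //; apply: (le_trans (ler_wpM2l (mulr_ge0 Y0 u10) h3)).
  rewrite mulrA ler_piMl //.
  by have := ler_pM Y0 u10 Y1 u11; lra.
have b2 : g * (Y * u3 * A1) <= g * Q.
  rewrite ler_wpM2l ?(ltW g0) //; apply: (le_trans (ler_wpM2l (mulr_ge0 Y0 u30) h1)).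
  rewrite ler_piMl //.
  by have := ler_pM Y0 u30 Y1 u31; lra.
have b4 : g * (X * Z) <= g * S by rewrite ler_wpM2l // ltW.
rewrite !mulrDr; move: b1 b2 b3 b4.
rewrite (_ : p * (3/4 * g * y2) = 3/4 * g * (p * y2)); last by ring.
rewrite (_ : Y * (u1 * (g * A3)) = g * (Y * u1 * A3)); last by ring.
rewrite (_ : Y * (u3 * (g * A1)) = g * (Y * u3 * A1)); last by ring.
rewrite -[g * X * Z]mulrA.
by move: (_ * (p * y2)) (p * Lb) (g * E) (g * _ ) (g * _) (g * _) (g * _) (g * _) (g * _); clear => *; lra.
Qed.

End BarrierArithmetic.

(** * Drift of the barrier *)

Section BarrierDrift.
Context {R : realType}.
Notation st := (bstate R).

(** Error of the barrier per unit of [gamma]. The first summand is small with [gamma], the second is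
    absorbed by the dissipation of I3^-2 when [a] is small, and the last is small when [eta] is
    small given [a] and then [T1] given both. *)
Definition barrier_cost (gamma T1 T3 sigma a eta I3 : R) :=
  gamma * (barrier_err a T3 ((4 / sigma) ^+ 2 * (8 * sigma)) * (1 + I3))
  + a * T3 * I3^-1 ^+ 2
  + (3 * eta ^+ 2 + 2 * (T1 / eta) + 6 * (T3 * eta / a ^+ 2) + 3 * (T1 / a)).

Variables (gamma T1 T3 sigma a eta : R) (l : seq (@term R)) (x : st).
Hypotheses (g0 : 0 < gamma) (T10 : 0 < T1) (T11 : T1 <= 1) (T30 : 0 < T3).
Hypotheses (sigma0 : 0 < sigma) (sigma1 : sigma <= 1 / 1000) (a0 : 0 < a).
Hypotheses (eta0 : 0 < eta) (eta1 : eta <= 1) (eta_le : eta <= a * (sigma / 4)).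
Hypothesis (nl : nrm sigma l <= 8 * sigma).
Hypothesis res : forall e al : R, 0 <= e -> e <= sigma / 4 ->
  `|ev (map tang l) e al - Num.sqrt 3 * ev l e al
     - curve_rhs e al (ev l e al) (ev (map tang l) e al)| <= gamma.
Hypothesis px : pquad x.
Let I1 := x.1.1.
Let I3 := x.1.2.
Let i := I3^-1.
Let c1 := pos (1 - I1 / eta).
Let c3 := pos (1 - a ^+ 2 * i ^+ 2).
Let y := pos (1/10 - jv (jdist l) x).
Let I10 : 0 < I1. Proof. by case: px. Qed.
Let I30 : 0 < I3. Proof. by case: px. Qed.
Let i0 : 0 < i. Proof. by rewrite invr_gt0. Qed.

Let pos_gt0 (v : R) : 0 < pos v -> 0 < v.
Proof. by have [//|v0] := ltP 0 v; rewrite pos_0 ?ltxx. Qed.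

Lemma cutoff_range : 0 < c1 -> 0 < c3 -> [/\ I1 <= eta, a <= I3 & I1 / I3 <= sigma / 4].
Proof.
move=> /pos_gt0; rewrite subr_gt0 ltr_pdivrMr // mul1r => /ltW Ie.
move=> /pos_gt0; rewrite subr_gt0 -exprMn => /ltW ai.
have aI : a <= I3.
  by rewrite -[leRHS]mul1r -ler_pdivrMr // -(@expr_le1 _ 2) // mulr_ge0 // ltW.
split => //; rewrite ler_pdivrMr //; apply: (le_trans Ie); apply: (le_trans eta_le).
by rewrite mulrC ler_wpM2l // divr_ge0 // ltW.
Qed.

Let dist_cos : jv (jdist l) x =
  dist (cos (jv ju x)) (sin (jv ju x)) (ev l (I1 / I3) (jv jang x)).
Proof. exact: jdistE. Qed.
Let e0 : 0 <= I1 / I3. Proof. by rewrite divr_ge0 // ltW. Qed.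
Let s8 : 8 * sigma <= 1/100. Proof. by move: sigma1 => h; lra. Qed.

Let xi_small : I1 / I3 <= sigma / 4 -> `|ev l (I1 / I3) (jv jang x)| <= 1/100.
Proof.
move=> es; apply: (@le_trans _ _ (nrm sigma l)); last exact: le_trans nl s8.
exact: ev_bound.
Qed.

Lemma bump_range : 0 <= y /\ (I1 / I3 <= sigma / 4 -> y <= 1/10).
Proof.
split=> [|es]; first exact: pos_ge0.
rewrite /y; have [h|h] := lerP 0 (1/10 - jv (jdist l) x); last by rewrite pos_0 ?ltW.
rewrite pos_id // gerBl dist_cos dist_ge0 //; exact: cos2Dsin2.
Qed.

Lemma barrier_drift : 3/4 * gamma * (c1 ^+ 3 * c3 ^+ 3 * y ^+ 2)
  <= - jgen gamma T1 T3 (jbarrier l a eta) x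
     + gamma * barrier_cost gamma T1 T3 sigma a eta I3.
Proof.
have [y0 y1] := bump_range.
have c10 : 0 <= c1 by exact: pos_ge0.
have c30 : 0 <= c3 by exact: pos_ge0.
set k2 := (4 / sigma) ^+ 2 * (8 * sigma).
have B0 : 0 <= barrier_err a T3 k2 * (1 + I3).
  by rewrite mulr_ge0 ?barrier_err_ge0 // addr_ge0 // ltW.
have P0 : 0 <= a * T3 * i ^+ 2 by rewrite !mulr_ge0 ?sqr_ge0 // ltW.
have Q0 : 0 <= 3 * eta ^+ 2 + 2 * (T1 / eta) by rewrite addr_ge0 // mulr_ge0 ?sqr_ge0 // divr_ge0 // ltW.
have R0 : 0 <= 6 * (T3 * eta / a ^+ 2) + 3 * (T1 / a).
  by rewrite addr_ge0 // mulr_ge0 // divr_ge0 ?sqr_ge0 ?mulr_ge0 // ltW.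
have cost : barrier_cost gamma T1 T3 sigma a eta I3 = gamma * (barrier_err a T3 k2 * (1 + I3))
   + a * T3 * i ^+ 2 + (3 * eta ^+ 2 + 2 * (T1 / eta)) + (6 * (T3 * eta / a ^+ 2) + 3 * (T1 / a)).
  by rewrite /barrier_cost -/i -/k2 -!addrA.
have cost0 : 0 <= gamma * barrier_cost gamma T1 T3 sigma a eta I3.
  have B1 := mulr_ge0 (ltW g0) B0.
  by rewrite cost mulr_ge0 ?(ltW g0) //; exact: (addr_ge0 (addr_ge0 (addr_ge0 B1 P0) Q0) R0).
rewrite jgen_barrier // jgen_cut1 // jgen_cut3 // -/I1 -/I3 -/i -/c1 -/c3 -/y.
set X := dist_xi _ _ _ * _.
(* Where a cut-off vanishes, so do its first two derivatives, and both the gain and the drift of the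
   barrier are 0. Only the remaining region guarantees e <= [sigma] / 4, without which the curve is
   not controlled. *)
have [c1E|c1N] := eqVneq c1 0.
  rewrite c1E !(expr0n, mul0r, mulr0, addr0, add0r, oppr0) /= ?(mul0r,mulr0,addr0,add0r,oppr0) //.
have [c3E|c3N] := eqVneq c3 0.
  by rewrite c3E !(expr0n, mul0r, mulr0, addr0, add0r, oppr0) /= ?(mul0r,mulr0,addr0,add0r,oppr0).
have c1p : 0 < c1 by rewrite lt_neqAle eq_sym c1N.
have c3p : 0 < c3 by rewrite lt_neqAle eq_sym c3N.
have [Ie aI es] := cutoff_range c1p c3p.
have {}y1 := y1 es.
have ai : a * i <= 1 by rewrite ler_pdivrMr // mul1r.
have pos_le1 (v : R) : 0 <= v -> pos (1 - v) <= 1.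
  by move=> v0; have [h|h] := lerP 0 (1 - v); [rewrite pos_id // gerBl|rewrite pos_0 ?ltW].
have c11 : c1 <= 1 by rewrite pos_le1 // divr_ge0 // ltW.
have c31 : c3 <= 1 by rewrite pos_le1 // mulr_ge0 // sqr_ge0.
have I11 : I1 <= 1 by exact: le_trans Ie eta1.
have hb := bump_drift g0 T10 T11 T30 sigma0 sigma1 a0 nl px I11 aI es (res _ e0 es).
rewrite -/y -/I3 -/k2 in hb.
have h3 := cut3_arith (ltW a0) (ltW T30) (ltW i0) ai c30 c31.
have h1 := cut1_arith eta0 (ltW T10) (ltW I10) Ie c10 c11.
have hX : `|X| <= 66.
  have [q1 q2 q3 _ _] := curve_small sigma0 sigma1 nl px es.
  rewrite /X normrM.
  have [_ C1 S1 S2] := CS_bounds (cos2Dsin2 (jv ju x)).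
  have /andP[C0 _] : -1 <= cos (jv ju x) <= 1 by rewrite cos_geN1 cos_le1.
  exact: dist_xi_par.
have hc := cross_arith a0 (ltW T10) (ltW T30) (ltW I10) eta0 Ie (ltW i0) (mulfV (lt0r_neq0 I30)) ai
  c10 c11 c30 c31 y0 y1 hX.
have y3 : y ^+ 3 <= 1/10.
  have y01 : y <= 1 by apply: (le_trans y1); lra.
  by apply: le_trans y1; rewrite exprS ler_piMr // expr_le1.
have u1 : 0 <= c1 ^+ 3 <= 1 by rewrite exprn_ge0 // exprn_ile1.
have u3 : 0 <= c3 ^+ 3 <= 1 by rewrite exprn_ge0 // exprn_ile1.
have p01 : 0 <= c1 ^+ 3 * c3 ^+ 3 <= 1.
  by case/andP: u1 => ? ?; case/andP: u3 => ? ?; rewrite mulr_ge0 // mulr_ile1.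
rewrite cost; apply: (barrier_collect g0 p01 (exprn_ge0 3 y0) y3 u1 u3 _ P0 Q0 hb h3 h1 hc).
by rewrite mulr_ge0 // ltW.
Qed.

(** If the distance is at least 1/20, theta3 is far from the repelling point and the half-angle
    identity gives the factor 20. Otherwise y > 1/20, and 1600 y^2 >= 4 exceeds the trivial bound on
    the left-hand side. *)
Lemma cutoff_angle : 0 < c1 -> 0 < c3 ->
  (sin x.2.2 + Num.sqrt 3 / 2) ^+ 2 <= 20 * (1 + 2 * cos x.2.2) ^+ 2 + 1600 * y ^+ 2.
Proof.
move=> /cutoff_range h /h[Ie aI es].
have xis := xi_small es; have [y0 _] := bump_range.
have P4 : (sin x.2.2 + Num.sqrt 3 / 2) ^+ 2 <= 4.
  exact: sin_shift_sqr.
set u := jv ju x; have CS := cos2Dsin2 u; have HA := half_angle CS.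
have h3 : x.2.2 = u + phase by rewrite /u /=; ring.
move: P4; rewrite h3 cosD sinD cos_phase sin_phase.
rewrite (_ : sin u * - (1 / 2) + _ + _ = Num.sqrt 3 / 2 * cos u - 1 / 2 * sin u + Num.sqrt 3 / 2); last by ring.
rewrite (_ : cos u * - (1 / 2) - _ = - (1 / 2) * cos u - Num.sqrt 3 / 2 * sin u); last by ring.
have [n1 C1 S1 S2] := CS_bounds CS.
set P := _ - _ + _ => P4; set Q := 1 + 2 * _.
rewrite -/P -/Q in HA.
have [w|w] := lerP (1 / 20) (jv (jdist l) x).
  have [xl xu] : -(1/100) <= ev l (I1 / I3) (jv jang x) /\ ev l (I1 / I3) (jv jang x) <= 1/100.
    by apply/andP; rewrite -ler_norml.
  have := dist_far CS xl xu; rewrite -dist_cos => /(_ w) hC.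
  exact: angle_far hC C1 HA.
have y2 : 4 <= 1600 * y ^+ 2 by exact: bump_near.
by apply: (le_trans P4); apply: (le_trans y2); rewrite lerDr mulr_ge0 // sqr_ge0.
Qed.

End BarrierDrift.
(** * The Lyapunov function *)

Section LyapunovPieces.
Context {R : realType}.
Notation st := (bstate R).

Lemma is_derive_continuous (f : R -> R) (y df : R) : is_derive y 1 f df -> {for y, continuous f}.
Proof. by move=> [d _]; apply/differentiable_continuous/derivable1_diffP. Qed.

Section Drifts.
Variables (gamma T1 T3 : R) (x : st).
Hypotheses (g0 : 0 < gamma) (T10 : 0 < T1) (T11 : T1 <= 1) (T30 : 0 < T3) (px : pquad x).
Notation L := (jgen gamma T1 T3).
Let I1 := x.1.1.
Let I3 := x.1.2.
Let I10 : 0 < I1. Proof. by case: px. Qed.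
Let I30 : 0 < I3. Proof. by case: px. Qed.

(** The square dissipates I^4. The inverse blows up at 0 and still dissipates: the noise contributes
    T/2 I^-2 per unit of [gamma], which cancels only half of the inward drift - T I^-2. *)
Definition jinvsqr (J : @jet R) := jadd (jmul J J) (jinv J).
Definition jconfine := jadd (jinvsqr jI1) (jinvsqr (@jI3 R)).

Lemma quartic_absorb (k I : R) : - ((k ^+ 2 + 1) / 4) <= I ^+ 4 - k * I.
Proof.
have := sqr_ge0 (I ^+ 2 - 1 / 2); have := sqr_ge0 (I - k / 2).
have -> : I ^+ 4 = (I ^+ 2) ^+ 2 by ring.
by rewrite !sqrrB; move: (I ^+ 2) => v; lra.
Qed.

Let invsqr_drift (J : @jet R) T : jv J x != 0 ->
  L J x = gamma * (T - jv J x ^+ 3) -> jgam gamma T1 T3 J J x = gamma * T * jv J x / 2 ->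
  L (jinvsqr J) x = - gamma * (2 * jv J x ^+ 4 + T / 2 * (jv J x)^-1 ^+ 2 - (1 + 5 / 2 * T) * jv J x).
Proof.
move=> J0 hL hG; rewrite /jinvsqr jgen_add jgen_mul /jinv jgen_comp hL hG.
by field.
Qed.

Lemma confine_drift : gamma * (I3 ^+ 4 + T3 / 2 * I3^-1 ^+ 2)
  <= - L jconfine x + gamma * ((1 + 5 / 2 * T3) ^+ 2 + 4).
Proof.
rewrite /jconfine jgen_add (invsqr_drift (jI1_neq0 px) (jgen_I1 _ _ _ _) (jgam_I1 _ _ _ _)).
rewrite (invsqr_drift (jI3_neq0 px) (jgen_I3 _ _ _ _) (jgam_I3 _ _ _ _)).
rewrite [jv jI1 x]/= [jv jI3 x]/= -/I1 -/I3 !mulNr -opprD opprK -!mulrDr ler_pM2l //.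
have h3 := quartic_absorb (1 + 5 / 2 * T3) I3.
have h1 := quartic_absorb (7 / 2) I1.
have h2 : T1 * I1 <= I1 by rewrite ler_piMl // ltW.
have h4 : 0 <= T1 / 2 * I1^-1 ^+ 2 by rewrite mulr_ge0 ?sqr_ge0 // divr_ge0 // ltW.
have h5 : 0 <= I1 ^+ 4 by rewrite exprn_ge0 // ltW.
have h6 := sqr_ge0 (1 + 5 / 2 * T3).
rewrite (_ : (1 + 5 / 2 * T1) * I1 = I1 + 5 / 2 * (T1 * I1)); last by ring.
move: h1 h2 h3 h4 h5 h6; move: (T3 / 2 * _) ((1 + 5 / 2 * T3) ^+ 2) ((1 + 5 / 2 * T3) * I3) (T1 * I1) (T1 / 2 * _) (I1 ^+ 4) (I3 ^+ 4) => *; lra.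
Qed.

Lemma first_drift : gamma * I1 ^+ 3 <= - L jI1 x + gamma * T1.
Proof. by rewrite jgen_I1 -/I1 mulrBr opprB addrNK. Qed.

End Drifts.

Section Cubic.
Variables (gamma T1 T3 : R).
Notation L := (jgen gamma T1 T3).
Notation G := (jgam gamma T1 T3).

Definition jhorner (p : seq R) (X : @jet R) := foldr (fun c J => jadd (jcst c) (jmul X J)) (jcst 0) p.

Lemma jhorner_ok p X : jet_ok X -> jet_ok (jhorner p X).
Proof.
by move=> okX; elim: p => [|c p h] /=; [|apply: jadd_ok; [|exact: jmul_ok]]; exact: jcst_ok.
Qed.

Lemma jgen_quartic c1 c2 c3 c4 X x : let y := jv X x in
  L (jhorner [:: 0; c1; c2; c3; c4] X) x =
  (c1 + 2 * c2 * y + 3 * c3 * y ^+ 2 + 4 * c4 * y ^+ 3) * L X x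
  + (c2 + 3 * c3 * y + 6 * c4 * y ^+ 2) * G X X x.
Proof.
have GM J K : G X (jmul J K) x = jv J x * G X K x + jv K x * G X J x.
  by rewrite jgamC jgam_mul ![G _ X x]jgamC.
have GA J K : G X (jadd J K) x = G X J x + G X K x.
  by rewrite jgamC jgam_add ![G _ X x]jgamC.
have GC c : G X (jcst c) x = 0 by rewrite jgamC jgam_cst.
move=> y; rewrite /jhorner /= !(jgen_add, jgen_mul, jgen_cst, GA, GM, GC) /= -/y; ring.
Qed.

Variable s : R.
Hypotheses (g0 : 0 < gamma) (s0 : 0 < s) (sT : s ^+ 3 = T3).

(** The antiderivative of the cubic of [poisson_cubic] at I3 / s, where s = T3^(1/3) is the natural
    unit of I3. *)
Definition jcubic := jhorner [:: 0; - (3/4); 3/4; - (3/10); 1/20] (jmul (jcst s^-1) jI3).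

Lemma jcubic_ok : jet_ok jcubic.
Proof. by apply: jhorner_ok; apply: jmul_ok; [exact: jcst_ok|exact: jI3_ok]. Qed.

Lemma jcubic_ge x : -1 <= jv jcubic x.
Proof.
rewrite /=; set y := s^-1 * _.
have := sqr_ge0 (y ^+ 2 - 3 * y); have := sqr_ge0 (y - 5 / 4).
rewrite -subr_ge0 => h1 h2; rewrite -subr_ge0.
rewrite [leRHS](_ : _ = 1 / 20 * ((y ^+ 2 - 3 * y) ^+ 2 + 6 * (y - 5 / 4) ^+ 2 + 85 / 8)); last by field.
by move: h1 h2; move: (_ ^+ 2) (_ ^+ 2) => u v; lra.
Qed.

Lemma cubic_drift x : pquad x -> gamma * (x.1.2 - 92/100 * s) ^+ 2
  <= - L jcubic x + gamma * (11/100 * s ^+ 2).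
Proof.
move=> px; rewrite /jcubic jgen_quartic.
set X := jmul _ _; pose y := x.1.2 / s.
have XE : jv X x = y by rewrite /= mulrC.
have LX : L X x = s^-1 * (gamma * (T3 - x.1.2 ^+ 3)).
  by rewrite /X jgen_mul jgen_cst jgam_cst jgen_I3 /= mulr0 !addr0.
have GX : G X X x = s^-1 ^+ 2 * (gamma * T3 * x.1.2 / 2).
  rewrite /X jgam_mul jgam_cst jgamC jgam_mul jgam_cst jgam_I3 [jv (jcst _) x]/=; ring.
rewrite XE LX GX -sT.
have -> : x.1.2 = s * y by rewrite /y mulrC divfK // lt0r_neq0.
have sn := lt0r_neq0 s0.
have y0 : 0 <= y by rewrite divr_ge0 // ltW // px.2.
have := poisson_cubic y0.
have g0' : 0 <= gamma * s ^+ 2 by rewrite mulr_ge0 ?sqr_ge0 // ltW.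
move/(ler_wpM2l g0'); set lhs := (X in X <= _); set rhs := (X in _ <= X) => h.
have -> : gamma * (s * y - 92 / 100 * s) ^+ 2 = lhs by rewrite /lhs; ring.
apply: (le_trans h); rewrite le_eqVlt; apply/orP; left; apply/eqP; rewrite /rhs; move: y {y0 h lhs rhs XE} => y.
by field.
Qed.

End Cubic.

Section Psi.
Variables (gamma T1 T3 : R).
Notation L := (jgen gamma T1 T3).

(** The derivative factors as (1 + 2c) (c^2 - c + 1/2) with c = cos t. The second factor is at least
    1/4, so the function decreases along theta3' = - I3 (1 + 2c); it is also such that the product
    has mean 0 over the circle, which makes the antiderivative periodic. *)
Definition jpsi := jcomp (fun t : R => 2 * sin t - 2 / 3 * sin t ^+ 3 - 1 / 2 * (sin t * cos t))
  (fun t => 2 * cos t ^+ 3 - cos t ^+ 2 + 1 / 2)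
  (fun t => 2 * cos t * sin t - 6 * cos t ^+ 2 * sin t) jt3.

Lemma jpsi_ok : jet_ok jpsi.
Proof.
apply: jcomp_ok => [|x _]; first exact: jt3_ok.
move: (jv jt3 x) => t; split.
- apply: is_derive_eq; rewrite /GRing.scale /=; have := cos2Dsin2 t.
  move: (cos t) (sin t) => c d cd; apply/eqP; rewrite -subr_eq0; apply/eqP.
  transitivity ((c ^+ 2 + d ^+ 2 - 1) * (1 / 2 - 2 * c)); first by field.
  by rewrite cd subrr mul0r.
- by apply: is_derive_eq; rewrite /GRing.scale /=; ring.
- by apply: is_derive_continuous.
Qed.

Lemma jpsi_bound x : -4 <= jv jpsi x <= 4.
Proof.
rewrite /=; move: x.2.2 => t.
have [c0 c1 s0 s1] := CS_bounds (cos2Dsin2 t).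
have [p0 p1] := mul_itv s0 s1 s0 s1; have [q0 q1] := mul_itv p0 p1 s0 s1.
have [r0 r1] := mul_itv s0 s1 c0 c1.
rewrite exprSr expr2; move: (sin t * sin t * sin t) (sin t * cos t) q0 q1 r0 r1 => u v q0 q1 r0 r1.
by apply/andP; split; lra.
Qed.

Lemma psi_drift x : pquad x -> 0 < gamma ->
  x.1.2 * (1 + 2 * cos x.2.2) ^+ 2 / 4 <= - L jpsi x + 7 * x.1.1 + 4 * gamma.
Proof.
move=> [I10 I30] g0; rewrite /jpsi jgen_comp jgen_t3 jgam_t3 /=.
have [c0 c1 s0 s1] := CS_bounds (cos2Dsin2 x.2.2).
have [d0 d1 _ _] := CS_bounds (cos2Dsin2 x.2.1).
move: x.1.1 x.1.2 I10 I30 => I1 I3 I10 I30.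
move: (cos x.2.2) (sin x.2.2) (cos x.2.1) c0 c1 s0 s1 d0 d1 => c d e c0 c1 s0 s1 d0 d1.
have [p0 p1] := mul_itv c0 c1 c0 c1; have [q0 q1] := mul_itv p0 p1 c0 c1.
have [r0 r1] := mul_itv c0 c1 s0 s1; have [t0 t1] := mul_itv p0 p1 s0 s1.
set k := 2 * c ^+ 3 - c ^+ 2 + 1 / 2; set m := 2 * c * d - _.
have k0 : - (7 / 2) <= k by rewrite /k exprSr expr2; lra.
have k1 : k <= 7 / 2 by rewrite /k exprSr expr2; have := sqr_ge0 c; rewrite expr2; lra.
have m1 : m <= 8 by rewrite /m expr2 -!mulrA; rewrite -mulrA in t0; lra.
have [h0 h1] := mul_itv k0 k1 d0 d1.
have a1 : I3 * (1 + 2 * c) ^+ 2 / 4 <= k * (I3 * (1 + 2 * c)).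
  have -> : k * (I3 * (1 + 2 * c)) = I3 * (1 + 2 * c) ^+ 2 / 4 + I3 * ((1 + 2 * c) * (c - 1 / 2)) ^+ 2.
    by rewrite /k; field.
  by rewrite lerDl mulr_ge0 ?sqr_ge0 // ltW.
have a2 : - 7 * I1 <= k * (2 * I1 * e).
  rewrite (_ : k * _ = 2 * (k * e) * I1); last by ring.
  by rewrite ler_wpM2r ?(ltW I10) //; lra.
have a3 : m / 2 * gamma <= 4 * gamma by rewrite ler_wpM2r ?(ltW g0) //; lra.
move: a1 a2 a3; rewrite [k * - _]mulrN [k * (_ + _)]mulrDr.
by move: (k * (I3 * _)) (k * (2 * _ * _)) (m / 2 * _) (I3 * _ / 4); clear => *; lra.
Qed.

End Psi.
End LyapunovPieces.

(** * Pointwise inequalities and their collection *)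

Section PointwiseAlgebra.
Context {R : realType}.

(** The price of having no angle control off the cut-offs. From 1 - c^3 <= 3 (1 - c), the cut-off in
    I3 loses a constant 3 a^2; the one in I1 loses 3 I3^2 I1 / [eta], which Young's inequality
    splits into dissipated powers. *)
Lemma cutoff_loss (a kappa eta I1 I3 i c1 c3 : R) : 0 < I3 -> I3 * i = 1 -> 0 <= I1 -> 0 < eta ->
  0 < kappa -> 0 <= c1 <= 1 -> 0 <= c3 <= 1 -> 1 - I1 / eta <= c1 -> 1 - a ^+ 2 * i ^+ 2 <= c3 ->
  I3 ^+ 2 * (1 - c1 ^+ 3 * c3 ^+ 3) <= 3 * a ^+ 2 + 3/2 * (kappa * I3 ^+ 4 + I1 ^+ 2 / (kappa * eta ^+ 2)).
Proof.
move=> I30 Ii I10 e0 k0 c1b c3b h1 h3.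
have cube (c : R) : 0 <= c <= 1 -> 0 <= c ^+ 3 <= 1 /\ 1 - c ^+ 3 <= 3 * (1 - c).
  move=> /andP[c0 cl]; split; first by rewrite exprn_ge0 // exprn_ile1.
  rewrite -subr_ge0 (_ : _ - _ = (1 - c) ^+ 2 * (c + 2)); last by ring.
  by rewrite mulr_ge0 ?sqr_ge0 // addr_ge0.
have [/andP[u0 u1] u2] := cube _ c1b; have [/andP[v0 v1] v2] := cube _ c3b.
have p0 : 0 <= (1 - c1 ^+ 3) * (1 - c3 ^+ 3) by rewrite mulr_ge0 // subr_ge0.
have q : 1 - c1 ^+ 3 * c3 ^+ 3 <= 3 * (I1 / eta) + 3 * (a ^+ 2 * i ^+ 2) by lra.
apply: (le_trans (ler_wpM2l (sqr_ge0 I3) q)).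
have -> : I1 ^+ 2 / (kappa * eta ^+ 2) = (I1 / eta) ^+ 2 / kappa.
  by field; rewrite !lt0r_neq0.
move: (I1 / eta) => r; rewrite mulrDr.
have -> : I3 ^+ 2 * (3 * (a ^+ 2 * i ^+ 2)) = 3 * a ^+ 2 * (I3 * i) ^+ 2 by ring.
rewrite Ii expr1n mulr1 addrC lerD2l -subr_ge0.
have -> : 3 / 2 * (kappa * I3 ^+ 4 + r ^+ 2 / kappa) - I3 ^+ 2 * (3 * r) =
  3 / 2 * ((kappa * I3 ^+ 2 - r) ^+ 2 / kappa) by field; exact: lt0r_neq0.
by rewrite mulr_ge0 // divr_ge0 ?sqr_ge0 // ltW.
Qed.

(** The height needs I3^2 Q^2 and I3^2 y^2, but only I3 Q^2 and y^2 are dissipated. For I3 <= M the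
    missing powers cost M and M^2; for I3 >= M one has I3^2 <= I3^4 / M^2, which the confining
    function pays for. *)
Lemma angle_split (I3 M Q P y chi kQ ky : R) : 0 < I3 -> 1 <= M -> 0 <= kQ -> 0 <= ky ->
  0 <= chi <= 1 -> y ^+ 2 <= 1 -> Q ^+ 2 <= 9 -> P ^+ 2 <= 4 ->
  (0 < chi -> P ^+ 2 <= kQ * Q ^+ 2 + ky * y ^+ 2) ->
  I3 ^+ 2 * P ^+ 2 <= 4 * (I3 ^+ 2 * (1 - chi)) + kQ * (M * (I3 * Q ^+ 2) + 9 * (I3 ^+ 4 / M ^+ 2))
    + ky * (M ^+ 2 * (chi * y ^+ 2) + I3 ^+ 4 / M ^+ 2).
Proof.
move=> I30 M1 kQ0 ky0 /andP[c0 c1] y1 Q9 P4 hP.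
have M0 : 0 < M by apply: lt_le_trans M1.
have Q0 := sqr_ge0 Q; have y0 := sqr_ge0 y; have P0 := sqr_ge0 P; have S0 := sqr_ge0 I3.
have F0 : 0 <= I3 ^+ 4 / M ^+ 2 by rewrite divr_ge0 ?sqr_ge0 // exprn_ge0 // ltW.
have large : M <= I3 -> I3 ^+ 2 <= I3 ^+ 4 / M ^+ 2.
  move=> MI; rewrite ler_pdivlMr ?exprn_gt0 // (_ : I3 ^+ 4 = I3 ^+ 2 * I3 ^+ 2); last by ring.
  by rewrite ler_wpM2l // lerXn2r ?nnegrE ?(ltW M0) ?(ltW I30).
have hQ : chi * (I3 ^+ 2 * Q ^+ 2) <= M * (I3 * Q ^+ 2) + 9 * (I3 ^+ 4 / M ^+ 2).
  apply: (@le_trans _ _ (I3 ^+ 2 * Q ^+ 2)); first by rewrite ler_piMl // mulr_ge0.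
  have [IM|/ltW MI] := lerP I3 M.
    apply: ler_wpDr; first exact: mulr_ge0.
    by rewrite expr2 -mulrA ler_wpM2r // mulr_ge0 // ltW.
  apply: ler_wpDl; first exact: mulr_ge0 (ltW M0) (mulr_ge0 (ltW I30) Q0).
  by rewrite mulrC ler_pM // large.
have hy : chi * (I3 ^+ 2 * y ^+ 2) <= M ^+ 2 * (chi * y ^+ 2) + I3 ^+ 4 / M ^+ 2.
  have cy : 0 <= chi * y ^+ 2 by exact: mulr_ge0.
  have [IM|/ltW MI] := lerP I3 M.
    apply: ler_wpDr => //; rewrite mulrCA ler_wpM2r //.
    by rewrite lerXn2r ?nnegrE ?(ltW M0) ?(ltW I30).
  apply: ler_wpDl; first by rewrite mulr_ge0 ?sqr_ge0.
  rewrite mulrCA -[leRHS]mulr1 ler_pM ?large //.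
  by rewrite -[leRHS]mulr1 ler_pM.
have hP4 : (1 - chi) * (I3 ^+ 2 * P ^+ 2) <= 4 * (I3 ^+ 2 * (1 - chi)).
  by rewrite [leLHS]mulrA [leLHS]mulrC [(1 - chi) * _]mulrC ler_wpM2r // mulr_ge0 // subr_ge0.
have hc : chi * (I3 ^+ 2 * P ^+ 2) <= kQ * (chi * (I3 ^+ 2 * Q ^+ 2)) + ky * (chi * (I3 ^+ 2 * y ^+ 2)).
  have [->|cN] := eqVneq chi 0; first by rewrite !mul0r !mulr0 addr0.
  have cp : 0 < chi by rewrite lt_neqAle eq_sym cN.
  rewrite [leRHS](_ : _ = chi * (I3 ^+ 2 * (kQ * Q ^+ 2 + ky * y ^+ 2))); last by ring.
  by rewrite !ler_wpM2l // hP.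
have gQ := ler_wpM2l kQ0 hQ; have gy := ler_wpM2l ky0 hy.
rewrite [leLHS](_ : _ = (1 - chi) * (I3 ^+ 2 * P ^+ 2) + chi * (I3 ^+ 2 * P ^+ 2)); last by ring.
apply: (le_trans (lerD hP4 hc)); rewrite -addrA lerD2l; exact: lerD.
Qed.

(** Young's inequality with weight 1/10, which keeps the main coefficient at 33/40 = 11/10 * 3/4,
    close to the limiting 3/4; the errors get 11, doubled to 22 when they are separated. *)
Lemma height_split (I1 I3 s1 P m c : R) : -1 <= s1 <= 1 ->
  m = Num.sqrt 3 / 2 * c ->
  (I1 * s1 + I3 * (P - Num.sqrt 3 / 2) + m) ^+ 2 <=
  33 / 40 * (I3 - c) ^+ 2 + 22 * I1 ^+ 2 + 22 * (I3 ^+ 2 * P ^+ 2).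
Proof.
move=> /andP[s10 s11] ->; have := @sqrt3E R; move: (Num.sqrt 3) => t t3.
pose p := I3 - c; pose q := I3 * P; pose r := I1 * s1.
have -> : I1 * s1 + I3 * (P - t / 2) + t / 2 * c = q + r - t / 2 * p by rewrite /p /q /r; field.
have -> : 33 / 40 * (I3 - c) ^+ 2 = 11 / 40 * t ^+ 2 * p ^+ 2 by rewrite t3 /p; field.
rewrite -exprMn -/q.
have h1 : r ^+ 2 <= I1 ^+ 2.
  rewrite /r exprMn ler_piMr ?sqr_ge0 // -[s1 ^+ 2]real_normK ?num_real // expr_le1 // ler_norml s10.
  exact: s11.
have h2 := sqr_ge0 (q - r).
have h3 := sqr_ge0 (t / 2 * p + 10 * (q + r)).
have -> : 11 / 40 * t ^+ 2 * p ^+ 2 = 11 / 10 * (t / 2 * p) ^+ 2 by field.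
move: h3 h2 h1; move: (t / 2 * p) => z; clear.
have -> : (q + r - z) ^+ 2 = (q + r) ^+ 2 - 2 * ((q + r) * z) + z ^+ 2 by ring.
have -> : (z + 10 * (q + r)) ^+ 2 = z ^+ 2 + 20 * ((q + r) * z) + 100 * (q + r) ^+ 2 by ring.
have -> : (q - r) ^+ 2 = 2 * q ^+ 2 + 2 * r ^+ 2 - (q + r) ^+ 2 by ring.
by lra.
Qed.

(** The drift of I1 dissipates only I1^3, at a cost proportional to [T1]. Lower powers are traded
    for it at the threshold [tau], leaving constants that are small with [tau]. *)
Lemma power_absorb (tau A B I : R) : 0 < tau -> 0 <= A -> 0 <= B -> 0 <= I ->
  A * I ^+ 2 + B * I <= A * tau ^+ 2 + B * tau + (A / tau + B / tau ^+ 2) * I ^+ 3.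
Proof.
move=> t0 A0 B0 I0; have tn := lt0r_neq0 t0; have t1 := ltW t0.
have p := mulr_ge0 (sqr_ge0 (I - tau)) (addr_ge0 I0 t1).
have h2 : I ^+ 2 <= tau ^+ 2 + I ^+ 3 / tau.
  rewrite -subr_ge0 (_ : _ - _ = ((I - tau) ^+ 2 * (I + tau) + I * tau * tau) / tau); last by field.
  exact: divr_ge0 (addr_ge0 p (mulr_ge0 (mulr_ge0 I0 t1) t1)) t1.
have h1 : I <= tau + I ^+ 3 / tau ^+ 2.
  rewrite -subr_ge0 (_ : _ - _ = ((I - tau) ^+ 2 * (I + tau) + I ^+ 2 * tau) / tau ^+ 2); last by field.
  exact: divr_ge0 (addr_ge0 p (mulr_ge0 (sqr_ge0 I) t1)) (sqr_ge0 tau).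
rewrite [leRHS](_ : _ = A * (tau ^+ 2 + I ^+ 3 / tau) + B * (tau + I ^+ 3 / tau ^+ 2)); last by field.
by apply: lerD; exact: ler_wpM2l.
Qed.

Lemma collect_sum (W v A J a2 k I34 D4 X n D2 yc s2 lam lV lU lB lp lI CU T i2 g E I3 Z tau tau2 D5 I1
    I13 T1 a : R) :
  W <= 33/40 * v + (A * J + 264 * a2 + k * I34 + D4 * (X / 4) + n * I34 + D2 * (3/4 * yc)) ->
  33/40 * v <= 33/40 * (- lV + 11/100 * s2) ->
  lam * (I34 + T / 2 * i2) <= lam * (- lU + CU) ->
  D2 * (3/4 * yc) <= D2 * (- lB + (g * (E * (1 + I3)) + a * T * i2 + Z)) ->
  D4 * (X / 4) <= D4 * (- lp + 7 * I1 + 4 * g) ->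
  D5 * I13 <= D5 * (- lI + T1) ->
  A * J + 7 * D4 * I1 <= A * tau2 + 7 * D4 * tau + D5 * I13 ->
  (k + n + D2 * (g * E)) * I34 <= lam * I34 ->
  D2 * a * (T * i2) <= lam / 2 * (T * i2) ->
  D2 * (g * E) * I3 <= D2 * (g * E) * (1 + I34) ->
  W <= (363/4000 * s2 + (lam * CU + 264 * a2 + 4 * (D4 * g) + 2 * (D2 * (g * E))
    + D2 * Z + A * tau2 + 7 * (D4 * tau) + D5 * T1))
  - (33/40 * lV + lam * lU + D2 * lB + D4 * lp + D5 * lI).
Proof. by move=> *; lra. Qed.

Section Collect.
Variables (gamma T1 T3 s2 lam CU D2 D4 D5 A N M kappa a eta tau kQ ky E0 Z : R).
Variables (v I1 I3 i2 X ychi P3 D W lV lU lB lp lI : R).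
Hypotheses (g0 : 0 < gamma) (T30 : 0 < T3) (lam0 : 0 < lam) (M0 : 0 < M) (tau0 : 0 < tau) (kap0 : 0 < kappa).
Hypotheses (eta0 : 0 < eta) (kQ0 : 0 < kQ) (ky0 : 0 < ky) (E00 : 0 <= E0) (I10 : 0 <= I1) (I30 : 0 <= I3) (i20 : 0 <= i2).
Hypotheses (D4E : D4 = 88 * (kQ * M)) (D2E : D2 = 88 / 3 * (ky * M ^+ 2))
  (AE : A = 22 + 132 / (kappa * eta ^+ 2)) (NE : N = 198 * kQ + 22 * ky)
  (D5E : D5 = A / tau + 7 * D4 / tau ^+ 2).
Hypothesis hlam : 132 * kappa + N / M ^+ 2 + D2 * (gamma * E0) <= lam.
Hypothesis hlam2 : D2 * a <= lam / 2.
Hypothesis hV : gamma * v <= - lV + gamma * (11/100 * s2).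
Hypothesis hU : gamma * (I3 ^+ 4 + T3 / 2 * i2) <= - lU + gamma * CU.
Hypothesis hB : 3/4 * gamma * ychi <= - lB + gamma * (gamma * (E0 * (1 + I3)) + a * T3 * i2 + Z).
Hypothesis hp : X / 4 <= - lp + 7 * I1 + 4 * gamma.
Hypothesis hI : gamma * I1 ^+ 3 <= - lI + gamma * T1.
Hypothesis hD : D <= 3 * a ^+ 2 + 3/2 * (kappa * I3 ^+ 4 + I1 ^+ 2 / (kappa * eta ^+ 2)).
Hypothesis hP : P3 <= 4 * D + kQ * (M * X + 9 * (I3 ^+ 4 / M ^+ 2)) + ky * (M ^+ 2 * ychi + I3 ^+ 4 / M ^+ 2).
Hypothesis hW : W <= 33/40 * v + 22 * I1 ^+ 2 + 22 * P3.

(** The coefficients make each error match one dissipated quantity, starting from the factor 22 of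
    the height: 88 = 22 * 4 and 88/3 = 22 * 4/3 undo the gains 1/4 and 3/4, 264 = 22 * 4 * 3, 132 =
    22 * 4 * 3/2, 198 = 22 * 9. The main term is 33/40 * 11/100. *)
Lemma collect : W <= (363/4000 * s2 + (lam * CU + 264 * a ^+ 2 + 4 * (D4 * gamma) + 2 * (D2 * (gamma * E0))
    + D2 * Z + A * tau ^+ 2 + 7 * (D4 * tau) + D5 * T1))
  - (33/40 / gamma * lV + lam / gamma * lU + D2 / gamma * lB + D4 * lp + D5 / gamma * lI).
Proof.
have div (u k w : R) : gamma * u <= - k + gamma * w -> u <= - (k / gamma) + w.
  move=> h; rewrite -(ler_pM2l g0); apply: (le_trans h).
  by rewrite mulrDr mulrN mulrCA divff ?mulr1 // lt0r_neq0.
have qV := div _ _ _ hV; have qU := div _ _ _ hU; have qI := div _ _ _ hI.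
have qB : 3/4 * ychi <= - (lB / gamma) + (gamma * (E0 * (1 + I3)) + a * T3 * i2 + Z).
  by apply: div; rewrite mulrCA mulrA.
have D40 : 0 <= D4 by rewrite D4E !mulr_ge0 // ltW.
have D20 : 0 <= D2 by rewrite D2E !mulr_ge0 ?sqr_ge0 // ltW.
have A0 : 0 <= A by rewrite AE addr_ge0 // divr_ge0 // mulr_ge0 ?sqr_ge0 // ltW.
have D50 : 0 <= D5 by rewrite D5E addr_ge0 // divr_ge0 ?sqr_ge0 ?mulr_ge0 // ltW.
have I34 : 0 <= I3 ^+ 4 by rewrite exprn_ge0.
have fV : 33/40 * v <= 33/40 * (- (lV / gamma) + 11/100 * s2) by rewrite ler_wpM2l.
have fU := ler_wpM2l (ltW lam0) qU; have fB := ler_wpM2l D20 qB.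
have fp := ler_wpM2l D40 hp; have fI := ler_wpM2l D50 qI.
have g7 : 0 <= 7 * D4 by rewrite mulr_ge0.
have fA := power_absorb tau0 A0 g7 I10; rewrite -D5E in fA.
have f1 : (132 * kappa + N / M ^+ 2 + D2 * (gamma * E0)) * I3 ^+ 4 <= lam * I3 ^+ 4 by rewrite ler_wpM2r.
have f2 : D2 * a * (T3 * i2) <= lam / 2 * (T3 * i2) by rewrite ler_wpM2r // mulr_ge0 // ltW.
have f3 : D2 * (gamma * E0) * I3 <= D2 * (gamma * E0) * (1 + I3 ^+ 4).
  rewrite ler_wpM2l ?mulr_ge0 // ?(ltW g0) //.
  have := sqr_ge0 (I3 ^+ 2 - 1 / 2); have := sqr_ge0 (I3 - 1 / 2).
  have -> : I3 ^+ 4 = (I3 ^+ 2) ^+ 2 by ring.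
  rewrite !sqrrB; move: (I3 ^+ 2) => t; lra.
have e1 : 22 * P3 <= 264 * a ^+ 2 + 132 * kappa * I3 ^+ 4 + 132 / (kappa * eta ^+ 2) * I1 ^+ 2
   + D4 * (X / 4) + N / M ^+ 2 * I3 ^+ 4 + D2 * (3/4 * ychi).
  have p22 : (0 : R) <= 22 by []. have p4 : (0 : R) <= 4 by [].
  apply: (le_trans (ler_wpM2l p22 hP)).
  have := ler_wpM2l p22 (ler_wpM2l p4 hD).
  rewrite D4E D2E NE.
  have -> : I1 ^+ 2 / (kappa * eta ^+ 2) = (kappa * eta ^+ 2)^-1 * I1 ^+ 2 by rewrite mulrC.
  have -> : 132 / (kappa * eta ^+ 2) * I1 ^+ 2 = 132 * ((kappa * eta ^+ 2)^-1 * I1 ^+ 2) by rewrite mulrA.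
  have -> : (198 * kQ + 22 * ky) / M ^+ 2 * I3 ^+ 4 = 198 * (kQ * (I3 ^+ 4 / M ^+ 2)) + 22 * (ky * (I3 ^+ 4 / M ^+ 2)).
    by move: (M ^+ 2)^-1 => Mi; ring.
  move: (_^-1 * _) (I3 ^+ 4 / _) => r F h.
  rewrite -subr_ge0; rewrite -subr_ge0 in h.
  by move: h; congr (0 <= _); field.
have e2 : 22 * I1 ^+ 2 + 132 / (kappa * eta ^+ 2) * I1 ^+ 2 = A * I1 ^+ 2 by rewrite AE [RHS]mulrDl.
have e3 : W <= 33/40 * v + (A * I1 ^+ 2 + 264 * a ^+ 2 + 132 * kappa * I3 ^+ 4
   + D4 * (X / 4) + N / M ^+ 2 * I3 ^+ 4 + D2 * (3/4 * ychi)).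
  rewrite -e2; have := lerD hW e1; move: (22 * P3) (22 * I1 ^+ 2) (33/40 * v) => p q r.
  move: (132 / _ * _) (132 * _ * _) (D4 * _) (N / _ * _) (D2 * _) (264 * _) => *; lra.
have -> : 33/40 / gamma * lV + lam / gamma * lU + D2 / gamma * lB + D4 * lp + D5 / gamma * lI =
  33/40 * (lV / gamma) + lam * (lU / gamma) + D2 * (lB / gamma) + D4 * lp + D5 * (lI / gamma) by ring.
exact: collect_sum e3 fV fU fB fp fI fA f1 f2 f3.
Qed.

End Collect.

End PointwiseAlgebra.

(** * Assembly of the Lyapunov function *)

Section Certificate.
Context {R : realType}.
Notation st := (bstate R).

Definition jscale (c : R) (J : @jet R) := jmul (jcst c) J.

Lemma jscale_ok c J : jet_ok J -> jet_ok (jscale c J).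
Proof. by move=> okJ; apply: jmul_ok => //; exact: jcst_ok. Qed.

Lemma jgen_scale gamma T1 T3 c J x : jgen gamma T1 T3 (jscale c J) x = c * jgen gamma T1 T3 J x.
Proof. by rewrite jgen_mul jgen_cst jgam_cst mulr0 !addr0. Qed.

Lemma jconfine_ok : jet_ok (@jconfine R).
Proof.
apply: jadd_ok; apply: jadd_ok.
- by apply: jmul_ok; exact: jI1_ok.
- by apply: jinv_ok; [exact: jI1_ok|exact: jI1_neq0].
- by apply: jmul_ok; exact: jI3_ok.
- by apply: jinv_ok; [exact: jI3_ok|exact: jI3_neq0].
Qed.

Lemma jconfine_ge0 (x : st) : pquad x -> 0 <= jv jconfine x.
Proof.
by case=> h1 h3; rewrite /= !addr_ge0 // ?invr_ge0 ?mulr_ge0 // ltW.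
Qed.

Lemma confine_proper (J : @jet R) (k : R) : 0 < k ->
  (forall x, pquad x -> k * jv jconfine x <= jv J x) ->
  forall c : R, exists a b, [/\ 0 < a, a <= b & forall x, pquad x -> jv J x < c -> box a b x].
Proof.
move=> k0 hJ c; pose K := 1 + `|c / k|.
have K1 : 1 <= K by rewrite lerDl.
have K0 : 0 < K by apply: lt_le_trans K1.
exists K^-1, K; split; first by rewrite invr_gt0.
  by rewrite (le_trans _ K1) // invf_le1.
move=> x px; move/(le_lt_trans (hJ x px)); rewrite mulrC -ltr_pdivlMr // => h.
have {}h : jv jconfine x < K by apply: (lt_le_trans h); rewrite (le_trans (ler_norm _)) // lerDr.
have [h1 h3] := px; move: h; rewrite /=.
have side (I S : R) : 0 < I -> I * I + I^-1 <= S -> S < K -> K^-1 <= I <= K.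
  move=> I0 hS SK; have i0 : 0 < I^-1 by rewrite invr_gt0.
  have i1 : I^-1 <= K by apply: ltW; apply: le_lt_trans SK; apply: le_trans hS; rewrite lerDr mulr_ge0 // ltW.
  apply/andP; split; first by rewrite -[leRHS]invrK lef_pV2 ?posrE.
  rewrite leNgt; apply/negP => KI.
  have : K < I * I + I^-1.
    apply: ltr_wpDr; first exact: ltW.
    by apply: (lt_le_trans KI); rewrite ler_peMl ?(ltW I0) // (le_trans K1) // ltW.
  by rewrite ltNge (le_trans hS) // ltW.
move=> h; split.
  apply: (side _ _ h1 _ h); rewrite lerDl addr_ge0 ?invr_ge0 ?mulr_ge0 // ltW //.
apply: (side _ _ h3 _ h); rewrite lerDr addr_ge0 ?invr_ge0 ?mulr_ge0 // ltW //.
Qed.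

(** Each small constant of the certificate is taken from here; slots with coefficient 0 are
    fillers. *)
Lemma small4 (k1 k2 k3 k4 b1 b2 b3 b4 : R) : 0 <= k1 -> 0 <= k2 -> 0 <= k3 -> 0 <= k4 ->
  0 < b1 -> 0 < b2 -> 0 < b3 -> 0 < b4 ->
  exists e : R, [/\ 0 < e, e <= 1 & forall z, 0 <= z -> z <= e ->
    [/\ k1 * z <= b1, k2 * z <= b2, k3 * z <= b3 & k4 * z <= b4]].
Proof.
have one (k b : R) : 0 <= k -> 0 < b -> exists e : R, [/\ 0 < e, e <= 1 & forall z, 0 <= z -> z <= e -> k * z <= b].
  move=> k0 b0; have bk : 0 < b + k by rewrite ltr_pwDl.
  exists (b / (b + k)); split.
  - exact: divr_gt0.
  - by rewrite ler_pdivrMr // mul1r lerDl.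
  - move=> z z0; rewrite ler_pdivlMr // mulrDr => h.
    apply: le_trans h; rewrite mulrC lerDr mulr_ge0 // ltW //.
move=> h1 h2 h3 h4 p1 p2 p3 p4.
have [e1 [a1 c1 d1]] := one _ _ h1 p1; have [e2 [a2 c2 d2]] := one _ _ h2 p2.
have [e3 [a3 c3 d3]] := one _ _ h3 p3; have [e4 [a4 c4 d4]] := one _ _ h4 p4.
exists (Num.min (Num.min e1 e2) (Num.min e3 e4)); split.
- by rewrite !lt_min a1 a2 a3 a4.
- by rewrite !ge_min c1.
- by move=> z z0; rewrite !le_min => /andP[/andP[? ?] /andP[? ?]]; split; [apply: d1|apply: d2|apply: d3|apply: d4].
Qed.

Definition jtotal s l a eta (c1 c2 c3 c4 c5 c0 : R) : @jet R :=
  jadd (jscale c1 (jcubic s)) (jadd (jscale c2 jconfine) (jadd (jscale c3 (jbarrier l a eta))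
    (jadd (jscale c4 jpsi) (jadd (jscale c5 jI1) (jcst c0))))).

Section Total.
Variables (s a eta c1 c2 c3 c4 c5 : R) (l : seq (@term R)).
Hypotheses (s0 : 0 < s) (c10 : 0 <= c1) (c20 : 0 < c2) (c30 : 0 <= c3) (c40 : 0 <= c4) (c50 : 0 <= c5).
Notation V := (jtotal s l a eta c1 c2 c3 c4 c5 (c1 + c4 * 4)).

Lemma jtotal_ok : jet_ok V.
Proof.
apply: jadd_ok; first exact/jscale_ok/jcubic_ok.
apply: jadd_ok; first exact/jscale_ok/jconfine_ok.
apply: jadd_ok; first exact/jscale_ok/jbarrier_ok.
apply: jadd_ok; first exact/jscale_ok/jpsi_ok.
by apply: jadd_ok; [exact/jscale_ok/jI1_ok|exact: jcst_ok].
Qed.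

Lemma jtotalE x : jv V x = c1 * jv (jcubic s) x + (c2 * jv jconfine x + (c3 * jv (jbarrier l a eta) x
  + (c4 * jv jpsi x + (c5 * x.1.1 + (c1 + c4 * 4))))).
Proof. by []. Qed.

Lemma jtotal_periodic : torus_periodic (jv V).
Proof.
have [b1 b3] := jbarrier_periodic l a eta.
have c2p (t : R) : cos (t + 2 * pi) = cos t by have [] := trig_periodic 1 t; rewrite mul1r.
have s2p (t : R) : sin (t + 2 * pi) = sin t by have [] := trig_periodic 1 t; rewrite mul1r.
split=> i1 i3 t1 t3; rewrite !jtotalE ?b1 ?b3 //.
have -> // : jv jpsi (i1, i3, (t1, t3 + 2 * pi)) = jv jpsi (i1, i3, (t1, t3)).
by rewrite /= c2p s2p.
Qed.

(** The additive constant c1 + 4 c4 offsets the lower bounds -1 and -4 of the polynomial and of the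
    angular function, so positivity and properness come from the confining part. *)
Lemma jtotal_ge x : pquad x -> c2 * jv jconfine x <= jv V x.
Proof.
move=> px; rewrite jtotalE.
have h1 : - c1 <= c1 * jv (jcubic s) x by rewrite -mulrN1 ler_wpM2l // jcubic_ge.
have h3 : 0 <= c3 * jv (jbarrier l a eta) x by rewrite mulr_ge0 // jbarrier_ge0.
have h4 : - (c4 * 4) <= c4 * jv jpsi x by rewrite -mulrN ler_wpM2l //; case/andP: (jpsi_bound x).
have h5 : 0 <= c5 * x.1.1 by rewrite mulr_ge0 // ltW // px.1.
move: h1 h3 h4 h5; move: (c1 * _) (c3 * _) (c4 * jv _ _) (c5 * _) (c4 * 4) (c2 * _) => *; lra.
Qed.

Lemma jgen_total gamma T1 T3 x : jgen gamma T1 T3 V x = c1 * jgen gamma T1 T3 (jcubic s) x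
  + c2 * jgen gamma T1 T3 jconfine x + c3 * jgen gamma T1 T3 (jbarrier l a eta) x
  + c4 * jgen gamma T1 T3 jpsi x + c5 * jgen gamma T1 T3 jI1 x.
Proof. by rewrite /jtotal 5![jgen _ _ _ (jadd (jscale _ _) _) x]jgen_add 5!jgen_scale jgen_cst addr0 !addrA. Qed.

End Total.
End Certificate.

(** * Choice of the constants and the second moment of the height *)

Section Drift.
Context {R : realType}.
Notation st := (bstate R).

Lemma thousandth_le (u : R) : u <= 1 / 1000 -> u <= 100^-1.
Proof. by move=> h; lra. Qed.

Lemma hfun_measurable : measurable_fun setT (@hfun R).
Proof.
have [h1 h3 h5 h7] := @bstate_coord_continuous R; apply: continuous_bstate_measurable => x.
have cs (f : st -> R) : continuous f -> {for x, continuous (fun z => sin (f z))}.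
  by move=> cf; apply: continuous_comp; [exact: cf|exact: continuous_sin].
rewrite (_ : @hfun R = fun z => z.1.1 * sin z.2.1 + z.1.2 * sin z.2.2) //.
apply: (@continuousD R R st (fun z => z.1.1 * sin z.2.1) (fun z => z.1.2 * sin z.2.2)).
  by apply: (@continuousM R st (fun z => z.1.1)); [exact: h1|exact: cs].
by apply: (@continuousM R st (fun z => z.1.2)); [exact: h3|exact: cs].
Qed.

Lemma bump_le1 (w : R) : 0 <= w -> pos (1 / 10 - w) <= 1.
Proof. by move=> w0; rewrite /pos ge_max ler01; lra. Qed.

Lemma cos_affine_sqr (t : R) : (1 + 2 * cos t) ^+ 2 <= 9.
Proof.
rewrite (_ : 9 = 3 ^+ 2); last by ring.
have := cos_geN1 t; have := cos_le1 t => h1 h2.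
by apply: sqr_le_norm; rewrite ler_norml; apply/andP; split; lra.
Qed.

Lemma lam_budget (lam k n D E g : R) : 0 < lam -> k <= lam / 4 -> n <= lam / 4 ->
  D * E * g <= lam / 4 -> k + n + D * (g * E) <= lam.
Proof. by move=> *; lra. Qed.

(** Eleven errors, each at most [s2] / 2000, add 22/4000 to 363/4000. *)
Lemma error_budget (b s2 lam CU D2 D4 D5 A a eta tau gamma E0 T1 T3 : R) : 0 <= s2 ->
  b = s2 / 20 / 100 -> 0 <= a -> a <= 1 -> 0 <= eta -> eta <= 1 -> 0 <= tau -> tau <= 1 -> 0 <= D2 -> 0 <= A ->
  CU * lam <= b -> 264 * a <= b -> 3 * D2 * eta <= b -> 6 * D2 * T3 / a ^+ 2 * eta <= b ->
  7 * D4 * tau <= b -> A * tau <= b -> 4 * D4 * gamma <= b -> 2 * D2 * E0 * gamma <= b ->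
  2 * D2 / eta * T1 <= b -> 3 * D2 / a * T1 <= b -> D5 * T1 <= b ->
  363/4000 * s2 + (lam * CU + 264 * a ^+ 2 + 4 * (D4 * gamma) + 2 * (D2 * (gamma * E0))
    + D2 * (3 * eta ^+ 2 + 2 * (T1 / eta) + 6 * (T3 * eta / a ^+ 2) + 3 * (T1 / a))
    + A * tau ^+ 2 + 7 * (D4 * tau) + D5 * T1) <= 385/4000 * s2.
Proof.
move=> s0 bE a0 a1 e0 e1 t0 t1 D20 A0 h1 h2 h3 h4 h5 h6 h7 h8 h9 h10 h11.
have sq (u : R) : 0 <= u -> u <= 1 -> u ^+ 2 <= u by move=> u0 u1; rewrite expr2 ler_piMl.
have n264 : (0 : R) <= 264 by exact: ler0n.
have k1 : 264 * a ^+ 2 <= b by exact: le_trans (ler_wpM2l n264 (sq _ a0 a1)) h2.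
have k2 : D2 * (3 * eta ^+ 2) <= b.
  by apply: le_trans h3; rewrite mulrA [D2 * 3]mulrC ler_wpM2l ?mulr_ge0 // sq.
have k3 : A * tau ^+ 2 <= b by apply: le_trans h6; rewrite ler_wpM2l // sq.
have r4 : D2 * (6 * (T3 * eta / a ^+ 2)) = 6 * D2 * T3 / a ^+ 2 * eta by ring.
have r9 : D2 * (2 * (T1 / eta)) = 2 * D2 / eta * T1 by ring.
have r10 : D2 * (3 * (T1 / a)) = 3 * D2 / a * T1 by ring.
have r1 : lam * CU = CU * lam by ring.
have r5 : 7 * (D4 * tau) = 7 * D4 * tau by ring.
have r7 : 4 * (D4 * gamma) = 4 * D4 * gamma by ring.
have r8 : 2 * (D2 * (gamma * E0)) = 2 * D2 * E0 * gamma by ring.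
rewrite !mulrDr r4 r9 r10 r1 r5 r7 r8.
move: h1 k1 k2 h4 h5 k3 h7 h8 h9 h10 h11; rewrite bE.
move: (CU * lam) (264 * _) (D2 * _) (_ * eta) (_ * tau) (A * _) (_ * gamma) (_ * gamma) (_ * T1) (_ * T1) (_ * T1).
move: s2 {s0 bE} => z; clear => *; lra.
Qed.

(** The centre is the value of I3 sin theta3 at the attracting angle with I3 replaced by 92/100 s,
    its stationary mean up to rounding. *)
Theorem height_second_moment (T3 : R) : 0 < T3 ->
  let s := T3 `^ (1 / 3) in
  exists eps : R, 0 < eps /\
    forall gamma T1 : R, 0 < gamma -> gamma < eps -> 0 < T1 -> T1 < eps ->
    forall P : probability st R, invariant_broken gamma T1 T3 P ->
      (\int[P]_x ((@hfun R x + Num.sqrt 3 / 2 * (92/100 * s)) ^+ 2)%:E <= (385/4000 * s ^+ 2)%:E)%E.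
Proof.
move=> T30 s; have s0 : 0 < s by exact: powR_gt0.
have sT : s ^+ 3 = T3.
  by rewrite -powR_mulrn ?powR_ge0 // -powRrM mul1r mulVf // powRr1 // ltW.
have s20 : 0 < s ^+ 2 by rewrite exprn_gt0.
pose b := s ^+ 2 / 20 / 100; have b0 : 0 < b by exact: divr_gt0 (divr_gt0 s20 (ltr0Sn _ _)) (ltr0Sn _ _).
have [sigma [sg0 sg1]] : exists sigma : R, 0 < sigma /\ sigma <= 1 / 1000 by exists (1000^-1); rewrite invr_gt0 ltr0Sn div1r lexx.
(* The values 20 and 1600 are hidden behind an existential, like [sigma] above, so that later
   arithmetic treats them as atoms. *)
have [kQ [ky [kQ0 ky0 hang]]] : exists kQ ky : R, [/\ 0 < kQ, 0 < ky &
    forall p q y : R, p <= 20 * q ^+ 2 + 1600 * y ^+ 2 -> p <= kQ * q ^+ 2 + ky * y ^+ 2].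
  by exists 20, 1600; split; [exact: ltr0Sn|exact: ltr0Sn|].
pose CU := (1 + 5 / 2 * T3) ^+ 2 + 4.
have CU0 : 0 < CU by rewrite ltr_wpDl ?sqr_ge0.
(* The coefficient of the confining function comes first: it must be small for its own cost, and it
   then fixes the budget of the rest. A quarter of it on I3^4 goes to each of [kap], M and [gamma],
   and half of it on I3^-2 goes to [a]. *)
have [lam [lam0 lam1 /(_ lam (ltW lam0) (lexx _))[hl _ _ _]]] :=
  small4 (ltW CU0) (lexx 0) (lexx 0) (lexx 0) b0 b0 b0 b0.
have l4 : 0 < lam / 4 by rewrite divr_gt0.
have l2 : 0 < lam / 2 by rewrite divr_gt0.
pose N := 198 * kQ + 22 * ky; have N0 : 0 < N by exact: addr_gt0 (mulr_gt0 (ltr0Sn _ _) kQ0) (mulr_gt0 (ltr0Sn _ _) ky0).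
have [kap [kap0 kap1 /(_ kap (ltW kap0) (lexx _))[hkap _ _ _]]] :=
  @small4 R 132 0 0 0 (lam / 4) 1 1 1 (ler0n _ _) (lexx 0) (lexx 0) (lexx 0) l4 ltr01 ltr01 ltr01.
have [m [m0 m1 /(_ m (ltW m0) (lexx _))[hm _ _ _]]] :=
  @small4 R N 0 0 0 (lam / 4) 1 1 1 (ltW N0) (lexx 0) (lexx 0) (lexx 0) l4 ltr01 ltr01 ltr01.
pose M := m^-1; have M1 : 1 <= M by rewrite -invr1 lef_pV2 ?posrE.
have M0 : 0 < M by rewrite invr_gt0.
have hM : N / M ^+ 2 <= lam / 4.
  apply: le_trans hm; rewrite /M exprVn invrK ler_wpM2l ?(ltW N0) // expr2 ler_piMl // ltW //.
pose D4 := 88 * (kQ * M); have D40 : 0 < D4 by exact: mulr_gt0 (ltr0Sn _ _) (mulr_gt0 kQ0 M0).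
pose D2 := 88 / 3 * (ky * M ^+ 2); have D20 : 0 < D2 by exact: mulr_gt0 (divr_gt0 (ltr0Sn _ _) (ltr0Sn _ _)) (mulr_gt0 ky0 (exprn_gt0 _ M0)).
have [a [a0 a1 /(_ a (ltW a0) (lexx _))[ha1 ha2 _ _]]] :=
  @small4 R D2 264 0 0 (lam / 2) b 1 1 (ltW D20) (ler0n _ _) (lexx 0) (lexx 0) l2 b0 ltr01 ltr01.
have as0 : 0 < a * (sigma / 4) by rewrite mulr_gt0 // divr_gt0.
have d1 : 0 <= 3 * D2 by rewrite mulr_ge0 // ltW.
have d2 : 0 <= 6 * D2 * T3 / a ^+ 2 by rewrite !mulr_ge0 ?invr_ge0 ?sqr_ge0 // ltW.
have [eta [eta0 eta1 /(_ eta (ltW eta0) (lexx _))[he1 he2 he3 _]]] :=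
  small4 (ler01 : (0 : R) <= 1) d1 d2 (lexx 0) as0 b0 b0 b0.
rewrite mul1r in he1.
pose A := 22 + 132 / (kap * eta ^+ 2).
have A0 : 0 <= A by exact: addr_ge0 (ler0n _ _) (divr_ge0 (ler0n _ _) (mulr_ge0 (ltW kap0) (sqr_ge0 _))).
have d3 : 0 <= 7 * D4 by rewrite mulr_ge0 // ltW.
have [tau [tau0 tau1 /(_ tau (ltW tau0) (lexx _))[ht1 ht2 _ _]]] :=
  small4 d3 A0 (lexx 0) (lexx 0) b0 b0 b0 b0.
pose D5 := A / tau + 7 * D4 / tau ^+ 2.
have D50 : 0 <= D5 by rewrite addr_ge0 // divr_ge0 ?sqr_ge0 // ltW.
pose E0 := barrier_err a T3 ((4 / sigma) ^+ 2 * (8 * sigma)).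
have E00 : 0 <= E0 by exact: barrier_err_ge0.
have d4 : 0 <= 4 * D4 by rewrite mulr_ge0 // ltW.
have d5 : 0 <= 2 * D2 * E0 by rewrite !mulr_ge0 // ltW.
have d6 : 0 <= D2 * E0 by rewrite !mulr_ge0 // ltW.
have [eg [eg0 eg1 heg]] := small4 d4 d5 d6 (lexx 0) b0 b0 l4 b0.
have d7 : 0 <= 2 * D2 / eta by rewrite divr_ge0 ?mulr_ge0 // ltW.
have d8 : 0 <= 3 * D2 / a by rewrite divr_ge0 // ltW.
have [et [et0 et1 het]] := small4 d7 d8 D50 (lexx 0) b0 b0 b0 b0.
exists (Num.min eg et); split; first by rewrite lt_min eg0.
move=> gamma T1 g0; rewrite lt_min => /andP[/ltW geg _] T10.
rewrite lt_min => /andP[_ /ltW Tet] P invP.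
have [hg1 hg2 hg3 _] := heg _ (ltW g0) geg.
have [hT1 hT2 hT3 _] := het _ (ltW T10) Tet.
have T11 : T1 <= 1 by exact: le_trans et1.
have s100 : sigma <= 100^-1 by exact: thousandth_le.
(* The tolerance is [gamma] itself. The sum [l] varies with [gamma], but the constants above see it
   only through its norm bound. *)
have [l [nl res]] := repelling_curve sg0 s100 g0.
pose c1 := 33 / 40 / gamma; pose c2 := lam / gamma; pose c3 := D2 / gamma; pose c5 := D5 / gamma.
have c10 : 0 <= c1 by rewrite divr_ge0 // ltW.
have c20 : 0 < c2 by rewrite divr_gt0.
have c30 : 0 <= c3 by rewrite divr_ge0 // ltW.
have c50 : 0 <= c5 by rewrite divr_ge0 // ltW.
have hV x : pquad x ->
    c2 * jv jconfine x <= jv (jtotal s l a eta c1 c2 c3 D4 c5 (c1 + D4 * 4)) x.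
  by apply: jtotal_ge => //; exact: ltW.
have hlam : 132 * kap + N / M ^+ 2 + D2 * (gamma * E0) <= lam.
  exact: lam_budget lam0 hkap hM hg3.
apply: (lyapunov_bound g0 T10 T30 invP (jtotal_ok s a eta c1 c2 c3 D4 c5 l)).
- exact: jtotal_periodic.
- by move=> x px; apply: le_trans (hV x px); rewrite mulr_ge0 ?jconfine_ge0 // ltW.
- exact: confine_proper c20 hV.
- by apply: measurable_funX; apply: measurable_funD; [exact: hfun_measurable|exact: measurable_cst].
- by move=> x; exact: sqr_ge0.
- exact: mulr_ge0 (divr_ge0 (ler0n _ _) (ler0n _ _)) (ltW s20).
move=> x px; have [I10 I30] := px.
rewrite jgen_total.
set Z := 3 * eta ^+ 2 + 2 * (T1 / eta) + 6 * (T3 * eta / a ^+ 2) + 3 * (T1 / a).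
have bud := error_budget (ltW s20) (erefl b) (ltW a0) a1 (ltW eta0) eta1 (ltW tau0) tau1 (ltW D20) A0
  hl ha2 he2 he3 ht1 ht2 hg1 hg2 hT1 hT2 hT3.
apply: (le_trans _ (lerD bud (lexx _))) => {bud}.
have fV := cubic_drift T1 g0 s0 sT px.
have fU := confine_drift T3 g0 T10 T11 px.
have fB := barrier_drift g0 T10 T11 T30 sg0 sg1 a0 eta0 eta1 he1 nl res px.
have fp := psi_drift T1 T3 px g0.
have fI := first_drift gamma T1 T3 x.
set y := pos (1/10 - jv (jdist l) x) in fB.
set k1 := pos (1 - x.1.1 / eta) in fB.
set k3 := pos (1 - a ^+ 2 * x.1.2^-1 ^+ 2) in fB.
have fa : 0 < k1 -> 0 < k3 -> (sin x.2.2 + Num.sqrt 3 / 2) ^+ 2 <= kQ * (1 + 2 * cos x.2.2) ^+ 2 + ky * y ^+ 2.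
  by move=> p1 p3; apply: hang; exact: (cutoff_angle sg0 sg1 a0 eta0 he1 nl px p1 p3).
have Ii : x.1.2 * x.1.2^-1 = 1 by rewrite mulfV // lt0r_neq0.
have pos_itv (u : R) : 0 <= u -> 0 <= pos (1 - u) <= 1 /\ 1 - u <= pos (1 - u).
  move=> u0; rewrite pos_ge0 /pos le_max lexx orbT ge_max ler01 gerBl u0 //.
have [k1b k1g] := pos_itv _ (divr_ge0 (ltW I10) (ltW eta0)).
have [k3b k3g] := pos_itv _ (mulr_ge0 (sqr_ge0 a) (sqr_ge0 x.1.2^-1)).
have fD := cutoff_loss I30 Ii (ltW I10) eta0 kap0 k1b k3b k1g k3g.
have chib : 0 <= k1 ^+ 3 * k3 ^+ 3 <= 1.
  by case/andP: k1b => ? ?; case/andP: k3b => ? ?; rewrite mulr_ge0 ?exprn_ge0 // mulr_ile1 ?exprn_ge0 // exprn_ile1.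
have y1 : y ^+ 2 <= 1.
  have w0 : 0 <= jv (jdist l) x by rewrite jdistE dist_ge0 // cos2Dsin2.
  by rewrite expr_le1 ?pos_ge0 // /y; exact: bump_le1.
have Q9 : (1 + 2 * cos x.2.2) ^+ 2 <= 9 by exact: cos_affine_sqr.
have fA : 0 < k1 ^+ 3 * k3 ^+ 3 ->
    (sin x.2.2 + Num.sqrt 3 / 2) ^+ 2 <= kQ * (1 + 2 * cos x.2.2) ^+ 2 + ky * y ^+ 2.
  move=> chi0; apply: fa; rewrite lt_neqAle eq_sym pos_ge0 andbT; apply/eqP => k0; move: chi0;
    by rewrite k0 expr0n /= ?mul0r ?mulr0 ltxx.
have fP := angle_split I30 M1 (ltW kQ0) (ltW ky0) chib y1 Q9 (sin_shift_sqr x.2.2) fA.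
have s1b : -1 <= sin x.2.1 <= 1 by rewrite sin_geN1 sin_le1.
have fW := height_split x.1.1 x.1.2 (sin x.2.2 + Num.sqrt 3 / 2) s1b (erefl (Num.sqrt 3 / 2 * (92/100 * s))).
rewrite addrK -[_ + _ * sin x.2.2]/(hfun x) in fW.
have i20 : 0 <= x.1.2^-1 ^+ 2 by exact: sqr_ge0.
exact: (collect g0 T30 lam0 M0 tau0 kap0 kQ0 ky0 E00 (ltW I10) (ltW I30) i20 erefl erefl erefl erefl erefl
  hlam ha1 fV fU fB fp fI fD fP fW).
Qed.

End Drift.
(** * Variance *)

Section Variance.
Context {R : realType}.
Notation st := (bstate R).
Variable P : probability st R.

(** The mean minimises the second moment: with d the mean of h - m0, replacing [m0] by the mean of h
    lowers it by d^2. Integrability must come first, since [fine] would turn an infinite mean into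
    0. *)
Lemma variance_le (h : st -> R) (m0 C : R) : measurable_fun setT h ->
  (\int[P]_x ((h x - m0) ^+ 2)%:E <= C%:E)%E -> (variance_of P h <= C%:E)%E.
Proof.
move=> mh hC; pose Y x := h x - m0.
have mY : measurable_fun setT Y by apply: measurable_funB => //; exact: measurable_cst.
have mY2 : measurable_fun setT (fun x => Y x ^+ 2) by exact: measurable_funX.
have iY2 : P.-integrable setT (EFin \o (fun x => Y x ^+ 2)).
  apply/integrableP; split; first exact/measurable_EFinP.
  rewrite (eq_integral (fun x => ((h x - m0) ^+ 2)%:E)); first exact: le_lt_trans hC (ltry _).
  by move=> x _ /=; rewrite ger0_norm // sqr_ge0.
have icst (c : R) : P.-integrable setT (EFin \o cst c) by exact: finite_measure_integrable_cst.
have iY : P.-integrable setT (EFin \o Y).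
  apply: (@le_integrable _ _ _ P setT _ _ (EFin \o (fun x => Y x ^+ 2 + 1))) => //.
  - exact/measurable_EFinP.
  - move=> x _ /=; rewrite lee_fin [leRHS]ger0_norm ?addr_ge0 ?sqr_ge0 //.
    rewrite ler_norml; have := sqr_ge0 (Y x - 1); have := sqr_ge0 (Y x + 1).
    rewrite sqrrB sqrrD expr1n mulr1 => h1 h2; have := sqr_ge0 (Y x) => h3.
    by apply/andP; split; lra.
  - exact: (integrableD _ iY2 (icst 1)).
pose e := (\int[P]_x (Y x)%:E)%E.
have efin : e \is a fin_num by exact: integrable_fin_num.
have int_cst (c : R) : (\int[P]_x (cst c x)%:E = c%:E)%E.
  by rewrite (eq_integral (cst c%:E)) // integral_cst //= probability_setT mule1.
have Eh : fine (\int[P]_x (h x)%:E) = fine e + m0.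
  rewrite (eq_integral ((EFin \o Y) \+ (EFin \o cst m0))%E); last first.
    by move=> x _; rewrite /= -EFinD /Y subrK.
  rewrite (integralD_EFin measurableT iY (icst m0)) fineD //; last exact: integrable_fin_num.
  by rewrite int_cst.
rewrite /variance_of Eh.
set d := fine e.
apply: le_trans hC.
pose Z x := - (2 * d) * Y x + d ^+ 2.
have iZ1 : P.-integrable setT (EFin \o (fun x => - (2 * d) * Y x)).
  exact: (integrableZl measurableT (- (2 * d)) iY).
have iZ : P.-integrable setT (EFin \o Z) by exact: (integrableD measurableT iZ1 (icst (d ^+ 2))).
have EZ : (\int[P]_x (Z x)%:E = (- d ^+ 2)%:E)%E.
  rewrite (eq_integral ((EFin \o (fun x => (- (2 * d) * Y x)%R)) \+ (EFin \o cst (d ^+ 2)%R))%E) //.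
  rewrite (integralD_EFin measurableT iZ1 (icst (d ^+ 2))).
  rewrite int_cst.
  rewrite (eq_integral (fun x => ((- (2 * d))%:E * (EFin \o Y) x)%E)); last by move=> x _; rewrite /= EFinM.
  rewrite integralZl // -/e -(fineK efin) -/d -EFinM -EFinD; congr (_%:E); ring.
rewrite (eq_integral ((EFin \o (fun x => (Y x ^+ 2)%R)) \+ (EFin \o Z))%E); last first.
  by move=> x _; rewrite /= -EFinD /Z /Y; congr (_%:E); ring.
rewrite (integralD_EFin measurableT iY2 iZ) EZ.
by rewrite geeDl // lee_fin oppr_le0 sqr_ge0.
Qed.

End Variance.

Theorem theorem5p11 (R : realType) (T3 : R) : 0 < T3 ->
  exists eps : R, 0 < eps /\
    forall gamma T1 : R, 0 < gamma -> gamma < eps -> 0 < T1 -> T1 < eps ->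
    forall P : probability (bstate R) R, invariant_broken gamma T1 T3 P ->
      (variance_of P (@hfun R) < (T3 `^ (2 / 3) / 10)%:E)%E.
Proof.
move=> T30; have [eps [eps0 H]] := height_second_moment T30.
exists eps; split=> // gamma T1 g0 g1 T10 T11 P invP.
have := H gamma T1 g0 g1 T10 T11 P invP; set s := T3 `^ (1 / 3) => hC.
have s20 : 0 < s ^+ 2 by rewrite exprn_gt0 // powR_gt0.
have -> : T3 `^ (2 / 3) = s ^+ 2.
  by rewrite /s -powR_mulrn ?powR_ge0 // -powRrM; congr (_ `^ _); field.
apply: (@le_lt_trans _ _ (385/4000 * s ^+ 2)%:E); last by rewrite lte_fin; lra.
apply: (@variance_le _ _ _ (- (Num.sqrt 3 / 2 * (92/100 * s)))); first exact: hfun_measurable.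
by under eq_integral do rewrite opprK.
Qed.
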